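(* Let $\{X_t\}_{t\ge 0}$ be a continuous-time Markov process on $\{0,1,2,\dots\}$, started at $0$, with generator $Q=((q_{ij}))_{0\le i,j<\infty}$ satisfying, for all $i\ge 0$, $q_{i,i+1}>0$, $q_{ij}=0$ if $j>i+1$, and $\sum_{j=0}^{i+1}q_{ij}=0$. Let $n\ge 3$, let $T_n$ be the first time the process reaches state $n$, let $l_{T_n}^i$ be the amount of time the process spends in state $i$ before it reaches $n$, and let $Q_n=((q_{ij}))_{0\le i,j\le n-1}$ be the upper $n\times n$ submatrix of $Q$. Then the finite sequence of random variables $\left\{l_{T_n}^i\right\}_{0\le i\le n-1}$ (indexed by $i$) is a Markov chain if and only if $Q_n$ is a tridiagonal matrix.
   Context: A generator matrix $Q=((q_{ij}))$ has $q_{ij}\ge 0$ for $i\ne j$: from state $i$ the process waits an exponential time with rate $-q_{ii}$ and then jumps to $j\neq i$ with probability $q_{ij}/(-q_{ii})$. The occupation time is $l_{T_n}^i=\int_0^{T_n}1_{\{X_s=i\}}\,ds$. The sequence $\{l_{T_n}^i\}_{0\le i\le n-1}$ is a Markov chain (satisfies the Markov property) if for every $1\le k\le n-1$ the conditional distribution of $l_{T_n}^k$ given $(l_{T_n}^{k-1},l_{T_n}^{k-2},\dots,l_{T_n}^0)$ equals the conditional distribution of $l_{T_n}^k$ given $l_{T_n}^{k-1}$ (the chain need not be time-homogeneous). $Q_n$ is tridiagonal if $q_{ij}=0$ whenever $0\le i,j\le n-1$ and $|i-j|\ge 2$. *)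

(* Defs.v *)
From HB Require Import structures.
From mathcomp Require Import all_boot all_order all_algebra.
From mathcomp Require Import all_classical all_reals all_analysis.
From mathcomp Require Import measurable_realfun.

Set Implicit Arguments.
Unset Strict Implicit.
Unset Printing Implicit Defensive.
Import Order.TTheory GRing.Theory Num.Theory.
Import numFieldNormedType.Exports.

Local Open Scope classical_set_scope.
Local Open Scope ring_scope.

(* A generator on {0, 1, 2, ...} is an infinite matrix Q : nat -> nat -> R. *)

Definition jump_prob (R : realType) (Q : nat -> nat -> R) (i j : nat) : R :=
  if j == i then 0 else Q i j / - Q i i.

(* Joint law of the successive states Y_0, Y_1, ... and holding times
   S_0, S_1, ... of the chain with generator Q started at i0: Y is a Markov
   chain with transition matrix jump_prob Q and, conditionally on Y, the S_k
   are independent, S_k being exponential with rate - q_{Y_k Y_k}. *)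
Definition jump_hold_law d (Omega : measurableType d) (R : realType)
    (P : probability Omega R) (Q : nat -> nat -> R) (i0 : nat)
    (Y : nat -> {RV P >-> nat}) (S : nat -> {RV P >-> R}) : Prop :=
  forall (m : nat) (y : nat -> nat) (B : nat -> set R),
    (forall k, measurable (B k)) ->
    P [set w | (forall k, (k <= m)%N -> Y k w = y k) /\
               (forall k, (k < m)%N -> B k (S k w))] =
    (((y 0%N == i0)%:R * \prod_(k < m) jump_prob Q (y k) (y k.+1))%:E *
     \prod_(k < m) exponential_prob (- Q (y k) (y k)) (B k))%E.

Definition jump_time d (Omega : measurableType d) (R : realType)
    (P : probability Omega R) (S : nat -> {RV P >-> R}) (k : nat) (w : Omega)
    : R :=
  \sum_(m < k) S m w.

(* (X_t)_{t >= 0} is a right-continuous Markov process with generator Q started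
   at i0, in its jump chain / holding time description.  Q may be explosive:
   nothing but right-continuity is required of X after the first explosion time
   sup_k J_k.  The values of X at negative times are irrelevant. *)
Definition markov_jump_process d (Omega : measurableType d) (R : realType)
    (P : probability Omega R) (Q : nat -> nat -> R) (i0 : nat)
    (X : R -> Omega -> nat) : Prop :=
  [/\ forall t, 0 <= t -> measurable_fun [set: Omega] (X t),
      forall w t, 0 <= t ->
        exists2 e, 0 < e & forall s, t <= s < t + e -> X s w = X t w
    & exists (Y : nat -> {RV P >-> nat}) (S : nat -> {RV P >-> R}),
        jump_hold_law Q i0 Y S /\
        {ae P, forall w, forall k t,
           jump_time S k w <= t < jump_time S k.+1 w -> X t w = Y k w}].

(* T_n, equal to +oo on paths that never reach n. *)
Definition hitting_time (Omega : Type) (R : realType) (X : R -> Omega -> nat)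
    (n : nat) (w : Omega) : \bar R :=
  ereal_inf [set t%:E | t in [set t | 0 <= t /\ X t w = n]].

Definition occupation_time (Omega : Type) (R : realType)
    (X : R -> Omega -> nat) (n i : nat) (w : Omega) : \bar R :=
  (\int[lebesgue_measure]_(s in [set s : R | (0 <= s)%R /\
                                             s%:E < hitting_time X n w])
     (\1_[set s | X s w = i] s)%:E)%E.

(* kappa is a (regular) conditional distribution of Y given Z. *)
Definition cond_distribution d (Omega : measurableType d) (R : realType)
    (P : probability Omega R) d1 (E : measurableType d1)
    d2 (F : measurableType d2) (Y : Omega -> F) (Z : Omega -> E)
    (kappa : R.-pker E ~> F) : Prop :=
  forall (B : set E) (C : set F), measurable B -> measurable C ->
    P (Z @^-1` B `&` Y @^-1` C) = (\int[P]_(w in Z @^-1` B) kappa (Z w) C)%E.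

(* (l_{k-1}, l_{k-2}, ..., l_0) *)
Definition past (Omega E : Type) (l : nat -> Omega -> E) (k : nat)
    (w : Omega) : k.-tuple E :=
  [tuple l (k.-1 - i)%N w | i < k].

(* The finite sequence l_0, ..., l_{n-1} is a (possibly time-inhomogeneous)
   Markov chain.  The conditional distributions are compared almost surely,
   since they are only determined up to null sets. *)
Definition finite_markov_chain d (Omega : measurableType d) (R : realType)
    (P : probability Omega R) d1 (E : measurableType d1) (n : nat)
    (l : nat -> Omega -> E) : Prop :=
  forall k, (1 <= k <= n.-1)%N ->
    exists (kpast : R.-pker (k.-tuple E) ~> E) (klast : R.-pker E ~> E),
      [/\ cond_distribution P (l k) (past l k) kpast,
          cond_distribution P (l k) (l k.-1) klast
        & {ae P, forall w, forall C, measurable C ->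
             kpast (past l k w) C = klast (l k.-1 w) C}].

Definition upper_submatrix (R : Type) (Q : nat -> nat -> R) (n : nat)
    : 'M[R]_n :=
  \matrix_(i < n, j < n) Q i j.

Definition is_tridiag_mx (R : realType) (n : nat) (A : 'M[R]_n) : Prop :=
  forall i j : 'I_n, (2 <= `|i - j|)%N -> A i j = 0.

(* Main.v *)
(** Given the numbers of visits V_i to the states i < n before T_n, the occupation
    times l^i are independent, l^i being a sum of V_i exponential variables of
    rate - q_ii.  Fix a = k - 1 and write r = - q_aa.

    If no jump leads from {a+1, ..., n-1} to {0, ..., a-1}, every excursion from a
    stays on one side of a.  Among the m + 1 visits to a, the choice of the D
    upward excursions contributes a binomial coefficient, so that the density of
    l^a at x on the event that (l^0, ..., l^{a-1}) is in A and l^{a+1} in C is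
    r e^{-rx} times a Cauchy product of exponential series in rx, one factor
    depending on A only and the other on C only.  The second factor, normalised,
    is the transition kernel.

    Conversely, let f(A, C) be this density.  The Markov property gives
    f(A, C) f(T, T) = f(A, T) f(T, C) for almost every x, where T stands for no
    constraint.  Take for A and C the constraints that the occupation times are at
    most e: as e tends to 0 they become "each state below a is visited once" and
    "a+1 is visited once".  Now let x tend to 0.  The terms of order 0, in which a
    is visited once, cancel, but if q_{a+1,j} > 0 for some j < a, then in the terms
    of order 1, in which a is visited twice, the paths with an excursion through
    a+1 -> j violate both constraints and make them strictly positively
    correlated, a contradiction. *)

Require Import Defs.
From HB Require Import structures.
From mathcomp Require Import all_boot all_order all_algebra.
From mathcomp Require Import all_classical all_reals all_analysis.
From mathcomp Require Import measurable_realfun.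
From mathcomp Require Import ring lra zify.

Import Order.TTheory GRing.Theory Num.Theory.
Import numFieldNormedType.Exports.
Local Open Scope classical_set_scope.
Local Open Scope ring_scope.

Set Implicit Arguments.
Unset Strict Implicit.
Unset Printing Implicit Defensive.

(** * Functionals of the visit numbers before a hitting time *)

(** No space of paths is built. Probabilities about the jump chain are values of [hit], applied to
    functionals of the final state and of the visit numbers. Identities between them come from the
    uniqueness of bounded solutions of the first-step equation ([hit_uniq]), inequalities from
    invariants of the visit numbers ([hit_mono]). Holding times enter only through one gamma law per
    state, evaluated at its visit number ([law_functional]). Both directions use one explicit
    density in the time spent in a, [chain_density], with constraints on the states below a and on
    a+1 only. Two obstacles shape the converse. The product identity holds outside a null set that
    depends on the constraints, so the windows [0, e] run through a sequence. And the probability of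
    the constraints may vanish with e, so the factor contributed by states visited once is divided
    out before the limit. A forbidden entry q_{ij} with j <= i-2 is excluded by the step from a =
    i-1 to i. *)

Definition incr (i : nat) (c : nat -> nat) : nat -> nat :=
  fun j => ((j == i) + c j)%N.

Lemma incr_addn i c c' :
  (fun j => (incr i c j + c' j)%N) = incr i (fun j => (c j + c' j)%N).
Proof. by apply/funext => j; rewrite /incr addnA. Qed.

(* Weighted sum, over the paths that start at [i] and reach [st] in fewer than
   [K] steps, of a functional [G] of the final state and of the numbers of
   visits to each state (the final state being not counted). *)
Fixpoint hit_sum (R : realType) (p : nat -> nat -> R) (st : pred nat)
    (K i : nat) (G : nat -> (nat -> nat) -> R) : R :=
  if K is K'.+1 then
    if st i then G i (fun=> 0%N)
    else \sum_(j < i.+2) p i j * hit_sum p st K' j (fun t c => G t (incr i c))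
  else 0.

Definition hit (R : realType) (p : nat -> nat -> R) (st : pred nat)
    (i : nat) (G : nat -> (nat -> nat) -> R) : R :=
  limn (fun K => hit_sum p st K i G).

Lemma cvg_sum_ord (R : realType) m (f : 'I_m -> nat -> R) (l : 'I_m -> R) :
  (forall j, f j K @[K --> \oo] --> l j) ->
  (\sum_(j < m) f j K) @[K --> \oo] --> \sum_(j < m) l j.
Proof.
elim: m f l => [|m IH] f l fl.
  by under eq_cvg do rewrite big_ord0; rewrite big_ord0; exact: cvg_cst.
under eq_cvg do rewrite big_ord_recl; rewrite big_ord_recl.
by apply: cvgD; [exact: fl|apply: (IH (fun j => f (lift ord0 j)) (fun j => l (lift ord0 j))) => j; exact: fl].
Qed.

(** For [G >= 0] the truncations increase with [K]; the upper bound keeps them bounded, so that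
    [hit] is a genuine limit. *)
Definition in01 (R : realType) (G : nat -> (nat -> nat) -> R) :=
  forall t c, 0 <= G t c <= 1.

Lemma in01_incr (R : realType) (G : nat -> (nat -> nat) -> R) i :
  in01 G -> in01 (fun t c => G t (incr i c)).
Proof. by move=> G01 t c; exact: G01. Qed.

Section hit_sum.
Variables (R : realType) (p : nat -> nat -> R) (st : pred nat) (n : nat).
Hypothesis p_ge0 : forall i j, 0 <= p i j.
Hypothesis p_sum : forall i, \sum_(j < i.+2) p i j = 1.
Hypothesis p_up : forall i, 0 < p i i.+1.
Hypothesis st_n : st n.

Local Notation hs := (hit_sum p st).
Local Notation h := (hit p st).
Local Notation shift i G := (fun t c => G t (incr i c)).

(** [Pos] is an invariant linking start, final state and visit numbers. Being preserved when a first
    step of positive probability is added, it holds along every path that contributes, so [G] and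
    [G'] need only be compared there. *)
Lemma hit_sum_mono (Pos : nat -> nat -> (nat -> nat) -> Prop) :
  (forall i, (i <= n)%N -> st i -> Pos i i (fun=> 0%N)) ->
  (forall i j t c, (i < n)%N -> ~~ st i -> (j <= i.+1)%N -> 0 < p i j ->
     Pos j t c -> Pos i t (incr i c)) ->
  forall K i G G', (i <= n)%N -> (forall t c, Pos i t c -> G t c <= G' t c) ->
    hs K i G <= hs K i G'.
Proof.
move=> Pos0 PosS; elim=> [//|K IH] i G G' ile GG' /=.
case: ifPn => sti; first by apply: GG'; exact: Pos0.
have iltn : (i < n)%N.
  by rewrite ltn_neqAle ile andbT; apply: contraNneq sti => ->.
apply: ler_sum => j _.
have [pij|] := ltP 0 (p i j); last first.
  by move=> pij; rewrite (_ : p i j = 0) ?mul0r//; apply/eqP; rewrite eq_le pij p_ge0.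
apply: ler_wpM2l => //; apply: IH => [|t c Pc].
  by apply: leq_trans iltn; have := ltn_ord j; rewrite ltnS.
by apply: GG'; apply: (PosS i j) => //; rewrite -ltnS.
Qed.

Lemma ler_hit_sum K i G G' : (forall t c, G t c <= G' t c) ->
  hs K i G <= hs K i G'.
Proof.
elim: K i G G' => [//|K IH] i G G' GG' /=; case: ifP => // _.
by apply: ler_sum => j _; apply: ler_wpM2l => //; apply: IH.
Qed.

Lemma hit_sumD K i G G' : hs K i (fun t c => G t c + G' t c) =
  hs K i G + hs K i G'.
Proof.
elim: K i G G' => [|K IH] i G G' /=; first by rewrite addr0.
case: ifP => // _; rewrite -big_split/=; apply: eq_bigr => j _.
by rewrite IH mulrDr.
Qed.

Lemma hit_sumZ K i a G : hs K i (fun t c => a * G t c) = a * hs K i G.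
Proof.
elim: K i G => [|K IH] i G /=; first by rewrite mulr0.
case: ifP => // _; rewrite mulr_sumr; apply: eq_bigr => j _.
by rewrite IH mulrCA.
Qed.

Lemma hit_sum0 K i : hs K i (fun _ _ => 0) = 0.
Proof.
rewrite -[RHS](mul0r (hs K i (fun _ _ => 0))) -hit_sumZ.
by congr hit_sum; apply/funext => t; apply/funext => c; rewrite mul0r.
Qed.

Lemma hit_sum_ge0 K i G : (forall t c, 0 <= G t c) -> 0 <= hs K i G.
Proof. by move=> G0; rewrite -(hit_sum0 K i); exact: ler_hit_sum. Qed.

Lemma hit_sum1_le1 K i : hs K i (fun _ _ => 1) <= 1.
Proof.
elim: K i => [|K IH] i /=; first by rewrite ler01.
case: ifP => // _; rewrite -[leRHS](p_sum i); apply: ler_sum => j _.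
by rewrite -[leRHS]mulr1; apply: ler_wpM2l => //; exact: IH.
Qed.

Lemma hit_sum_le1 K i G : in01 G -> hs K i G <= 1.
Proof.
move=> G01; apply: le_trans (hit_sum1_le1 K i); apply: ler_hit_sum => t c.
by have /andP[] := G01 t c.
Qed.

Lemma hit_sumS K i G : (forall t c, 0 <= G t c) -> hs K i G <= hs K.+1 i G.
Proof.
elim: K i G => [|K IH] i G G0; first exact: hit_sum_ge0.
rewrite /=; case: ifP => // _; apply: ler_sum => j _.
by apply: ler_wpM2l => //; apply: IH.
Qed.

Lemma nondecreasing_hit_sum i G : (forall t c, 0 <= G t c) ->
  nondecreasing_seq (fun K => hs K i G).
Proof. by move=> G0; apply/nondecreasing_seqP => K; exact: hit_sumS. Qed.

Lemma cvg_hit i G : in01 G -> hs K i G @[K --> \oo] --> h i G.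
Proof.
move=> G01; apply: nondecreasing_is_cvgn.
  by apply: nondecreasing_hit_sum => t c; have /andP[] := G01 t c.
by exists 1 => _ [K _ <-]; exact: hit_sum_le1.
Qed.

Lemma hit_sum_le_hit K i G : in01 G -> hs K i G <= h i G.
Proof.
move=> G01; apply: nondecreasing_cvgn_le; last exact: (cvg_hit G01).
by apply: nondecreasing_hit_sum => t c; have /andP[] := G01 t c.
Qed.

Lemma hit_ge0 i G : in01 G -> 0 <= h i G.
Proof. by move=> G01; exact: (hit_sum_le_hit 0). Qed.

Lemma hit_le i G x : in01 G -> (forall K, hs K i G <= x) -> h i G <= x.
Proof.
move=> G01 Gx; rewrite /hit; apply: limr_le; first exact: (cvg_hit G01).
by apply: nearW.
Qed.

Lemma hit_le1 i G : in01 G -> h i G <= 1.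
Proof. by move=> G01; apply: hit_le => // K; exact: hit_sum_le1. Qed.

Lemma hit_stop i G : st i -> h i G = G i (fun=> 0%N).
Proof.
move=> sti; rewrite /hit; apply/cvg_lim => //.
by rewrite -(cvg_shiftS _); apply: cvg_near_cst; apply: nearW => K /=; rewrite sti.
Qed.

(** First-step equation: upward jumps have size one, so the sum is finite and the limit passes
    through it. *)
Lemma hit_rec i G : in01 G -> ~~ st i ->
  h i G = \sum_(j < i.+2) p i j * h j (shift i G).
Proof.
move=> G01 sti; rewrite {1}/hit; apply/cvg_lim => //.
rewrite -(cvg_shiftS _) /= (negbTE sti).
apply: cvg_sum_ord => j; apply: cvgM; first exact: cvg_cst.
by apply: cvg_hit; exact: in01_incr.
Qed.

Lemma hit_mono (Pos : nat -> nat -> (nat -> nat) -> Prop) :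
  (forall i, (i <= n)%N -> st i -> Pos i i (fun=> 0%N)) ->
  (forall i j t c, (i < n)%N -> ~~ st i -> (j <= i.+1)%N -> 0 < p i j ->
     Pos j t c -> Pos i t (incr i c)) ->
  forall i G G', in01 G -> in01 G' -> (i <= n)%N ->
    (forall t c, Pos i t c -> G t c <= G' t c) -> h i G <= h i G'.
Proof.
move=> Pos0 PosS i G G' G01 G'01 ile GG'; apply: hit_le => // K.
apply: le_trans (hit_sum_le_hit K i G'01).
exact: (hit_sum_mono Pos0 PosS).
Qed.

Lemma ler_hit i G G' : in01 G -> in01 G' ->
  (forall t c, G t c <= G' t c) -> h i G <= h i G'.
Proof.
move=> G01 G'01 GG'; apply: hit_le => // K.
by apply: le_trans (hit_sum_le_hit K i G'01); exact: ler_hit_sum.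
Qed.

Lemma hitD i G G' : in01 G -> in01 G' ->
  h i (fun t c => G t c + G' t c) = h i G + h i G'.
Proof.
move=> G01 G'01; rewrite {1}/hit; apply/cvg_lim => //.
under eq_cvg do rewrite hit_sumD.
by apply: cvgD; exact: cvg_hit.
Qed.

Lemma hitZ i a G : in01 G -> h i (fun t c => a * G t c) = a * h i G.
Proof.
move=> G01; rewrite {1}/hit; apply/cvg_lim => //.
under eq_cvg do rewrite hit_sumZ.
by apply: cvgM; [exact: cvg_cst|exact: cvg_hit].
Qed.

Lemma in01_cst1 : in01 (fun _ _ => 1 : R).
Proof. by move=> t c; rewrite ler01 lexx. Qed.

Lemma hit0 i : h i (fun _ _ => 0) = 0.
Proof.
by rewrite /hit; apply/cvg_lim => //; under eq_cvg do rewrite hit_sum0; exact: cvg_cst.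
Qed.

(* The maximum principle for [1 - h i 1], which is harmonic and vanishes at
   [n]: an interior maximum propagates upwards to [n]. *)
Lemma hit1 i : (i <= n)%N -> h i (fun _ _ => 1) = 1.
Proof.
pose r j := 1 - h j (fun _ _ => 1).
have r0 j : 0 <= r j by rewrite subr_ge0; apply: hit_le1; exact: in01_cst1.
have [k rk] : exists k : 'I_n.+1, forall j : 'I_n.+1, r j <= r k.
  pose k := [arg max_(k > (ord0 : 'I_n.+1)) r k]%O.
  by exists k => j; rewrite /k; case: arg_maxP => // l _; exact.
have max0 m : forall j, (m + j = n)%N -> r j = r k -> r k = 0.
  elim: m => [|m IH] j.
    by rewrite add0n => -> <-; rewrite /r hit_stop ?subrr.
  move=> mj rj; have [stj|stj] := boolP (st j).
    by rewrite -rj /r hit_stop ?subrr.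
  apply: (IH j.+1); first by rewrite addnS.
  have rE : r j = \sum_(l < j.+2) p j l * r l.
    rewrite /r hit_rec//; last exact: in01_cst1.
    rewrite -[X in X - _](p_sum j) -sumrB; apply: eq_bigr => l _.
    by rewrite mulrBr mulr1.
  have lek (l : nat) : (l <= n)%N -> r l <= r k.
    by rewrite -ltnS => ln; exact: (rk (Ordinal ln)).
  apply/eqP; rewrite eq_le lek; last by rewrite -mj addSn ltnS leq_addl.
  rewrite -(ler_pM2l (p_up j)) -subr_ge0.
  have : 0 <= \sum_(l < j.+1) p j (widen_ord (leqnSn _) l) * (r k - r (widen_ord (leqnSn _) l)).
    apply: sumr_ge0 => l _; rewrite mulr_ge0// subr_ge0 lek//=.
    by apply: ltnW; apply: leq_trans (ltn_ord l) _; rewrite -mj addSn ltnS leq_addl.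
  have : \sum_(l < j.+2) p j l * (r k - r l) = 0.
    under eq_bigr do rewrite mulrBr.
    by rewrite sumrB -mulr_suml p_sum mul1r -rE rj subrr.
  rewrite big_ord_recr/= => /eqP; rewrite addr_eq0 => /eqP ->.
  by rewrite mulrBr opprB.
move=> ile; apply/eqP; rewrite eq_sym -subr_eq0 -/(r i) eq_le r0 andbT.
rewrite -(max0 (n - k)%N k) ?subnK//; last by rewrite -ltnS.
by rewrite -ltnS in ile; exact: (rk (Ordinal ile)).
Qed.

(** Unrolling the equation [K] times bounds [f] by [C] times the weight of not having stopped yet,
    which tends to 0 by [hit1]. The parameter [g] changes at each step through [sh], hence a family
    of unknowns; the alternative [f i g = 0] serves where the equation fails for trivial reasons. *)
Lemma hit_uniq (T : Type) (dom : T -> Prop) (sh : nat -> T -> T)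
    (f : nat -> T -> R) (C : R) :
  (forall i g, (i <= n)%N -> dom g -> `|f i g| <= C) ->
  (forall i g, (i <= n)%N -> dom g -> st i -> f i g = 0) ->
  (forall i g, (i < n)%N -> dom g -> ~~ st i -> f i g = 0 \/
     dom (sh i g) /\ f i g = \sum_(j < i.+2) p i j * f j (sh i g)) ->
  forall i g, (i <= n)%N -> dom g -> f i g = 0.
Proof.
move=> fC f0 fS.
have bound K : forall i g, (i <= n)%N -> dom g ->
    `|f i g| <= C * (1 - hs K i (fun _ _ => 1)).
  elim: K => [|K IH] i g ile dg /=; first by rewrite subr0 mulr1 fC.
  case: ifPn => sti; first by rewrite f0// normr0 subrr mulr0.
  have iltn : (i < n)%N.
    by rewrite ltn_neqAle ile andbT; apply: contraNneq sti => ->.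
  have [->|[dsh ->]] := fS i g iltn dg sti.
    rewrite normr0 mulr_ge0//; first by apply: le_trans (fC i g ile dg).
    by have := hit_sum1_le1 K.+1 i; rewrite /= (negbTE sti) subr_ge0.
  rewrite (le_trans (ler_norm_sum _ _ _))// -[X in X - _](p_sum i) -sumrB mulr_sumr.
  apply: ler_sum => j _; rewrite normrM ger0_norm// -[X in X - _]mulr1 -mulrBr mulrCA.
  apply: ler_wpM2l => //; apply: IH => //.
  by apply: leq_trans iltn; have := ltn_ord j; rewrite ltnS.
move=> i g ile dg; apply/eqP; rewrite -normr_eq0 eq_le normr_ge0 andbT.
have lim0 : C * (1 - hs K i (fun _ _ => 1)) @[K --> \oo] --> C * (1 - 1).
  apply: cvgM; first exact: cvg_cst.
  by apply: cvgB; [exact: cvg_cst|have := @cvg_hit i _ in01_cst1; rewrite hit1].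
rewrite subrr mulr0 in lim0.
rewrite -(cvg_lim (@Rhausdorff R) lim0); apply: limr_ge; first exact: (cvgP _ lim0).
by apply: nearW => K; exact: bound.
Qed.

End hit_sum.

(** * Excursions from a state *)

(** Pascal's rule. Read on excursions: among [m.+1] of them, [D] going up, the first one goes either
    down or up. *)
Lemma pascal_sum (R : realType) (x : nat -> nat -> R) m :
  \sum_(D < m.+2) 'C(m.+1, D)%:R * x (m.+1 - D)%N D =
  \sum_(D < m.+1) 'C(m, D)%:R * (x (m - D).+1 D + x (m - D)%N D.+1).
Proof.
under [RHS]eq_bigr do rewrite mulrDr.
rewrite big_split/= big_ord_recl/= [X in _ = X + _]big_ord_recl/= !bin0 !subn0 -addrA.
congr (_ + _).
under eq_bigr => D _ do rewrite /bump/= add1n binS subSS natrD mulrDl.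
rewrite big_split/= big_ord_recr/= bin_small// mul0r addr0; congr (_ + _).
by apply: eq_bigr => D _; rewrite /bump/= add1n subnSK.
Qed.

Definition unitfun (R : realType) (g : (nat -> nat) -> R) :=
  forall c, 0 <= g c <= 1.

Section factorization.
Variables (R : realType) (p : nat -> nat -> R) (n a : nat).
Hypothesis p_ge0 : forall i j, 0 <= p i j.
Hypothesis p_sum : forall i, \sum_(j < i.+2) p i j = 1.
Hypothesis p_up : forall i, 0 < p i i.+1.
Hypothesis p_diag : forall i, p i i = 0.
Hypothesis a_lt : (a < n)%N.

Local Notation down := (hit p (pred1 a)).
Local Notation up := (hit p (pred2 a n)).

(* Total weight of the sequences of [E] excursions from [a] to [a] through
   states below [a]. *)
Fixpoint below (E : nat) (g : (nat -> nat) -> R) : R :=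
  if E is E'.+1 then
    \sum_(j < a) p a j * down j (fun _ c => below E' (fun c' => g (fun l => (c l + c' l)%N)))
  else g (fun=> 0%N).

(** A path from [i] to [a], then [E] excursions below. Visits to [a] are left out of the counts; the
    factor [c a == m] of [prod3] records them. *)
Definition to_below i E g : R :=
  down i (fun _ c => below E (fun c' => g (fun l => (c l + c' l)%N))).

(* Total weight of the sequences of [D] excursions from [a] to [a] through
   states above [a], followed by a path from [a] to [n] through such states. *)
Fixpoint above (D : nat) (k : (nat -> nat) -> R) : R :=
  p a a.+1 * up a.+1 (fun t c =>
    if D is D'.+1 then (t == a)%:R * above D' (fun c' => k (fun l => (c l + c' l)%N))
    else (t == n)%:R * k c).

(** Beware of the shift: [to_above i D.+1] returns from [i] to [a] and then continues as [above D],
    while [to_above i 0] goes from [i] to [n] without meeting [a]. *)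
Definition to_above i D k : R := up i (fun t c =>
    if D is D'.+1 then (t == a)%:R * above D' (fun c' => k (fun l => (c l + c' l)%N))
    else (t == n)%:R * k c).

Lemma p_le1 i j : (j < i.+2)%N -> p i j <= 1.
Proof.
move=> ji; rewrite -(p_sum i) (bigD1 (Ordinal ji))//= lerDl.
exact: sumr_ge0.
Qed.

Lemma unitfun_add g c : unitfun g ->
  unitfun (fun c' => g (fun l => (c l + c' l)%N) : R).
Proof. by move=> g01 c'; exact: g01. Qed.

Lemma below01 E g : unitfun g -> 0 <= below E g <= 1.
Proof.
elim: E g => [|E IH] g g01 /=; first exact: g01.
have G01 : in01 (fun _ c => below E (fun c' => g (fun l => (c l + c' l)%N))).
  by move=> t c; apply: IH; exact: unitfun_add.
apply/andP; split.
  by apply: sumr_ge0 => j _; rewrite mulr_ge0//; exact: (hit_ge0 _ p_ge0 p_sum).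
apply: (@le_trans _ _ (\sum_(j < a) p a j)).
  apply: ler_sum => j _; rewrite -[leRHS]mulr1; apply: ler_wpM2l => //.
  exact: (hit_le1 _ p_ge0 p_sum).
by rewrite -(p_sum a) big_ord_recr/= big_ord_recr/= -addrA lerDl addr_ge0.
Qed.

Lemma in01_below E g : unitfun g ->
  in01 (fun _ c => below E (fun c' => g (fun l => (c l + c' l)%N))).
Proof. by move=> g01 t c; apply: below01; exact: unitfun_add. Qed.

Lemma to_below01 i E g : unitfun g -> 0 <= to_below i E g <= 1.
Proof.
move=> g01; rewrite /to_below (hit_ge0 _ p_ge0 p_sum)/= ?(hit_le1 _ p_ge0 p_sum)//;
  exact: in01_below.
Qed.

Lemma in01_indic (b : bool) (x : R) : 0 <= x <= 1 -> 0 <= b%:R * x <= 1.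
Proof. by case: b => [|_]; rewrite ?mul1r// mul0r lexx ler01. Qed.

Lemma above01 D k : unitfun k -> 0 <= above D k <= 1.
Proof.
elim: D k => [|D IH] k k01 /=.
  have G01 : in01 (fun t c => (t == n)%:R * k c).
    by move=> t c; apply: in01_indic; exact: k01.
  rewrite mulr_ge0//=; last exact: (hit_ge0 _ p_ge0 p_sum).
  by apply: mulr_ile1; rewrite ?p_le1// ?(hit_ge0 _ p_ge0 p_sum) ?(hit_le1 _ p_ge0 p_sum).
have G01 : in01 (fun t c => (t == a)%:R * above D (fun c' => k (fun l => (c l + c' l)%N))).
  by move=> t c; apply: in01_indic; apply: IH; exact: unitfun_add.
rewrite mulr_ge0//=; last exact: (hit_ge0 _ p_ge0 p_sum).
by apply: mulr_ile1; rewrite ?p_le1// ?(hit_ge0 _ p_ge0 p_sum) ?(hit_le1 _ p_ge0 p_sum).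
Qed.

Lemma in01_above D k : unitfun k -> in01 (fun t c =>
    if D is D'.+1 then (t == a)%:R * above D' (fun c' => k (fun l => (c l + c' l)%N))
    else (t == n)%:R * k c).
Proof.
move=> k01 t c; case: D => [|D]; apply: in01_indic; first exact: k01.
by apply: above01; exact: unitfun_add.
Qed.

Lemma to_above01 i D k : unitfun k -> 0 <= to_above i D k <= 1.
Proof.
move=> k01; rewrite /to_above (hit_ge0 _ p_ge0 p_sum)/= ?(hit_le1 _ p_ge0 p_sum)//;
  exact: in01_above.
Qed.

Lemma aboveE D k : above D k = p a a.+1 * to_above a.+1 D k.
Proof. by case: D. Qed.

Lemma below0 g : below 0 g = g (fun=> 0%N).
Proof. by []. Qed.

Lemma belowSE E g : below E.+1 g = \sum_(j < a) p a j * to_below j E g.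
Proof. by []. Qed.

Lemma to_below_stop E g : to_below a E g = below E g.
Proof. by rewrite /to_below hit_stop//=. Qed.

Lemma to_below_rec i E g : unitfun g -> (i < a)%N ->
  to_below i E g = \sum_(j < i.+2) p i j * to_below j E (fun c => g (incr i c)).
Proof.
move=> g01 ia; rewrite /to_below (hit_rec p_ge0 p_sum)/=; last 2 first.
- exact: in01_below.
- by rewrite ltn_eqF.
by under eq_bigr => j _ do under eq_fun => t do under eq_fun => c do
  under eq_fun => c' do rewrite incr_addn.
Qed.

Lemma to_above_rec i D k : unitfun k -> i != a -> i != n ->
  to_above i D k = \sum_(j < i.+2) p i j * to_above j D (fun c => k (incr i c)).
Proof.
move=> k01 ia i_n; rewrite /to_above (hit_rec p_ge0 p_sum)/=; last 2 first.
- exact: in01_above.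
- by rewrite (negbTE ia) (negbTE i_n).
case: D => //= D.
by under eq_bigr => j _ do under eq_fun => t do under eq_fun => c do
  under eq_fun => c' do rewrite incr_addn.
Qed.

Lemma to_above_a0 k : to_above a 0 k = 0.
Proof. by rewrite /to_above hit_stop/= ?eqxx// ltn_eqF// mul0r. Qed.

Lemma to_above_aS D k : to_above a D.+1 k = above D k.
Proof. by rewrite /to_above hit_stop/= ?eqxx// mul1r. Qed.

Lemma to_above_n0 k : to_above n 0 k = k (fun=> 0%N).
Proof. by rewrite /to_above hit_stop/= ?eqxx ?orbT// mul1r. Qed.

Lemma to_above_nS D k : to_above n D.+1 k = 0.
Proof. by rewrite /to_above hit_stop/= ?eqxx ?orbT// gtn_eqF// mul0r. Qed.

#[local] Arguments above : simpl never.
#[local] Arguments below : simpl never.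

Hypothesis no_jump_over :
  forall i j, (a < i)%N -> (i < n)%N -> (j < a)%N -> p i j = 0.

Definition local_below (g : (nat -> nat) -> R) :=
  forall c c', (forall j, (j < a)%N -> c j = c' j) -> g c = g c'.

Definition local_above (k : (nat -> nat) -> R) :=
  forall c c', (forall j, (a < j < n)%N -> c j = c' j) -> k c = k c'.

Definition prod3 g m k : nat -> (nat -> nat) -> R :=
  fun _ c => g c * (c a == m)%:R * k c.

(** Closed form expected for [hit] of [prod3 g m k] from an arbitrary start. With [m] visits to [a]
    still to come there are [m.-1] returns to [a], of which [D] from above. From [i > a] the current
    excursion is unfinished, hence [to_above i D.+1]; the last summand is the case where [a] is not
    met again. *)
Let F i g m k : R :=
  \sum_(D < m) 'C(m.-1, D)%:R *
    ((if (i <= a)%N then to_below i (m.-1 - D) g else below (m.-1 - D) g) *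
     (if (i <= a)%N then above D k else to_above i D.+1 k)) +
  (a < i)%N%:R * (m == 0%N)%:R * (g (fun=> 0%N) * to_above i 0 k).

Let T := (((nat -> nat) -> R) * nat * ((nat -> nat) -> R))%type.

(** Effect of a step from [i] on the parameters: one visit is recorded in [g] and [k], and [m] drops
    when [i] is [a]. *)
Let sh i (x : T) : T :=
  (fun c => x.1.1 (incr i c), (x.1.2 - (i == a))%N, fun c => x.2 (incr i c)).

Lemma in01_prod3 g m k : unitfun g -> unitfun k -> in01 (prod3 g m k).
Proof.
move=> g01 k01 t c; rewrite /prod3.
have /andP[? ?] := g01 c; have /andP[? ?] := k01 c.
by case: eqP => _; rewrite ?mulr1 ?mulr0 ?mul0r ?lexx ?ler01// mulr_ge0//= mulr_ile1.
Qed.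

Lemma local_below_incr g i : local_below g -> (a <= i)%N -> (fun c => g (incr i c)) = g.
Proof.
move=> lg ai; apply/funext => c; apply: lg => j ja.
by rewrite /incr ltn_eqF// (leq_trans ja).
Qed.

Lemma local_above_incr k i : local_above k -> (i <= a)%N -> (fun c => k (incr i c)) = k.
Proof.
move=> lk ai; apply/funext => c; apply: lk => j /andP[ja _].
by rewrite /incr gtn_eqF// (leq_ltn_trans ai).
Qed.

(* Strong Markov decomposition at the successive visits to [a]: as no jump
   passes over [a] downwards, each excursion from [a] stays on one side. *)
Lemma hit_prod3 g m k : unitfun g -> unitfun k -> local_below g -> local_above k ->
  hit p (pred1 n) 0 (prod3 g m.+1 k) =
  \sum_(D < m.+1) 'C(m, D)%:R * (to_below 0 (m - D) g * above D k).
Proof.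
move=> g01 k01 lg lk.
pose f i (x : T) := hit p (pred1 n) i (prod3 x.1.1 x.1.2 x.2) - F i x.1.1 x.1.2 x.2.
pose dom (x : T) := [/\ unitfun x.1.1, unitfun x.2, local_below x.1.1,
  local_above x.2 & (x.1.2 <= m.+1)%N].
suff : f 0%N (g, m.+1, k) = 0.
  move=> /eqP; rewrite subr_eq0 => /eqP /= ->.
  by rewrite /F/= !mul0r addr0.
(* [hit] is at most 1. In [F] the path weights are at most 1, which leaves 1 for the last summand
   and the binomials for the sum; adding these over all [l <= m.+1] makes the bound uniform on
   [dom]. *)
pose C : R := 1 + (1 + \sum_(l < m.+2) \sum_(D < l) 'C(l.-1, D)%:R).
apply: (@hit_uniq R p (pred1 n) n p_ge0 p_sum p_up _ T dom sh f C); last by split.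
- by rewrite /= eqxx.
- move=> i [[g' l] k'] _ [/= g'01 k'01 _ _ lm]; rewrite /f/=.
  have h01 : 0 <= hit p (pred1 n) i (prod3 g' l k') <= 1.
    by rewrite (hit_ge0 _ p_ge0 p_sum) ?(hit_le1 _ p_ge0 p_sum)//; exact: in01_prod3.
  have F01 : 0 <= F i g' l k' <= 1 + \sum_(l < m.+2) \sum_(D < l) 'C(l.-1, D)%:R.
    have Z01 E : 0 <= (if (i <= a)%N then to_below i E g' else below E g') <= 1.
      by case: ifP => _; [exact: to_below01|exact: below01].
    have W01 D : 0 <= (if (i <= a)%N then above D k' else to_above i D.+1 k') <= 1.
      by case: ifP => _; [exact: above01|exact: to_above01].
    have V01 : 0 <= (a < i)%N%:R * (l == 0%N)%:R * (g' (fun=> 0%N) * to_above i 0 k') <= 1.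
      rewrite -mulrA; apply: in01_indic; apply: in01_indic.
      have /andP[? ?] := g'01 (fun=> 0%N); have /andP[? ?] := to_above01 i 0 k'01.
      by rewrite mulr_ge0//= mulr_ile1.
    have S01 : 0 <= \sum_(D < l) 'C(l.-1, D)%:R *
      ((if (i <= a)%N then to_below i (l.-1 - D) g' else below (l.-1 - D) g') *
       (if (i <= a)%N then above D k' else to_above i D.+1 k')) <=
      \sum_(D < l) 'C(l.-1, D)%:R.
      apply/andP; split.
        apply: sumr_ge0 => D _; have /andP[? ?] := Z01 (l.-1 - D)%N.
        by have /andP[? ?] := W01 D; rewrite !mulr_ge0.
      apply: ler_sum => D _; have /andP[? ?] := Z01 (l.-1 - D)%N.
      have /andP[? ?] := W01 D; rewrite -[leRHS]mulr1.
      by apply: ler_wpM2l => //; apply: mulr_ile1.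
    have SS : \sum_(D < l) 'C(l.-1, D)%:R <= \sum_(l < m.+2) \sum_(D < l) 'C(l.-1, D)%:R :> R.
      rewrite -ltnS in lm; rewrite (bigD1 (Ordinal lm))//= lerDl.
      by apply: sumr_ge0 => j _; apply: sumr_ge0.
    move: V01 S01 SS; rewrite /F; set x := \sum_(D < l) _ * _; set y := _ * _ * _.
    set z := \sum_(D < l) _; set u := \sum_(l < _) _.
    move=> /andP[? ?] /andP[? ?] ?; apply/andP; split; lra.
  move: h01 F01 => /andP[? ?] /andP[? ?].
  by rewrite ler_norml /C; apply/andP; split; lra.
- move=> _ [[g' l] k'] _ [/= g'01 k'01 _ _ lm] /eqP ->; rewrite /f/= hit_stop/=; last by rewrite eqxx.
  rewrite /F leqNgt a_lt/= big1 ?add0r; last by move=> D _; rewrite to_above_nS !mulr0.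
  by rewrite to_above_n0 /prod3 mul1r eq_sym; case: eqP => _; ring.
- move=> i [[g' l] k'] iltn [/= g'01 k'01 lg' lk' lm] i_n.
  have dsh : dom (sh i (g', l, k')).
    split => /=.
    + by move=> c; exact: g'01.
    + by move=> c; exact: k'01.
    + by move=> c c' cc; apply: lg' => j ja; rewrite /incr cc.
    + by move=> c c' cc; apply: lk' => j ja; rewrite /incr cc.
    + by apply: leq_trans lm; exact: leq_subr.
  have hitE : hit p (pred1 n) i (prod3 g' l k') =
      \sum_(j < i.+2) p i j * hit p (pred1 n) j (fun t c => prod3 g' l k' t (incr i c)).
    by rewrite (hit_rec p_ge0 p_sum)//; exact: in01_prod3.
  have [ia|ai|ia] := ltngtP i a.
  + right; split=> //; rewrite /f /sh/= hitE.
    rewrite (ltn_eqF ia) subn0.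
    under [RHS]eq_bigr do rewrite mulrBr.
    rewrite sumrB; congr (_ - _).
      apply: eq_bigr => j _; congr (_ * hit _ _ _ _).
      by apply/funext => t; apply/funext => c; rewrite /prod3 [incr _ c a]/incr (gtn_eqF ia).
    rewrite /F (ltnW ia) ltnNge (ltnW ia)/= !mul0r addr0.
    under eq_bigr do rewrite to_below_rec// mulr_suml mulr_sumr.
    rewrite exchange_big/=; apply: eq_bigr => j _.
    have ja : (j <= a)%N by apply: leq_trans ia; rewrite -ltnS.
    rewrite ja ltnNge ja/= !mul0r addr0 mulr_sumr; apply: eq_bigr => D _.
    rewrite (local_above_incr lk' (ltnW ia)); ring.
  + right; split=> //; rewrite /f /sh/= hitE.
    rewrite (gtn_eqF ai) subn0.
    under [RHS]eq_bigr do rewrite mulrBr.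
    rewrite sumrB; congr (_ - _).
      apply: eq_bigr => j _; congr (_ * hit _ _ _ _).
      by apply/funext => t; apply/funext => c; rewrite /prod3 [incr _ c a]/incr (ltn_eqF ai).
    rewrite /F leqNgt ai/= mul1r.
    have to_above_recE D : to_above i D k' =
        \sum_(j < i.+2) p i j * to_above j D (fun c => k' (incr i c)).
      by rewrite to_above_rec// gtn_eqF.
    under eq_bigr do rewrite to_above_recE mulr_sumr mulr_sumr.
    rewrite exchange_big/= to_above_recE !mulr_sumr -big_split/=.
    apply: eq_bigr => j _; rewrite (local_below_incr lg') ?(ltnW ai)//.
    have [ja|ja|ja] := ltngtP j a.
    (* Here the hypothesis acts: from above [a], no path gets below without stopping at [a]. *)
    * by rewrite no_jump_over// !mul0r !mulr0 addr0 big1// => D _; rewrite mul0r !mulr0.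
    * have -> : g' (incr i (fun=> 0%N)) = g' (fun=> 0%N).
        by have /(congr1 (fun h => h (fun=> 0%N))) := local_below_incr lg' (ltnW ai).
      rewrite mul1r mulrDr mulr_sumr; congr (_ + _); last ring.
      by apply: eq_bigr => D _; ring.
    * rewrite !mul0r addr0 ja to_above_a0 !mulr0 addr0 mulr_sumr.
      by apply: eq_bigr => D _; rewrite to_above_aS to_below_stop; ring.
  + subst i; case: l => [|l] in lm dsh hitE *.
      (* A path from [a] visits [a], so for zero visits both [hit] and [F] vanish; the truncated
         [0 - 1] in [sh] is never reached. *)
      left; rewrite /f /F/= big_ord0 ltnn !mul0r addr0 subr0 hitE big1// => j _.
      rewrite (_ : (fun _ _ => _) = (fun _ _ => 0)) ?hit0 ?mulr0//.
      by apply/funext => t; apply/funext => c; rewrite /prod3 [incr _ c a]/incr eqxx mulr0 mul0r.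
    right; split=> //; rewrite /f /sh/= hitE eqxx subn1/=.
    rewrite (local_below_incr lg')// (local_above_incr lk')//.
    under [RHS]eq_bigr do rewrite mulrBr.
    rewrite sumrB; congr (_ - _).
      apply: eq_bigr => j _; congr (_ * hit _ _ _ _).
      apply/funext => t; apply/funext => c; rewrite /prod3 [incr _ c a]/incr eqxx add1n eqSS.
      have /(congr1 (fun h => h c)) /= -> := local_below_incr lg' (leqnn a).
      by have /(congr1 (fun h => h c)) /= -> := local_above_incr lk' (leqnn a).
    rewrite big_ord_recr/= big_ord_recr/= p_diag mul0r addr0.
    rewrite /F !leqnn !ltnn /= !mul0r addr0 mul1r.
    case: l => [|l] in lm dsh hitE *.
      rewrite big_ord1/= big1 ?add0r; last first.
        by move=> j _; rewrite big_ord0 ltnNge (ltnW (ltn_ord j))/= !mul0r addr0 mulr0.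
      by rewrite big_ord0 add0r mul1r to_below_stop aboveE /= below0; ring.
    (* The two terms given by Pascal's rule match the first steps out of [a]: to some [j < a], and
       to [a.+1]. *)
    rewrite (pascal_sum (fun E D => to_below a E g' * above D k')).
    under [LHS]eq_bigr do rewrite mulrDr.
    rewrite [LHS]big_split/= mul0r addr0; congr (_ + _); last first.
      rewrite mulr_sumr; apply: eq_bigr => D _; rewrite to_below_stop aboveE; ring.
    under [LHS]eq_bigr do rewrite to_below_stop belowSE mulr_suml mulr_sumr.
    rewrite exchange_big/=; apply: eq_bigr => j _.
    rewrite (ltnW (ltn_ord j)) [(a < j)%N]ltnNge (ltnW (ltn_ord j))/= !mul0r addr0 mulr_sumr.
    by apply: eq_bigr => D _; ring.
- by [].
Qed.

End factorization.

(** * An identity and an inequality between path weights *)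

Section excursion_inequality.
Variables (R : realType) (p : nat -> nat -> R) (n a : nat).
Hypothesis p_ge0 : forall i j, 0 <= p i j.
Hypothesis p_sum : forall i, \sum_(j < i.+2) p i j = 1.
Hypothesis p_up : forall i, 0 < p i i.+1.
Hypothesis p_diag : forall i, p i i = 0.
Hypothesis b_lt : (a.+1 < n)%N.

Local Notation H i g m k := (hit p (pred1 n) i (prod3 a g m k)).
Local Notation cst1 := (fun _ : nat -> nat => 1 : R).

Let a_lt : (a < n)%N. Proof. exact: ltnW. Qed.

(* Constraints on the visit numbers of the paths from [i] to [n]. *)
Let visits i (_ : nat) (c : nat -> nat) : Prop :=
  [/\ forall l, (i <= l < n)%N -> (0 < c l)%N,
      (a < i)%N -> c a = 0%N -> forall l, (l < a)%N -> c l = 0%N &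
      (a < i)%N -> (0 < c a)%N -> ((i == a.+1) < c a.+1)%N].

(** The clauses of [visits] all express that upward jumps have size one: every state between the
    start and [n] is visited; from above [a], a path that avoids [a] avoids all states below, since
    it could not come back; one that meets [a] must cross [a.+1] afterwards, which makes two visits
    if it started there. *)
Lemma hit_visits_le i G G' : in01 G -> in01 G' -> (i <= n)%N ->
  (forall t c, visits i t c -> G t c <= G' t c) ->
  hit p (pred1 n) i G <= hit p (pred1 n) i G'.
Proof.
have V0 i' : (i' <= n)%N -> pred1 n i' -> visits i' i' (fun=> 0%N).
  by move=> _ /eqP ->; split => // l /andP[nl ln]; move: (leq_trans ln nl); rewrite ltnn.
have VS i' j t c : (i' < n)%N -> ~~ pred1 n i' -> (j <= i'.+1)%N -> 0 < p i' j ->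
    visits j t c -> visits i' t (incr i' c).
  move=> iltn _ ji _ [v1 v2 v3]; rewrite /incr; split.
  - move=> l /andP[il ln]; case: eqP => // /eqP li; rewrite add0n; apply: v1.
    by rewrite ln andbT (leq_trans ji)// ltn_neqAle eq_sym li.
  - move=> ai; rewrite ltn_eqF// add0n => ca l la; rewrite ltn_eqF ?(ltn_trans la)// add0n.
    apply: v2 => //; rewrite ltnNge; apply/negP => ja.
    by have := v1 a; rewrite ca ja a_lt => /(_ isT).
  - move=> ai; rewrite [a == i']ltn_eqF// add0n => ca.
    have : (0 < c a.+1)%N.
      have [jb|bj] := leqP j a.+1; first by apply: v1; rewrite jb.
      by apply: leq_ltn_trans (v3 (ltnW bj) ca).
    by rewrite [a.+1 == i']eq_sym; case: (i' == a.+1); lia.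
exact: (hit_mono p_ge0 p_sum (eqxx n : pred1 n n) V0 VS).
Qed.

Lemma hit_visits i G G' : in01 G -> in01 G' -> (i <= n)%N ->
  (forall t c, visits i t c -> G t c = G' t c) ->
  hit p (pred1 n) i G = hit p (pred1 n) i G'.
Proof.
move=> G01 G'01 ile GG'; apply/eqP; rewrite eq_le.
by apply/andP; split; apply: hit_visits_le => // t c /GG' ->.
Qed.

Lemma ler_hit_all_visited G G' : in01 G -> in01 G' ->
  (forall t c, (forall l, (l < n)%N -> (0 < c l)%N) -> G t c <= G' t c) ->
  hit p (pred1 n) 0 G <= hit p (pred1 n) 0 G'.
Proof.
move=> G01 G'01 GG'; apply: hit_visits_le => // t c [v1 _ _].
by apply: GG' => l ln; exact: v1.
Qed.

Lemma in01_cst0 : in01 (fun _ _ => 0 : R).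
Proof. by move=> t c; rewrite lexx ler01. Qed.

Lemma hit_visits0 i G : in01 G -> (i <= n)%N ->
  (forall t c, visits i t c -> G t c = 0) -> hit p (pred1 n) i G = 0.
Proof. by move=> ? ? G0; rewrite (hit_visits (G' := fun _ _ => 0)) ?hit0//; exact: in01_cst0. Qed.

Lemma unitfun1 : unitfun cst1.
Proof. by move=> c; rewrite ler01 lexx. Qed.

Lemma unitfun_nat (b : (nat -> nat) -> bool) : unitfun (fun c => (b c)%:R : R).
Proof. by move=> c; case: (b c); rewrite ?lexx ?ler01. Qed.

(** From [i <= a]: the path climbs from [i] to [a] one state at a time and never goes below [a]
    again. This is the limit, as the window shrinks, of the constraint on the times below [a];
    [once_b] plays the same role for [a.+1]. *)
Definition straight_below i (c : nat -> nat) : R :=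
  [forall j : 'I_a, c j == (i <= j)%N]%:R.

Definition once_b (c : nat -> nat) : R := (c a.+1 == 1%N)%:R.

Lemma unitfun_straight i : unitfun (straight_below i).
Proof. exact: unitfun_nat. Qed.

Lemma unitfun_once_b : unitfun once_b.
Proof. exact: unitfun_nat. Qed.

Lemma local_above_once_b : local_above n a once_b.
Proof. by move=> c c' cc; rewrite /once_b cc// ltnSn. Qed.

Lemma local_above_cst1 : local_above n a cst1.
Proof. by []. Qed.

Section above_functional.
Variable k : (nat -> nat) -> R.
Hypothesis k01 : unitfun k.
Hypothesis lk : local_above n a k.

Let in01H g m : unitfun g -> in01 (prod3 a g m k).
Proof. by move=> g01; exact: in01_prod3. Qed.

Let kincr i : (i <= a)%N -> forall c, k (incr i c) = k c.
Proof. by move=> ia c; have /(congr1 (fun h => h c)) := local_above_incr lk ia. Qed.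

(** The functional ignores visits below [a]. If the value is the same at [0, ..., j], the first-step
    equation at [j] gives it at [j.+1], as [p j j.+1] is nonzero. *)
Lemma hit_const_below m i : (i <= a)%N -> H i cst1 m k = H a cst1 m k.
Proof.
suff const j : (j <= a)%N -> H j cst1 m k = H 0 cst1 m k.
  by move=> ia; rewrite !const.
elim/ltn_ind: j => -[//|j] IH ja.
have : H j cst1 m k = \sum_(l < j.+2) p j l * H l cst1 m k.
  rewrite (hit_rec p_ge0 p_sum)/=; last 2 first.
  - exact/in01H/unitfun1.
  - by rewrite ltn_eqF// (leq_trans ja)// ltnW.
  apply: eq_bigr => l _; congr (_ * hit _ _ _ _).
  apply/funext => t; apply/funext => c.
  by rewrite /prod3 (kincr (ltnW ja)) [incr _ c a]/incr (gtn_eqF ja).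
rewrite big_ord_recr/= IH ?(ltnW ja)// => E.
have S : \sum_(l < j.+1) p j l * H l cst1 m k = (1 - p j j.+1) * H 0 cst1 m k.
  have -> : 1 - p j j.+1 = \sum_(l < j.+1) p j l by rewrite -(p_sum j) big_ord_recr/= addrK.
  rewrite mulr_suml; apply: eq_bigr => l _.
  by rewrite IH// (leq_trans _ (ltnW ja))// -ltnS.
rewrite S in E; have := p_up j; move=> /lt0r_neq0 pj.
by apply: (mulfI pj); move: E; lra.
Qed.

(** A first step to some [l <= i] would visit [l] once too often. *)
Lemma hit_straightS m i : (i < a)%N ->
  H i (straight_below i) m k = p i i.+1 * H i.+1 (straight_below i.+1) m k.
Proof.
move=> ia; have iltn := ltn_trans ia a_lt.
rewrite (hit_rec p_ge0 p_sum)/=; last 2 first.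
- exact/in01H/unitfun_straight.
- by rewrite ltn_eqF.
rewrite big_ord_recr/= big1 ?add0r; last first.
  move=> l _; rewrite hit_visits0 ?mulr0//.
  - by apply: in01_incr; exact/in01H/unitfun_straight.
  - by apply: leq_trans iltn; exact: ltnW (ltn_ord l).
  move=> t c [v1 _ _]; rewrite /prod3 /straight_below.
  case: forallP => [/(_ (Ordinal (leq_ltn_trans (ltn_ord l : (l <= i)%N) ia)))/=|]; last by rewrite !mul0r.
  have : (0 < c l)%N by apply: v1; rewrite leqnn (leq_ltn_trans _ iltn)// -ltnS.
  rewrite /incr; have := ltn_ord l; case: ltngtP => //; lia.
congr (_ * hit _ _ _ _); apply/funext => t; apply/funext => c.
rewrite /prod3 (kincr (ltnW ia)) [incr _ c a]/incr (gtn_eqF ia) add0n.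
have -> // : straight_below i (incr i c) = straight_below i.+1 c.
rewrite /straight_below; congr (nat_of_bool _)%:R; apply/forallP/forallP => E l; have := E l; rewrite /incr; lia.
Qed.

Lemma hit_straight m : H 0 (straight_below 0) m k =
  (\prod_(i < a) p i i.+1) * H a (straight_below a) m k.
Proof.
suff E i : (i <= a)%N -> H 0 (straight_below 0) m k =
    (\prod_(j < i) p j j.+1) * H i (straight_below i) m k by exact: E.
elim: i => [|i IH] ia; first by rewrite big_ord0 mul1r.
by rewrite IH ?(ltnW ia)// hit_straightS// big_ord_recr/= mulrA.
Qed.

Lemma hit_recS i g m : unitfun g -> i != n ->
  H i g m k = \sum_(j < i.+2) p i j * hit p (pred1 n) j (fun t c => prod3 a g m k t (incr i c)).
Proof. by move=> g01 i_n; rewrite (hit_rec p_ge0 p_sum)//; exact: in01H. Qed.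

Lemma hit_a g m : unitfun g -> local_below a g ->
  H a g m.+1 k = \sum_(j < a) p a j * H j g m k + p a a.+1 * H a.+1 g m k.
Proof.
move=> g01 lg; rewrite hit_recS ?ltn_eqF//.
have E t c : prod3 a g m.+1 k t (incr a c) = prod3 a g m k t c.
  rewrite /prod3 kincr// [incr _ c a]/incr eqxx add1n eqSS.
  by have /(congr1 (fun h => h c)) /= -> := local_below_incr lg (leqnn a).
under eq_bigr => j _ do under eq_fun => t do under eq_fun => c do rewrite E.
by rewrite big_ord_recr/= big_ord_recr/= p_diag mul0r addr0.
Qed.

Lemma hit_below_0 j g : unitfun g -> (j <= a)%N -> H j g 0 k = 0.
Proof.
move=> g01 ja; apply: hit_visits0; first exact: in01H.
  exact: leq_trans ja (ltnW a_lt).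
move=> t c [v1 _ _]; rewrite /prod3.
have : (0 < c a)%N by apply: v1; rewrite ja.
by case: (c a) => // l _; rewrite mulr0 mul0r.
Qed.

Lemma hit_below_straight_a j m : (j < a)%N -> H j (straight_below a) m k = 0.
Proof.
move=> ja; apply: hit_visits0; first exact/in01H/unitfun_straight.
  exact: leq_trans (ltnW ja) (ltnW a_lt).
move=> t c [v1 _ _]; rewrite /prod3 /straight_below.
case: forallP => [/(_ (Ordinal ja))/=|]; last by rewrite !mul0r.
have : (0 < c j)%N by apply: v1; rewrite leqnn (ltn_trans ja).
by rewrite [(a <= j)%N]leqNgt ja; case: (c j).
Qed.

Lemma local_below_straight i : local_below a (straight_below i).
Proof.
move=> c c' cc; congr (nat_of_bool _)%:R.
by apply/forallP/forallP => E l; have := E l; rewrite cc.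
Qed.

Lemma hit_a1 : H a cst1 1 k = p a a.+1 * H a.+1 cst1 0 k.
Proof.
rewrite hit_a//; last exact: unitfun1.
rewrite big1 ?add0r// => j _.
by rewrite hit_below_0 ?mulr0//; [exact: unitfun1|exact: ltnW].
Qed.

(** From [a.+1], avoiding [a] already forces avoiding everything below. *)
Lemma hit_b0 : H a.+1 cst1 0 k = H a.+1 (straight_below a) 0 k.
Proof.
apply: hit_visits; [exact/in01H/unitfun1|exact/in01H/unitfun_straight|exact: ltnW|].
move=> t c [_ v2 _]; rewrite /prod3; case: eqP => [ca|]; last by rewrite !mulr0.
rewrite /straight_below; case: forallP => // -[] l.
by rewrite v2// leqNgt ltn_ord.
Qed.

(** A path leaving [a] for good goes up and cannot reach the states below, so with a single visit to
    [a] the constraint below costs nothing. This is why the terms of order 0 cancel. *)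
Lemma hit_straight_a1 : H a (straight_below a) 1 k = H a cst1 1 k.
Proof.
rewrite hit_a1 hit_b0 hit_a; [|exact: unitfun_straight|exact: local_below_straight].
by rewrite big1 ?add0r// => j _; rewrite hit_below_straight_a ?mulr0.
Qed.

Lemma hit_straight_a2 :
  H a (straight_below a) 2 k = p a a.+1 * H a.+1 (straight_below a) 1 k.
Proof.
rewrite hit_a; [|exact: unitfun_straight|exact: local_below_straight].
by rewrite big1 ?add0r// => j _; rewrite hit_below_straight_a ?mulr0.
Qed.

(** The first step goes below [a], from where [hit_const_below] brings the path back to [a] at no
    cost, or to [a.+1]. *)
Lemma hit_a2 : H a cst1 2 k =
  (1 - p a a.+1) * H a cst1 1 k + p a a.+1 * H a.+1 cst1 1 k.
Proof.
rewrite hit_a//; last exact: unitfun1.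
have -> : 1 - p a a.+1 = \sum_(j < a) p a j.
  by rewrite -(p_sum a) big_ord_recr/= addrK big_ord_recr/= p_diag addr0.
congr (_ + _); rewrite mulr_suml; apply: eq_bigr => j _; rewrite hit_const_below//; exact: ltnW.
Qed.

End above_functional.

(** Returning from [a.+1] to [a] forces a second visit to [a.+1] on the way to [n]. *)
Lemma hit_b1_once : H a.+1 cst1 1 once_b = 0.
Proof.
apply: hit_visits0; [apply: in01_prod3|exact: ltnW|].
- exact: unitfun1.
- exact: unitfun_once_b.
move=> t c [_ _ v3]; rewrite /prod3 /once_b; case: (c a =P 1%N) => [ca|]; last by rewrite mulr0 mul0r.
have := v3 (ltnSn a); rewrite ca eqxx => /(_ isT).
by case: (c a.+1) => [|[|l]]// _; rewrite mulr0.
Qed.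

Lemma hit_ge_up i G : in01 G -> (i < n)%N ->
  p i i.+1 * hit p (pred1 n) i.+1 (fun t c => G t (incr i c)) <= hit p (pred1 n) i G.
Proof.
move=> G01 iltn; rewrite [leRHS](hit_rec p_ge0 p_sum)//=; last by rewrite ltn_eqF.
rewrite big_ord_recr/= lerDr; apply: sumr_ge0 => j _; rewrite mulr_ge0//.
by apply: (hit_ge0 _ p_ge0 p_sum); exact: in01_incr.
Qed.

(** The path [a, a.+1, ..., n] qualifies and has positive weight. *)
Lemma hit_a1_gt0 : 0 < H a cst1 1 once_b.
Proof.
pose G i : nat -> (nat -> nat) -> R := fun _ c => [forall j : 'I_n, c j == (i <= j)%N]%:R.
have G01 i : in01 (G i) by move=> t c; rewrite /G; case: [forall _, _]; rewrite ?lexx ?ler01.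
have Ggt0 m : forall i, (m + i = n)%N -> 0 < hit p (pred1 n) i (G i).
  elim: m => [|m IH] i.
    rewrite add0n => ->; rewrite hit_stop//=.
    rewrite /G; case: forallP => [_|[] l]; first exact: ltr01.
    by rewrite leqNgt ltn_ord.
  move=> mi; have iltn : (i < n)%N by rewrite -mi addSn ltnS leq_addl.
  apply: lt_le_trans (hit_ge_up (G01 i) iltn); rewrite mulr_gt0//.
  rewrite (_ : (fun t c => G i t (incr i c)) = G i.+1); first by apply: IH; rewrite addnS.
  apply/funext => t; apply/funext => c; congr (nat_of_bool _)%:R.
  by apply/forallP/forallP => E l; have := E l; rewrite /incr; lia.
apply: lt_le_trans (Ggt0 (n - a)%N a _) _; first by rewrite subnK// ltnW.
apply: (ler_hit _ p_ge0 p_sum) => //.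
  by apply: in01_prod3; [exact: unitfun1|exact: unitfun_once_b].
move=> t c; rewrite /G /prod3 /once_b; case: forallP => [E|_].
  have /= := E (Ordinal a_lt); rewrite leqnn => ->.
  by have /= := E (Ordinal b_lt); rewrite leqnSn => ->; rewrite !mulr1.
by rewrite mul1r mulr_ge0.
Qed.

(** The difference is the weight of the paths that visit [a] once and are not straight below ([N]).
    Those that begin with the jump to [j] are among them whatever follows, and from [j] the weight
    of a single visit to [a] is positive. *)
Lemma hit_b1_strict j : (j < a)%N -> 0 < p a.+1 j ->
  H a.+1 (straight_below a) 1 cst1 < H a.+1 cst1 1 cst1.
Proof.
move=> ja pbj.
pose N (c : nat -> nat) : R := (~~ [forall j : 'I_a, c j == (a <= j)%N])%:R.
have N01 : unitfun N by exact: unitfun_nat.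
have I01 g : unitfun g -> in01 (prod3 a g 1 cst1) by move=> ?; apply: in01_prod3 => //; exact: unitfun1.
rewrite -subr_gt0 (_ : _ - _ = H a.+1 N 1 cst1); last first.
  apply/eqP; rewrite subr_eq; apply/eqP.
  rewrite -(hitD _ p_ge0 p_sum); [|exact: I01|exact/I01/unitfun_straight].
  congr (hit _ _ _); apply/funext => t; apply/funext => c; rewrite /prod3 /N /straight_below.
  by case: [forall _, _]; rewrite !(mul1r, mul0r, addr0, add0r).
rewrite (hit_recS unitfun1 _ N01) ?ltn_eqF//.
have jb : (j < a.+3)%N by rewrite ltnS (leq_trans (ltnW ja))// ltnW.
rewrite (bigD1 (Ordinal jb))//=; apply: ltr_wpDr.
  apply: sumr_ge0 => l _; rewrite mulr_ge0//; apply: (hit_ge0 _ p_ge0 p_sum).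
  exact/in01_incr/I01.
rewrite mulr_gt0// (_ : hit _ _ _ _ = H j cst1 1 cst1); last first.
  apply: hit_visits; [exact/in01_incr/I01|exact/I01/unitfun1| |].
    by rewrite ltnW// (ltn_trans ja).
  move=> t c [v1 _ _]; rewrite /prod3 [incr _ c a]/incr (ltn_eqF (ltnSn a)) add0n.
  congr (_ * _ * _); rewrite /N; case: forallP => // /(_ (Ordinal ja))/=.
  have jb1 : (j < a.+1)%N by exact: ltnW.
  rewrite /incr [(a <= j)%N]leqNgt ja (ltn_eqF jb1) add0n.
  have : (0 < c j)%N by apply: v1; rewrite leqnn (ltn_trans ja).
  by case: (c j).
rewrite hit_const_below//; [|exact: unitfun1|exact: ltnW].
apply: lt_le_trans hit_a1_gt0 _; apply: (ler_hit _ p_ge0 p_sum).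
- by apply: in01_prod3; [exact: unitfun1|exact: unitfun_once_b].
- exact/I01/unitfun1.
- move=> t c; rewrite /prod3 ler_wpM2l ?mulr_ge0//.
  by have /andP[] := unitfun_once_b c.
Qed.

(** Order 0 in the time spent in [a]: with one visit to [a], the constraint below contributes the
    factor [\prod_(i < a) p i i.+1] whatever happens above. *)
Lemma excursion_identity :
  H 0 (straight_below 0) 1 once_b * H 0 cst1 1 cst1 =
  H 0 (straight_below 0) 1 cst1 * H 0 cst1 1 once_b.
Proof.
have u1 := unitfun1; have l1 := local_above_cst1.
have ub := unitfun_once_b; have lb := local_above_once_b.
rewrite !hit_straight// !hit_straight_a1// ![H 0 cst1 _ _]hit_const_below//; ring.
Qed.

(** Order 1. The contributions whose first excursion from [a] goes down cancel. On the left an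
    upward one is incompatible with [once_b]; what remains is a positive multiple of the gap in
    [hit_b1_strict]. *)
Lemma excursion_inequality j : (j < a)%N -> 0 < p a.+1 j ->
  H 0 (straight_below 0) 1 cst1 * H 0 cst1 2 once_b +
  H 0 (straight_below 0) 2 cst1 * H 0 cst1 1 once_b <
  H 0 (straight_below 0) 1 once_b * H 0 cst1 2 cst1.
Proof.
move=> ja pbj; have u1 := unitfun1; have l1 := local_above_cst1.
have ub := unitfun_once_b; have lb := local_above_once_b.
rewrite !hit_straight// ![H 0 cst1 _ _]hit_const_below// !hit_straight_a1//.
rewrite !hit_straight_a2// !hit_a2// hit_b1_once mulr0 addr0.
have := hit_b1_strict ja pbj; have := hit_a1_gt0; have := p_up a.
have : 0 < \prod_(i < a) p i i.+1 by apply: prodr_gt0.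
set U := \prod_(i < a) _; set x := H a cst1 1 once_b; set y := H a cst1 1 cst1.
set u := p a a.+1; set X := H a.+1 _ 1 cst1; set Y := H a.+1 _ 1 cst1.
move=> U0 u0 x0 XY; rewrite -subr_gt0.
rewrite (_ : _ - _ = U * x * u * (Y - X)); last ring.
by rewrite !mulr_gt0// subr_gt0.
Qed.

End excursion_inequality.

(** * Densities and translations *)

Import HBNNSimple.

Section density.
Local Open Scope ereal_scope.
Context d (T : measurableType d) (R : realType).
Variables (mu nu : {measure set T -> \bar R}) (g : T -> \bar R).
Hypothesis g_ge0 : forall x, 0 <= g x.
Hypothesis g_fin : forall x, g x \is a fin_num.
Hypothesis g_meas : measurable_fun setT g.
Hypothesis nuE : forall A, measurable A -> nu A = \int[mu]_(x in A) g x.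

Lemma ge0_integral_density E f : measurable E -> (forall x, 0 <= f x) ->
  measurable_fun E f ->
  \int[nu]_(x in E) f x = \int[mu]_(x in E) (f x * g x).
Proof.
move=> mE f0 mf.
pose h := nnsfun_approx mE mf.
have -> : \int[nu]_(x in E) f x =
    lim (\int[nu]_(x in E) (EFin \o h n) x @[n --> \oo]).
  have fE x : E x -> f x = lim ((EFin \o h n) x @[n --> \oo]).
    by move=> Ex; apply/esym/cvg_lim => //; exact: cvg_nnsfun_approx.
  under eq_integral => x /[!inE] /fE -> //.
  apply: monotone_convergence => //.
  - move=> n; apply/measurable_EFinP.
    by apply: (measurable_funS measurableT) => //; exact/measurable_funP.
  - by move=> n x Ex //=; rewrite lee_fin.
  - by move=> x Ex a b ab; rewrite lee_fin; exact/lefP/nd_nnsfun_approx.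
have -> : \int[mu]_(x in E) (f \* g) x =
    lim (\int[mu]_(x in E) ((EFin \o h n) \* g) x @[n --> \oo]).
  have fg x : E x -> f x * g x = lim (((EFin \o h n) \* g) x @[n --> \oo]).
    by move=> Ex; apply/esym/cvg_lim => //; apply: cvgeZr => //;
      exact: cvg_nnsfun_approx.
  under eq_integral => x /[!inE] /fg -> //.
  apply: monotone_convergence => [//| | |].
  - move=> n; apply/emeasurable_funM; apply/measurable_funTS => //.
    exact/measurable_EFinP.
  - by move=> n x Ex /=; rewrite mule_ge0 ?lee_fin.
  - by move=> x Ex a b ab/=; rewrite lee_wpmul2r ?lee_fin//; exact/lefP/nd_nnsfun_approx.
suff suf n : \int[mu]_(x in E) ((EFin \o h n) x * g x) =
    \int[nu]_(x in E) (EFin \o h n) x.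
  by congr (lim (_ @ \oo)); apply/funext => n; rewrite -suf.
transitivity (\int[nu]_(x in E)
   (\sum_(y \in range (h n)) (y * \1_(h n @^-1` [set y]) x)%:E)); last first.
  by apply: eq_integral => t tE; rewrite /= fimfunE -fsumEFin.
have indich m r : measurable_fun E (fun x => (r * \1_(h m @^-1` [set r]) x)%:E).
  by apply: (measurable_comp measurableT) => //; exact: measurable_funM.
rewrite ge0_integral_fsum//; last by move=> m y Ey; exact: nnfun_muleindic_ge0.
transitivity (\int[mu]_(x in E) (\sum_(y \in range (h n))
    (y * \1_(h n @^-1` [set y]) x)%:E * g x)).
  under [RHS]eq_integral => x xE.
    rewrite -ge0_mule_fsuml => [|y]; last exact: nnfun_muleindic_ge0.
    rewrite fsumEFin // -(fimfunE _ x); over.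
  by [].
rewrite ge0_integral_fsum//; last 2 first.
  - move=> y; apply: emeasurable_funM => //; exact: measurable_funTS.
  - by move=> m y Ey; rewrite mule_ge0 ?nnfun_muleindic_ge0.
apply: eq_fsbigr => r rhn.
under [RHS]eq_integral do rewrite EFinM.
rewrite integralZl_indic_nnsfun// integral_indic//.
under eq_integral do rewrite EFinM -muleA.
rewrite ge0_integralZl//; last 3 first.
- apply: emeasurable_funM; last exact: measurable_funTS.
  exact/measurable_EFinP.
- by move=> x _; rewrite mule_ge0// lee_fin.
- by move: rhn; rewrite inE => -[x _ <-]; rewrite lee_fin.
congr (_ * _); rewrite nuE; last exact: measurableI.
rewrite setIC [RHS]integral_mkcondr; apply: eq_integral => x xE.
by rewrite epatch_indic muleC.
Qed.

End density.

Section translation.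
Context {R : realType}.
Local Notation mu := (@lebesgue_measure R).
Local Open Scope ereal_scope.

Lemma lebesgue_measure_translate (t : R) (A : set R) : measurable A ->
  pushforward mu (fun x : measurableTypeR R => (x + t)%R : measurableTypeR R) A = mu A.
Proof.
move=> mA; apply/esym/lebesgue_measure_unique => //=; first exact: measurable_funD.
move=> _ _ [[a b]] _ <-.
rewrite /pushforward (_ : _ @^-1` _ = `](a - t)%R, (b - t)%R]%classic).
  rewrite !lebesgue_measure_itv/= !lte_fin ltrD2r; case: ifP => // _.
  by congr (_%:E); ring.
by apply/seteqP; split => x /=; rewrite !in_itv/= ltrBlDr lerBrDr.
Qed.

Lemma ge0_integral_translate (t : R) (f : R -> \bar R) :
  measurable_fun [set: R] f -> (forall r, 0 <= f r) ->
  \int[mu]_x f (x + t)%R = \int[mu]_x f x.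
Proof.
move=> mf f0.
have mt : @measurable_fun _ _ (measurableTypeR R) (measurableTypeR R) setT (fun x => (x + t)%R).
  by apply: measurable_funD.
have E := @ge0_integral_pushforward _ _ (measurableTypeR R) (measurableTypeR R) R _ mt (lebesgue_measure : {measure set (measurableTypeR R) -> \bar R}) setT f measurableT mf (fun y _ => f0 y).
rewrite preimage_setT in E; rewrite -[LHS]E.
by apply: eq_measure_integral => //= A mA AS; rewrite lebesgue_measure_translate.
Qed.

End translation.

(** * Sums of exponential variables *)

Section convolution.
Context {R : realType}.
Local Notation RR := (measurableTypeR R).

Definition add_coords (z : RR * RR) : RR := (z.1 : R) + z.2.

Lemma measurable_add_coords : measurable_fun setT add_coords.
Proof. exact: (measurable_funD (f := fst : RR * RR -> R) (g := snd : RR * RR -> R)). Qed.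

HB.instance Definition _ := isMeasurableFun.Build _ _ _ _ add_coords measurable_add_coords.

Definition conv (m1 m2 : probability RR R) : probability RR R :=
  distribution (m1 \x m2)%E add_coords.

Lemma convE (m1 m2 : probability RR R) B :
  conv m1 m2 B = (\int[m1]_x m2 [set y : R | B ((x : R) + y)%R])%E.
Proof.
rewrite /conv/= /distribution/= /pushforward /product_measure1.
apply: eq_integral => x _ /=; congr (m2 _).
by apply/seteqP; split => y /=; rewrite /xsection/= ?inE.
Qed.

End convolution.

Section gamma.
Context {R : realType}.
Local Notation mu := (@lebesgue_measure R).
Local Notation RR := (measurableTypeR R).
Variable a : R.
Hypothesis a_gt0 : 0 < a.

Definition exp_law : probability RR R.
Proof. unshelve refine (exponential_prob a : probability RR R); exact: a_gt0. Defined.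

Lemma exp_lawE B : exp_law B = exponential_prob a B.
Proof. by []. Qed.

Fixpoint gamma_law (c : nat) : probability RR R :=
  if c is c'.+1 then conv (gamma_law c') exp_law else (\d_(0 : RR) : probability RR R).

(** Density of [gamma_law c.+1], not of [gamma_law c]: the shift makes it [a e^{-ax}] times the term
    of index [c] of the exponential series in [ax], while [gamma_law 0] has no density. *)
Definition gamma_pdf (c : nat) (x : R) : R :=
  if 0 <= x then a ^+ c.+1 * (x ^+ c / c`!%:R) * expR (- a * x) else 0.

Lemma gamma_pdf_ge0 c x : 0 <= gamma_pdf c x.
Proof.
rewrite /gamma_pdf; case: ifP => // x0.
by rewrite !mulr_ge0 ?expR_ge0 ?exprn_ge0 ?invr_ge0 ?ler0n// ltW.
Qed.

Lemma measurable_gamma_pdf c : measurable_fun [set: R] (gamma_pdf c).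
Proof.
apply: measurable_fun_if => //.
- exact: measurable_fun_ler.
- apply: measurable_funTS; apply: measurable_funM.
    apply: measurable_funM; first exact: measurable_cst.
    by apply: measurable_funM; [exact: exprn_measurable|exact: measurable_cst].
  by apply: measurableT_comp => //; apply: measurable_funM.
Qed.

Lemma gamma_pdf0 : gamma_pdf 0 = exponential_pdf a.
Proof.
apply/funext => x; rewrite /gamma_pdf /exponential_pdf patchE.
by rewrite mem_setE/= in_itv/= andbT; case: ifP => // _; rewrite expr0 fact0 divr1 mulr1 expr1.
Qed.

Lemma integral_power_fact c (u : R) : 0 <= u ->
  (\int[mu]_(x in `[0%R, u]) (x ^+ c / c`!%:R)%:E = (u ^+ c.+1 / c.+1`!%:R)%:E)%E.
Proof.
rewrite le_eqVlt => /predU1P[<-|u0].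
  by rewrite set_itv1 integral_set1 expr0n mul0r.
have cX k l : continuous (fun x : R => x ^+ k / l).
  move=> x; apply: (@continuousM _ R^o (fun x : R => x ^+ k) (fun=> l^-1)).
    exact: exprn_continuous.
  exact: cst_continuous.
rewrite (@continuous_FTC2 _ _ (fun x => x ^+ c.+1 / c.+1`!%:R)) //.
- by rewrite expr0n mul0r sube0.
- by apply: continuous_subspaceT => x; exact: cX.
- split.
  + by move=> z _; apply: derivableM => //; exact: exprn_derivable.
  + by apply: cvg_at_right_filter; exact: cX.
  + by apply: cvg_at_left_filter; exact: cX.
- move=> z _; rewrite derive1Mr//; last exact: exprn_derivable.
  rewrite exp_derive1/= factS natrM invfM mulrACA.
  by rewrite divff ?mul1r// pnatr_eq0.
Qed.

(** The factors [e^{-a(y-x)}] and [e^{-ax}] merge into [e^{-ay}], which leaves the integral of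
    [x^c / c!] over [[0, y]]. *)
Lemma exponential_pdf_gamma_pdf c (y : R) :
  (\int[mu]_x (exponential_pdf a (y - x) * gamma_pdf c x)%:E = (gamma_pdf c.+1 y)%:E)%E.
Proof.
have -> : (\int[mu]_x (exponential_pdf a (y - x) * gamma_pdf c x)%:E =
    \int[mu]_(x in `[0%R, y]) (a ^+ c.+2 * expR (- a * y) * (x ^+ c / c`!%:R))%:E)%E.
  rewrite [RHS]integral_mkcond; apply: eq_integral => x _.
  rewrite patchE mem_setE/= in_itv/= /gamma_pdf.
  have [x0|x0] := leP 0 x; last by rewrite mulr0.
  have [xy|yx] := leP x y; last by rewrite lt0_exponential_pdf ?mul0r// subr_lt0.
  rewrite exponential_pdfE ?subr_ge0//; congr (_%:E).
  rewrite (_ : - a * y = - a * (y - x) + (- a * x)); last ring.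
  rewrite expRD [a ^+ c.+2]exprS; ring.
have [y0|y0] := leP 0 y; last first.
  by rewrite set_itv_ge ?integral_set0 -?leNgt// /gamma_pdf leNgt y0.
under eq_integral do rewrite EFinM.
rewrite ge0_integralZl//.
- by rewrite integral_power_fact// -EFinM /gamma_pdf y0; congr (_%:E); ring.
- apply/measurable_EFinP; apply: measurable_funTS; apply: measurable_funM.
    exact: exprn_measurable.
  exact: measurable_cst.
- move=> x; rewrite /= in_itv/= => /andP[x0 _].
  by rewrite lee_fin mulr_ge0 ?exprn_ge0 ?invr_ge0 ?ler0n.
- by rewrite lee_fin mulr_ge0 ?expR_ge0// exprn_ge0// ltW.
Qed.

Lemma measurable_exp_law_translate (B : set R) : measurable B ->
  measurable_fun [set: R] (fun x : R => exp_law [set y : R | B (x + y)]).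
Proof.
move=> mB; have mA : measurable ((add_coords : RR * RR -> RR) @^-1` B).
  by rewrite -[X in measurable X]setTI; exact: measurable_add_coords.
have := measurable_fun_xsection (exp_law : {measure set RR -> \bar R}) mA.
apply: eq_measurable_fun => x _ /=; congr (exponential_prob a _).
by apply/seteqP; split => y /=; rewrite /xsection/= ?inE.
Qed.

Lemma gamma_lawE c (B : set R) : measurable B ->
  gamma_law c.+1 B = (\int[mu]_(x in B) (gamma_pdf c x)%:E)%E.
Proof.
elim: c B => [|c IH] B mB.
  rewrite [gamma_law 1]/= convE integral_dirac//; last exact: measurable_exp_law_translate.
  rewrite diracT mul1e gamma_pdf0; congr exponential_prob.
  by apply/seteqP; split => x /=; rewrite add0r.
rewrite [gamma_law c.+2]/= convE.
pose f (z : RR * RR) := (\1_B z.2 * (exponential_pdf a ((z.2 : R) - z.1) * gamma_pdf c z.1))%:E.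
have mf : measurable_fun setT f.
  apply/measurable_EFinP; apply: measurable_funM.
    exact: measurableT_comp.
  apply: measurable_funM; last first.
    by apply: measurableT_comp => //; exact: measurable_gamma_pdf.
  apply: measurableT_comp; first exact: measurable_exponential_pdf.
  by apply: (measurable_funB (f := snd : RR * RR -> R) (g := fst : RR * RR -> R)).
have f0 z : (0 <= f z)%E.
  rewrite lee_fin !mulr_ge0 ?gamma_pdf_ge0//.
  by apply: exponential_pdf_ge0; exact: ltW.
rewrite (@ge0_integral_density _ RR R (lebesgue_measure : {measure set RR -> \bar R})
  (gamma_law c.+1) (fun x => (gamma_pdf c x)%:E) _ _ _ IH setT)//; last first.
- exact: measurable_exp_law_translate.
- by apply/measurable_EFinP; exact: measurable_gamma_pdf.
- by move=> x; rewrite lee_fin gamma_pdf_ge0.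
(* Translating by [x] makes the value [y] of the sum the inner variable; Tonelli then integrates [x]
   out for fixed [y]. *)
transitivity (\int[mu]_x \int[mu]_y f (x, y))%E.
  apply: eq_integral => x _.
  rewrite exp_lawE /exponential_prob integral_mkcond.
  have e0 y : 0 <= exponential_pdf a y by apply: exponential_pdf_ge0; exact: ltW.
  have mg : measurable_fun [set: R] (fun y : R => (exponential_pdf a (y - x) * \1_B y)%:E).
    apply/measurable_EFinP; apply: measurable_funM; last exact: measurable_indic.
    apply: measurableT_comp; first exact: measurable_exponential_pdf.
    exact: measurable_funB.
  have fE y : f (x, y) = ((gamma_pdf c x)%:E * (exponential_pdf a (y - x) * \1_B y)%:E)%E.
    by rewrite /f/= -EFinM; congr (_%:E); ring.
  under [RHS]eq_integral do rewrite fE.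
  rewrite ge0_integralZl//; last 2 first.
  - by move=> y _; rewrite lee_fin mulr_ge0.
  - by rewrite lee_fin gamma_pdf_ge0.
  rewrite muleC -(ge0_integral_translate x mg)//; last first.
    by move=> y; rewrite lee_fin mulr_ge0.
  congr (_ * _)%E; apply: eq_integral => y _.
  rewrite patchE addrK indicE [y + x]addrC.
  rewrite (_ : (y \in _) = (x + y \in B)); last by apply/idP/idP; rewrite !inE.
  by case: ifP => _; rewrite ?mulr1 ?mulr0.
rewrite (fubini_tonelli f)//.
rewrite [RHS]integral_mkcond; apply: eq_integral => y _.
rewrite patchE /f/= indicE.
case: ifPn => _; last by under eq_integral do rewrite mul0r; rewrite integral0.
by under eq_integral do rewrite mul1r; rewrite exponential_pdf_gamma_pdf.
Qed.

End gamma.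

(** * Law of the occupation times *)

(** Passes from rectangles to events on the sum of two coordinates. In [path_law_step], [K] is the
    probability of all other constraints and may be zero. *)
Lemma scaled_product_measure_unique d1 d2 (T1 : measurableType d1)
    (T2 : measurableType d2) (R : realType) (m1 : probability T1 R)
    (m2 : probability T2 R) (K : R) (nu : {measure set (T1 * T2) -> \bar R}) :
  0 <= K ->
  (forall A B, measurable A -> measurable B ->
     nu (A `*` B) = (K%:E * (m1 A * m2 B))%E) ->
  forall X, measurable X -> nu X = (K%:E * (m1 \x m2) X)%E.
Proof.
move=> K0 nuE X mX; pose k := NngNum K0.
have := @product_measure_unique _ _ T1 T2 R (mscale k m1) m2 nu.
move=> <-//; last by move=> A B mA mB; rewrite nuE// /mscale/= muleA.
rewrite /product_measure1/= ge0_integral_mscale//.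
exact: measurable_fun_xsection.
Qed.

Section path_law.
Context d (Omega : measurableType d) (R : realType) (P : probability Omega R).
Variables (Q : nat -> nat -> R) (n : nat).
Variables (Y : nat -> {RV P >-> nat}) (S : nat -> {RV P >-> R}).
Hypothesis rate_gt0 : forall i, 0 < - Q i i.
Hypothesis law : jump_hold_law Q 0 Y S.
Local Notation RR := (measurableTypeR R).

Definition glaw i c : probability RR R := gamma_law (rate_gt0 i) c.

Lemma glaw0 i B : glaw i 0 B = \d_(0 : RR) B.
Proof. by []. Qed.

Lemma glawS i c B :
  glaw i c.+1 B = (glaw i c \x exp_law (rate_gt0 i))%E (add_coords @^-1` B).
Proof. by []. Qed.

Definition visit_count (y : nat -> nat) r i : nat := \sum_(k < r) (y k == i).

Definition visit_time (y : nat -> nat) r i (w : Omega) : R :=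
  \sum_(k < r) (y k == i)%:R * S k w.

Definition path_weight (y : nat -> nat) m : R :=
  (y 0%N == 0%N)%:R * \prod_(k < m) jump_prob Q (y k) (y k.+1).

Lemma measurable_visit_time y r i : measurable_fun setT (visit_time y r i).
Proof. by apply: measurable_sum => k; apply: measurable_funM. Qed.

Lemma measurable_Y_eq k j : measurable [set w | Y k w = j].
Proof.
rewrite -[X in measurable X]setTI.
by apply: (measurable_funP (Y k) measurableT [set j]).
Qed.

Hypothesis p_ge0 : forall i j, 0 <= jump_prob Q i j.

Lemma path_weight_ge0 y m : 0 <= path_weight y m.
Proof. by rewrite /path_weight mulr_ge0// prodr_ge0. Qed.

(** Interpolates between the given law ([r = 0], each holding time constrained separately) and the
    occupation times ([r = m]): the first [r] holding times are already grouped by state. *)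
Let ev (y : nat -> nat) m r (B C : nat -> set R) :=
  [set w | (forall k, (k <= m)%N -> Y k w = y k) /\
     (forall i, (i < n)%N -> B i (visit_time y r i w)) /\
     (forall k, (r <= k < m)%N -> C k (S k w))].

Lemma measurable_path y m : measurable [set w | forall k, (k <= m)%N -> Y k w = y k].
Proof.
rewrite (_ : [set _ | _] = \bigcap_(k in [set k | (k <= m)%N]) [set w | Y k w = y k]); last first.
  by apply/seteqP; split => w.
by apply: bigcap_measurableType => k _; exact: measurable_Y_eq.
Qed.

(** Moving from [r] to [r.+1] adds [S r] to the time of the state [y r]. By the induction hypothesis
    on rectangles, that time and [S r] are independent on the event fixed by the other constraints,
    so their sum follows the convolution, a gamma law with one more term. *)
Lemma path_law_step y m : (forall k, (k < m)%N -> (y k < n)%N) ->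
  forall r, (r <= m)%N -> forall B C, (forall i, measurable (B i)) ->
   (forall k, measurable (C k)) ->
  P (ev y m r B C) = ((path_weight y m)%:E *
    (\prod_(i < n) glaw i (visit_count y r i) (B i) *
     \prod_(k < m | (r <= k)%N) exponential_prob (- Q (y k) (y k)) (C k)))%E.
Proof.
move=> yn; elim=> [|r IH] rm B C mB mC.
  have [B0|/existsNP[i /not_implyP[iltn B0]]] := pselect (forall i, (i < n)%N -> B i 0).
    rewrite [X in (_ * (X * _))%E]big1 ?mul1e; last first.
      move=> i _; rewrite /visit_count big_ord0 glaw0 diracE mem_set//; exact: B0.
    rewrite -(law m y mC); congr (P _); apply/seteqP; split => w /= [Yw].
      by move=> [_ Cw]; split => // k km; exact: Cw.
    move=> Cw; split => //; split => [i iltn|k /andP[_ km]]; last exact: Cw.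
    by rewrite /visit_time big_ord0; exact: B0.
  rewrite (_ : ev _ _ _ _ _ = set0); last first.
    apply/seteqP; split => // w /= [_ [/(_ i iltn)]].
    by rewrite /visit_time big_ord0.
  rewrite measure0 (bigD1 (Ordinal iltn))//= /visit_count big_ord0 glaw0 diracE.
  by rewrite memNset// !mul0e mule0.
pose i0 := y r.
have i0n : (i0 < n)%N by exact: yn.
pose B1 B' i := if i == i0 then B' else B i.
pose C1 C' k := if k == r then C' else C k.
pose A := [set w | (forall k, (k <= m)%N -> Y k w = y k) /\
     (forall i, (i < n)%N -> i != i0 -> B i (visit_time y r i w)) /\
     (forall k, (r < k < m)%N -> C k (S k w))].
pose K := ((path_weight y m)%:E *
    (\prod_(i < n | i != Ordinal i0n) glaw i (visit_count y r i) (B i) *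
     \prod_(k < m | (r < k)%N) exponential_prob (- Q (y k) (y k)) (C k)))%E.
pose LS (w : Omega) : RR * RR := (visit_time y r i0 w, S r w).
have mLS : measurable_fun setT LS.
  have mS : measurable_fun setT (S r) by exact: measurable_funPT.
  by apply/measurable_fun_pairP; split; [exact: measurable_visit_time|exact: mS].
have mA : measurable A.
  rewrite (_ : A = [set w | forall k, (k <= m)%N -> Y k w = y k] `&`
    ((\bigcap_(i in [set i | (i < n)%N && (i != i0)]) (visit_time y r i @^-1` B i)) `&`
     (\bigcap_(k in [set k | (r < k < m)%N]) (S k @^-1` C k)))); last first.
    apply/seteqP; split => w /= [Yw [Bw Cw]]; split => //; split.
    - by move=> i /= /andP[? ?]; exact: Bw.
    - by move=> k /= ?; exact: Cw.
    - by move=> i ? ?; apply: Bw => /=; apply/andP.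
    - by move=> k ?; exact: Cw.
  apply: measurableI; first exact: measurable_path.
  apply: measurableI; apply: bigcap_measurableType => k _; rewrite -[X in measurable X]setTI.
    exact: measurable_visit_time.
  exact: measurable_funPT.
have evA B' C' : P (A `&` LS @^-1` (B' `*` C')) = P (ev y m r (B1 B') (C1 C')).
  congr (P _); apply/seteqP; split => w /=.
    move=> [[Yw [Bw Cw]] [B'w C'w]]; split => //; split.
    - move=> i iltn; rewrite /B1; case: eqP => [->//|/eqP ii]; exact: Bw.
    - move=> k /andP[rk km]; rewrite /C1; case: eqP => [->//|/eqP kr].
      by apply: Cw; rewrite km andbT ltn_neqAle eq_sym kr.
  move=> [Yw [Bw Cw]]; split; [split => //; split|split].
  - by move=> i iltn ii; have := Bw i iltn; rewrite /B1 (negbTE ii).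
  - by move=> k /andP[rk km]; have := Cw k; rewrite (ltnW rk) km /C1 gtn_eqF// => /(_ isT).
  - by have := Bw i0 i0n; rewrite /B1 eqxx.
  - by have := Cw r; rewrite leqnn rm /C1 eqxx => /(_ isT).
have K_fin : K \is a fin_num.
  rewrite /K fin_numM// fin_numM//; apply: prode_fin_num => i _.
    by apply: fin_num_measure; exact: mB.
  by rewrite -(exp_lawE (rate_gt0 _)); apply: fin_num_measure; exact: mC.
have K_ge0 : (0 <= K)%E.
  rewrite /K mule_ge0 ?lee_fin ?path_weight_ge0// mule_ge0//; apply: prode_ge0 => i _ //.
  by rewrite -(exp_lawE (rate_gt0 _)).
have rect B' C' : measurable B' -> measurable C' ->
    P (A `&` LS @^-1` (B' `*` C')) =
    (K * (glaw i0 (visit_count y r i0) B' * exp_law (rate_gt0 i0) C'))%E.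
  move=> mB' mC'; rewrite evA IH ?(ltnW rm)//; last 2 first.
  - by move=> i; rewrite /B1; case: ifP.
  - by move=> k; rewrite /C1; case: ifP.
  rewrite (bigD1 (Ordinal i0n))//= /B1 eqxx.
  rewrite [X in (_ * ((_ * X) * _))%E](eq_bigr (fun i : 'I_n => glaw i (visit_count y r i) (B i))); last first.
    by move=> i /negbTE; rewrite -val_eqE/= => ->.
  rewrite (bigD1 (Ordinal rm))//= /C1 eqxx.
  rewrite [X in (_ * (_ * (_ * X)))%E](_ : _ =
    (\prod_(k < m | (r < k)%N) exponential_prob (- Q (y k) (y k)) (C k))%E); last first.
    apply: eq_big => k; first by rewrite -val_eqE/= eq_sym [RHS]ltn_neqAle andbC eq_sym.
    by move=> /andP[_ /negbTE]; rewrite -val_eqE/= => ->.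
  rewrite /K; set x := (\prod_(i < n | _) _)%E; set z := (\prod_(k < m | _) _)%E.
  by rewrite -[RHS]muleA; congr (_ * _)%E; rewrite muleACA muleC.
have k0 : 0 <= fine K by exact: fine_ge0.
unshelve epose (nu := pushforward (mrestr P mA) LS : {measure set (RR * RR) -> \bar R}).
  exact: mLS.
have nuE X : measurable X -> P (A `&` LS @^-1` X) =
    (K * (glaw i0 (visit_count y r i0) \x exp_law (rate_gt0 i0)) X)%E.
  move=> mX; rewrite setIC -[LHS]/(nu X) -(fineK K_fin).
  apply: (@scaled_product_measure_unique _ _ RR RR R) => // B' C' mB' mC'.
  by rewrite fineK// -rect// setIC.
have mD : measurable (add_coords @^-1` (B i0) : set (RR * RR)).
  by rewrite -[X in measurable X]setTI; apply: measurable_add_coords => //; exact: mB.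
rewrite (_ : ev y m r.+1 B C = A `&` LS @^-1` (add_coords @^-1` (B i0))); last first.
  have time_r i w : visit_time y r.+1 i w = visit_time y r i w + (i0 == i)%:R * S r w.
    by rewrite /visit_time big_ord_recr.
  apply/seteqP; split => w /=.
    move=> [Yw [Bw Cw]]; split; [split => //; split|].
    - move=> i iltn ii; have := Bw i iltn; rewrite time_r eq_sym (negbTE ii).
      by rewrite mul0r addr0.
    - by move=> k ?; exact: Cw.
    - by have := Bw i0 i0n; rewrite time_r eqxx mul1r.
  move=> [[Yw [Bw Cw]] Bi0]; split => //; split => //.
  move=> i iltn; rewrite time_r; have [<-|ii] := eqVneq i0 i; first by rewrite mul1r.
  by rewrite mul0r addr0; apply: Bw => //; rewrite eq_sym.
have prodE : (\prod_(i < n) glaw i (visit_count y r.+1 i) (B i) =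
    glaw i0 (visit_count y r i0).+1 (B i0) *
    \prod_(i < n | i != Ordinal i0n) glaw i (visit_count y r i) (B i))%E.
  rewrite (bigD1 (Ordinal i0n))//=; congr (_ * _)%E.
    by rewrite /visit_count big_ord_recr/= eqxx addn1.
  apply: eq_bigr => i; rewrite -val_eqE/= => ii.
  by rewrite /visit_count big_ord_recr/= eq_sym (negbTE ii) addn0.
rewrite nuE// -glawS /K prodE -muleA; congr (_ * _)%E.
by rewrite [LHS]muleC [LHS]muleA.
Qed.

Lemma path_law y m (B : nat -> set R) : (forall k, (k < m)%N -> (y k < n)%N) ->
  (forall i, measurable (B i)) ->
  P [set w | (forall k, (k <= m)%N -> Y k w = y k) /\
             (forall i, (i < n)%N -> B i (visit_time y m i w))] =
  ((path_weight y m)%:E * \prod_(i < n) glaw i (visit_count y m i) (B i))%E.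
Proof.
move=> yn mB.
have := path_law_step yn (leqnn m) mB (fun=> measurableT).
rewrite [X in (_ * (_ * X))%E]big1 ?mule1; last first.
  by move=> k; rewrite leqNgt ltn_ord.
move=> <-; congr (P _); apply/seteqP; split => w /=.
  by move=> [Yw Bw]; split.
by move=> [Yw [Bw _]]; split.
Qed.

Lemma path_prob y m :
  P [set w | forall k, (k <= m)%N -> Y k w = y k] = (path_weight y m)%:E.
Proof.
have := law m y (fun=> measurableT); rewrite [X in (_ * X)%E]big1 ?mule1; last first.
  by move=> k _; rewrite -(exp_lawE (rate_gt0 _)) probability_setT.
by move=> <-; congr (P _); apply/seteqP; split => w /=; [move=> ?; split|case].
Qed.

Hypothesis p_skipfree : forall i j, (i.+1 < j)%N -> jump_prob Q i j = 0.

Definition first_hit (y : nat -> nat) m :=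
  y m = n /\ forall k, (k < m)%N -> y k <> n.

(** Conditional probability of the constraints [B] given the visit numbers: [c0] counts the visits
    of a prefix already followed, [c] those still to come. The ignored argument is the final
    state. *)
Definition law_functional (B : nat -> set R) (c0 : nat -> nat) (_ : nat)
    (c : nat -> nat) : R :=
  \prod_(i < n) fine (glaw i (c i + c0 i) (B i)).

Let hitev y r K (B : nat -> set R) := [set w |
  (forall k, (k <= r)%N -> Y k w = y k) /\
  exists m, [/\ (r <= m < r + K)%N, first_hit (Y ^~ w) m &
   forall i, (i < n)%N -> B i (visit_time (Y ^~ w) m i w)]].

Lemma measurable_first_hit_time m (B : nat -> set R) : (forall i, measurable (B i)) ->
  measurable [set w | first_hit (Y ^~ w) m /\
    forall i, (i < n)%N -> B i (visit_time (Y ^~ w) m i w)].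
Proof.
move=> mB.
have mne k j : measurable [set w | Y k w <> j].
  by have := measurableC (measurable_Y_eq k j).
rewrite (_ : [set _ | _] = ([set w | Y m w = n] `&`
   \bigcap_(k in [set k | (k < m)%N]) [set w | Y k w <> n]) `&`
   \bigcap_(i in [set i | (i < n)%N]) ((fun w => visit_time (Y ^~ w) m i w) @^-1` B i)).
  apply: measurableI; first apply: measurableI.
  - exact: measurable_Y_eq.
  - by apply: bigcap_measurableType => k _.
  - apply: bigcap_measurableType => i _; rewrite -[X in measurable X]setTI.
    have mt : measurable_fun setT (fun w => visit_time (Y ^~ w) m i w).
      apply: measurable_sum => k; apply: measurable_funM => //.
      have mY : measurable_fun setT (Y k) by exact: measurable_funPT.
      exact: (@measurableT_comp _ _ _ _ _ _ (fun j : nat => (j == i)%:R : R) _ (Y k)).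
    exact: mt.
apply/seteqP; split => w /=.
  by move=> [[? ?] ?]; split.
by move=> [[? ?] ?]; split.
Qed.

Lemma measurable_hitev y r K B : (forall i, measurable (B i)) ->
  measurable (hitev y r K B).
Proof.
move=> mB; rewrite (_ : hitev _ _ _ _ = [set w | forall k, (k <= r)%N -> Y k w = y k] `&`
  \bigcup_(m in [set m | (r <= m < r + K)%N]) [set w | first_hit (Y ^~ w) m /\
    forall i, (i < n)%N -> B i (visit_time (Y ^~ w) m i w)]).
  apply: measurableI; first exact: measurable_path.
  by apply: bigcup_measurable => m _; exact: measurable_first_hit_time.
apply/seteqP; split => w /=.
  by move=> [Yw [m [? ? ?]]]; split => //; exists m.
by move=> [Yw [m ? [? ?]]]; split => //; exists m; split.
Qed.

Lemma fine_prod (B : nat -> set R) (c : nat -> nat) : (forall i, measurable (B i)) ->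
  (\prod_(i < n) glaw i (c i) (B i) = (\prod_(i < n) fine (glaw i (c i) (B i)))%:E)%E.
Proof.
move=> mB; elim/big_rec2: _ => // i x y _ ->.
by rewrite EFinM fineK// fin_num_measure//; exact: mB.
Qed.

(** Induction on the number [K] of remaining steps while the prefix [y] grows by one state; this
    turns the recursion of [hit_sum] into a disjoint union over the next state. *)
Lemma hitev_law B : (forall i, measurable (B i)) -> forall K r y,
  (forall k, (k < r)%N -> (y k < n)%N) -> (y r <= n)%N ->
  P (hitev y r K B) = (path_weight y r * hit_sum (jump_prob Q) (pred1 n) K (y r)
    (law_functional B (visit_count y r)))%:E.
Proof.
move=> mB; elim=> [|K IH] r y yn yrn.
  rewrite /= mulr0 (_ : hitev _ _ _ _ = set0) ?measure0//.
  by apply/seteqP; split => w //= [_ [m [/andP[rm]]]]; rewrite addn0 ltnNge rm.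
rewrite /=; have [yrE|yrN] := eqVneq (y r) n.
  have := path_law yn mB; rewrite fine_prod// -EFinM.
  rewrite /law_functional; under eq_bigr do rewrite -[visit_count _ _ _]add0n.
  move=> <-; congr (P _); apply/seteqP; split => w /= [Yw].
    have YE k : (k < r)%N -> y k = Y k w by move=> kr; rewrite Yw// ltnW.
    move=> [m [/andP[rm _] [Ym Yk] Bw]]; split => // i iltn.
    have {}rm : r = m.
      apply/eqP; move: rm; rewrite leq_eqVlt => /orP[//|rm].
      by have := Yk _ rm; rewrite Yw.
    subst m; rewrite (_ : visit_time y r i w = visit_time (Y ^~ w) r i w); first exact: Bw.
    by apply: eq_bigr => k _; rewrite YE.
  move=> Bw; split => //; exists r; rewrite leqnn addnS ltnS leq_addr; split => //.
    split; first by rewrite Yw.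
    by move=> k kr; rewrite Yw ?(ltnW kr)//; apply/eqP; rewrite ltn_eqF// yn.
  move=> i iltn; rewrite (_ : visit_time (Y ^~ w) r i w = visit_time y r i w); first exact: Bw.
  by apply: eq_bigr => k _; rewrite Yw// ltnW.
have {yrN}yrn : (y r < n)%N by rewrite ltn_neqAle yrN.
pose y' j k := if k == r.+1 then j else y k.
have y'le j k : (k <= r)%N -> y' j k = y k by move=> kr; rewrite /y' ltn_eqF.
have y'S j : y' j r.+1 = j by rewrite /y' eqxx.
have weight' j : path_weight (y' j) r.+1 = path_weight y r * jump_prob Q (y r) j.
  rewrite /path_weight big_ord_recr/= (y'le j 0%N)// (y'le j r)// y'S mulrA.
  by congr (_ * _ * _); apply: eq_bigr => k _; rewrite !y'le// ltnW.
have -> : hitev y r K.+1 B = \bigcup_j hitev (y' j) r.+1 K B.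
  apply/seteqP; split => w /=.
    move=> [Yw [m [/andP[rm mK] fh Bw]]]; exists (Y r.+1 w) => //; split.
      move=> k; rewrite leq_eqVlt => /orP[/eqP ->|kr]; first by rewrite y'S.
      by rewrite y'le// Yw.
    exists m; rewrite addSnnS mK andbT; split => //.
    rewrite ltn_neqAle rm andbT; apply/eqP => rE.
    by case: fh => + _; rewrite -rE Yw// => /eqP; rewrite ltn_eqF.
  move=> [j _ [Yw [m [/andP[rm mK] fh Bw]]]]; split.
    by move=> k kr; rewrite Yw ?(leqW kr)// y'le.
  by exists m; rewrite -addSnnS mK (ltnW rm).
rewrite measure_bigcup//=; last 2 first.
- by move=> j _; exact: measurable_hitev.
- move=> i j _ _ [w [[Yi _] [Yj _]]].
  by have := Yi r.+1 (leqnn _); rewrite Yj// !y'S.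
have H_ge0 j : (0 <= P (hitev (y' j) r.+1 K B))%E by exact: measure_ge0.
under eq_eseriesl do rewrite in_setT.
(* The variable [Y r.+1] may take any value; those above [(y r).+1] have probability zero, which
   leaves the finite sum of [hit_sum]. *)
rewrite (nneseries_split 0 (y r).+2)// add0n [X in (_ + X)%E]eseries0 ?adde0; last first.
  move=> j jy _; apply/eqP; rewrite eq_le H_ge0 andbT.
  apply: (@le_trans _ _ (P [set w | forall k, (k <= r.+1)%N -> Y k w = y' j k])).
    apply: le_measure; rewrite ?inE; [exact: measurable_hitev|exact: measurable_path|].
    by move=> w [].
  by rewrite path_prob weight' p_skipfree// mulr0.
rewrite big_mkord mulr_sumr -sumEFin; apply: eq_bigr => j _.
rewrite IH; last 2 first.
- move=> k; rewrite ltnS leq_eqVlt => /orP[/eqP ->|kr]; first by rewrite y'le.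
  by rewrite y'le ?yn// ltnW.
- by rewrite y'S (leq_trans _ yrn)// -ltnS.
rewrite weight' y'S -mulrA; congr (_ * (_ * hit_sum _ _ _ _ _))%:E.
apply/funext => t; apply/funext => c; apply: eq_bigr => i _; congr (fine (glaw _ _ _)).
rewrite /incr /visit_count big_ord_recr/= y'le//.
rewrite (eq_bigr (fun k : 'I_r => (y k == i : nat))); last by move=> k _; rewrite y'le// ltnW.
rewrite [y r == i]eq_sym. set x := (\sum_(k < r) _)%N; set z := nat_of_bool _. lia.
Qed.
End path_law.

(** * Occupation times along a single path *)

Section deterministic_path.
Variables (R : realType) (x : R -> nat) (y : nat -> nat) (s : nat -> R) (n m : nat).
Local Notation mu := (@lebesgue_measure R).
Let J k : R := \sum_(l < k) s l.
Hypothesis s_gt0 : forall k, 0 < s k.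
Hypothesis xE : forall k t, J k <= t < J k.+1 -> x t = y k.

Let JS k : J k.+1 = J k + s k.
Proof. by rewrite /J big_ord_recr. Qed.

Let J_ge0 k : 0 <= J k.
Proof. by apply: sumr_ge0 => l _; exact: ltW. Qed.

Let J_lt k : J k < J k.+1.
Proof. by rewrite JS ltrDl. Qed.

Lemma jump_interval k t : 0 <= t -> t < J k ->
  exists2 l, (l < k)%N & J l <= t < J l.+1.
Proof.
elim: k => [|k IH] t0; first by rewrite /J big_ord0 ltNge t0.
have [Jt|tJ] := leP (J k) t => tJS; first by exists k => //; rewrite Jt.
by have [l lk lt] := IH t0 tJ; exists l => //; exact: ltnW.
Qed.

Lemma hitting_time_path : y m = n -> (forall k, (k < m)%N -> y k <> n) ->
  ereal_inf [set t%:E | t in [set t | 0 <= t /\ x t = n]] = (J m)%:E.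
Proof.
move=> ym yk; apply/eqP; rewrite eq_le; apply/andP; split.
  apply: ereal_inf_lbound; exists (J m) => //=; split => //.
  by rewrite (@xE m)// lexx J_lt.
apply: le_ereal_inf_tmp => _ /= [t [t0 xt] <-]; rewrite lee_fin leNgt; apply/negP => tJ.
have [l lm Jl] := jump_interval t0 tJ.
by have := yk l lm; rewrite -(xE Jl).
Qed.

(** Measurability is carried along because additivity over the next holding interval requires it. *)
Lemma integral_path_indic k i :
  measurable_fun `[0, J k[%classic (fun t => (\1_[set u | x u = i] t)%:E : \bar R) /\
  (\int[mu]_(t in `[0%R, J k[) (\1_[set u | x u = i] t)%:E =
   (\sum_(l < k) (y l == i)%:R * s l)%:E)%E.
Proof.
elim: k => [|k [IHm IHi]].
  by rewrite /J !big_ord0 set_itvco0 integral_set0; split => //; exact: measurable_fun_set0.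
have split_itv : `[0, J k.+1[%classic = `[0, J k[%classic `|` `[J k, J k.+1[%classic.
  apply/seteqP; split => t /=; rewrite !in_itv/=.
    by move=> /andP[t0 tJ]; have [?|?] := leP (J k) t; [right|left]; apply/andP.
  move=> [/andP[t0 tJ]|/andP[Jt tJ]]; apply/andP; split => //.
    exact: lt_trans tJ _.
  exact: le_trans Jt.
have cst_piece : {in `[J k, J k.+1[%classic, cst ((y k == i)%:R%:E : \bar R) =1
    (fun t => (\1_[set u | x u = i] t)%:E)}.
  move=> t; rewrite inE/= in_itv/= => Jt; rewrite indicE (_ : (t \in _) = (y k == i))//.
  by apply/idP/idP; rewrite inE/= (xE Jt) => /eqP.
have mpiece : measurable_fun `[J k, J k.+1[%classic (fun t => (\1_[set u | x u = i] t)%:E : \bar R).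
  exact: (eq_measurable_fun _ cst_piece).
split; first by rewrite split_itv; apply/measurable_funU.
rewrite split_itv ge0_integral_setU//.
- rewrite IHi big_ord_recr/= EFinD; congr (_ + _)%E.
  rewrite (eq_integral (cst ((y k == i)%:R%:E))); last by move=> t tJ; rewrite cst_piece.
  rewrite integral_cst//= lebesgue_measure_itv/= lte_fin J_lt.
  by rewrite -EFinB -EFinM JS addrAC subrr add0r.
- by apply/measurable_funU.
- apply/disj_setPS => t /= []; rewrite !in_itv/= => /andP[_ tJ] /andP[Jt _].
  by move: (lt_le_trans tJ Jt); rewrite ltxx.
Qed.

End deterministic_path.

(** Only the path before its [m]-th jump is involved, so a later explosion does no harm. *)
Lemma occupation_time_path (Omega : Type) (R : realType) (X : R -> Omega -> nat)
    (n i m : nat) (w : Omega) (y : nat -> nat) (s : nat -> R) :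
  (forall k, 0 < s k) ->
  (forall k t, \sum_(l < k) s l <= t < \sum_(l < k.+1) s l -> X t w = y k) ->
  y m = n -> (forall k, (k < m)%N -> y k <> n) ->
  occupation_time X n i w = (\sum_(l < m) (y l == i)%:R * s l)%:E.
Proof.
move=> s0 XE ym yk; rewrite /occupation_time /hitting_time.
rewrite (hitting_time_path s0 XE ym yk).
rewrite (_ : [set _ | _] = `[0, \sum_(l < m) s l[%classic); last first.
  by apply/seteqP; split => t /=; rewrite in_itv/= lte_fin; [move=> [-> ->]|move=> /andP[]].
exact: (integral_path_indic s0 XE m i).2.
Qed.

(** * Measurability of the hitting and occupation times *)

Section measurability.
Context d (Omega : measurableType d) (R : realType) (X : R -> Omega -> nat).
Hypothesis mX : forall t, 0 <= t -> measurable_fun setT (X t).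
Hypothesis rcX : forall w t, 0 <= t ->
  exists2 e, 0 < e & forall s, t <= s < t + e -> X s w = X t w.
Variable n : nat.
Local Notation RR := (measurableTypeR R).
Local Notation T := (hitting_time X n).

Lemma measurable_X_eq t i : 0 <= t -> measurable [set w | X t w = i].
Proof.
move=> t0; rewrite -[X in measurable X]setTI.
exact: (mX t0 measurableT (Y := [set i])).
Qed.

(** By right-continuity the infimum defining [T] can be taken over nonnegative rationals; this is
    the [k]-th candidate, with [+oo] for a rational that does not qualify. *)
Let h (k : nat) (w : Omega) : \bar R :=
  if unpickle k is Some q then
    if (0 <= (ratr q : R)) && (X (ratr q) w == n) then (ratr q)%:E else +oo%E
  else +oo%E.

Let measurable_h k : measurable_fun setT (h k).
Proof.
rewrite /h; case: (unpickle k) => [q|]; last exact: measurable_cst.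
have [q0|q0] := leP 0 (ratr q : R) => /=; last exact: measurable_cst.
apply: measurable_fun_if => //.
have := @measurable_X_eq _ n q0; rewrite -(setTI [set w | _]) => mXn.
apply: (measurable_fun_bool true); rewrite setTI.
rewrite (_ : _ @^-1` _ = [set w | X (ratr q) w = n]).
  exact: measurable_X_eq.
by apply/seteqP; split => w /= /eqP.
Qed.

Lemma measurable_hitting_time : measurable_fun setT T.
Proof.
rewrite (_ : T = fun w => einfs (h ^~ w) 0%N).
  exact: measurable_fun_einfs.
apply/funext => w; apply/eqP; rewrite eq_le; apply/andP; split.
  apply: le_ereal_inf_tmp => _ /= [k _ <-]; rewrite /h.
  case: (unpickle k) => [q|]; last exact: leey.
  case: ifP => [/andP[q0 /eqP qn]|_]; last exact: leey.
  by apply: ereal_inf_lbound; exists (ratr q).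
apply: le_ereal_inf_tmp => _ /= [t [t0 Xt] <-].
apply/lee_addgt0Pr => e e0.
have [e1 e10 Xe] := rcX w t0.
have te : t < t + Num.min e e1 by rewrite ltrDl lt_min e0.
have [q] := rat_in_itvoo te.
rewrite in_itv/= => /andP[tq qe].
have q0 : 0 <= (ratr q : R) by rewrite (le_trans t0)// ltW.
apply: (@le_trans _ _ (ratr q)%:E); last first.
  by rewrite -EFinD lee_fin ltW// (lt_le_trans qe)// lerD2l ge_min lexx.
apply: ereal_inf_lbound; exists (pickle q) => //.
rewrite /h pickleK q0 Xe ?Xt ?eqxx// ltW//=.
by rewrite (lt_le_trans qe)// lerD2l ge_min lexx orbT.
Qed.

(** By right-continuity [X t] is, for [N] large, the value of [X] at the first point of the grid of
    mesh [1 / N.+1] strictly after [t]. On each cell the event is a rectangle. *)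
Lemma measurable_X_pair i : measurable [set z : Omega * RR | 0 <= (z.2 : R) /\ X z.2 z.1 = i].
Proof.
pose A N j := [set z : Omega * RR | (j%:R / N.+1%:R <= (z.2 : R) < j.+1%:R / N.+1%:R) /\
   X (j.+1%:R / N.+1%:R) z.1 = i].
have -> : [set z : Omega * RR | 0 <= (z.2 : R) /\ X z.2 z.1 = i] =
   \bigcup_M \bigcap_(N in [set N | (M <= N)%N]) \bigcup_j A N j.
  have small (e : R) N : 0 < e -> (Num.truncn e^-1 <= N)%N -> N.+1%:R^-1 < e.
    move=> e0 eN; rewrite invf_plt ?posrE// (lt_le_trans (truncnS_gt _))//.
    by rewrite ler_nat ltnS.
  apply/seteqP; split => [[w t]/= [t0 Xt]|[w t]/= [M _ XM]].
    have [e e0 Xe] := rcX w t0.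
    exists (Num.truncn e^-1) => // N /= MN.
    pose j := Num.truncn (t * N.+1%:R).
    have /andP[jt tj] : j%:R <= t * N.+1%:R < j.+1%:R.
      by apply: truncn_itv; rewrite mulr_ge0.
    exists j => //; rewrite /A/=; rewrite ler_pdivrMr// ltr_pdivlMr// jt tj; split => //.
    rewrite Xe ?Xt// ler_pdivlMr// (ltW tj)/=.
    rewrite -natr1 mulrDl mul1r; apply: ler_ltD; last exact: small.
    by rewrite ler_pdivrMr.
  have t0 : 0 <= t.
    have [j _ /= [/andP[+ _] _]] := XM M (leqnn M).
    by apply: le_trans; rewrite divr_ge0.
  split => //; have [e e0 Xe] := rcX w t0.
  have [j _ /= [/andP[jt tj]]] := XM (maxn M (Num.truncn e^-1)) (leq_maxl _ _).
  rewrite Xe// (ltW tj)/= -natr1 mulrDl mul1r.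
  by apply: ler_ltD => //; apply: small => //; exact: leq_maxr.
apply: bigcup_measurable => M _; apply: bigcap_measurableType => N _.
apply: bigcup_measurable => j _.
rewrite (_ : A N j = [set w | X (j.+1%:R / N.+1%:R) w = i] `*`
   `[j%:R / N.+1%:R, j.+1%:R / N.+1%:R[%classic).
  apply: measurableX; last exact: measurable_itv.
  by apply: measurable_X_eq; rewrite divr_ge0.
by apply/seteqP; split => -[w t]; rewrite /A/= in_itv/= => -[].
Qed.

Lemma measurable_occupation_time i : measurable_fun setT (occupation_time X n i).
Proof.
pose D := [set z : Omega * RR | 0 <= (z.2 : R) /\ X z.2 z.1 = i] `&`
  [set z : Omega * RR | ((z.2 : R)%:E < T z.1)%E].
have mD : measurable D.
  apply: measurableI; first exact: measurable_X_pair.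
  rewrite -[X in measurable X]setTI; apply: measurable_lte => //.
    by apply/measurable_EFinP; exact: measurable_snd.
  by apply: measurableT_comp; [exact: measurable_hitting_time|exact: measurable_fst].
have := @measurable_fun_fubini_tonelli_F _ _ _ RR R
  (lebesgue_measure : {sigma_finite_measure set RR -> \bar R})
  (fun z => (\1_D z)%:E).
have mf : measurable_fun setT (fun z => (\1_D z)%:E : \bar R) by exact/measurable_EFinP/measurable_indic.
have f0 z : (0 <= (\1_D z)%:E :> \bar R)%E by rewrite lee_fin.
move=> /(_ mf f0); apply: eq_measurable_fun => w _.
rewrite /fubini_F /occupation_time [RHS]integral_mkcond; apply: eq_integral => t _.
rewrite patchE !indicE.
have -> : ((w, t) \in D) = (t \in [set s : R | 0 <= s /\ (s%:E < T w)%E]) && (t \in [set s | X s w = i]).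
  by apply/idP/andP; rewrite !inE/=; [move=> [[? ?] ?]|move=> [[? ?] ?]]; split.
by case: (_ \in _).
Qed.

End measurability.

Lemma eq_measure_ae d (T : measurableType d) (R : realType)
    (mu : {measure set T -> \bar R}) (A B : set T) :
  measurable A -> measurable B -> {ae mu, forall w, A w <-> B w} -> mu A = mu B.
Proof.
move=> mA mB AB; rewrite -(setIT A) -(setIT B) -(@integral_indic _ _ _ mu setT)// -(@integral_indic _ _ _ mu setT)//.
apply: ge0_ae_eq_integral => //.
- by apply/measurable_EFinP; exact: measurable_indic.
- by apply/measurable_EFinP; exact: measurable_indic.
- apply: filterS AB => w AB _ /=; rewrite !indicE; congr (_%:R%:E).
  by congr nat_of_bool; apply/idP/idP; rewrite !inE => /AB.
Qed.

(** * From the jump chain to the process *)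

Section occupation_law.
Context d (Omega : measurableType d) (R : realType) (P : probability Omega R).
Variables (Q : nat -> nat -> R) (n : nat) (X : R -> Omega -> nat).
Hypothesis rate_gt0 : forall i, 0 < - Q i i.
Local Notation p := (jump_prob Q).
Hypothesis p_ge0 : forall i j, 0 <= p i j.
Hypothesis p_sum : forall i, \sum_(j < i.+2) p i j = 1.
Hypothesis p_up : forall i, 0 < p i i.+1.
Hypothesis p_skipfree : forall i j, (i.+1 < j)%N -> p i j = 0.

Lemma law_functional01 B c0 : (forall i, measurable (B i)) ->
  in01 (law_functional n rate_gt0 B c0).
Proof.
move=> mB t c; rewrite /law_functional.
have f01 i : 0 <= fine (glaw rate_gt0 i (c i + c0 i) (B i)) <= 1.
  rewrite fine_ge0//= -[leRHS]/(fine (1%:E)); apply: fine_le => //.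
    by apply: fin_num_measure; exact: mB.
  by apply: probability_le1; exact: mB.
rewrite prodr_ge0/=; last by move=> i _; have /andP[] := f01 i.
by apply: prodr_ile1 => i _; exact: f01.
Qed.

Section jump_chain.
Variables (Y : nat -> {RV P >-> nat}) (S : nat -> {RV P >-> R}).
Hypothesis law : jump_hold_law Q 0 Y S.

Let EB B := [set w | (forall k, (k <= 0)%N -> Y k w = 0%N) /\
  exists m, first_hit n (Y ^~ w) m /\
   forall i, (i < n)%N -> B i (visit_time S (Y ^~ w) m i w)].

Let EK B K := [set w | (forall k, (k <= 0)%N -> Y k w = 0%N) /\
  exists m, [/\ (0 <= m < 0 + K)%N, first_hit n (Y ^~ w) m &
   forall i, (i < n)%N -> B i (visit_time S (Y ^~ w) m i w)]].

Let EBE B : EB B = \bigcup_K EK B K.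
Proof.
apply/seteqP; split => w /=.
  by move=> [Y0 [m [? ?]]]; exists m.+1 => //; split => //; exists m; split => //=; rewrite add0n.
by move=> [K _ [Y0 [m [_ ? ?]]]]; split => //; exists m.
Qed.

Let measurable_EK B K : (forall i, measurable (B i)) -> measurable (EK B K).
Proof. exact: (@measurable_hitev _ _ _ _ n Y S (fun=> 0%N) 0%N K). Qed.

Let measurable_EB B : (forall i, measurable (B i)) -> measurable (EB B).
Proof. by move=> mB; rewrite EBE; apply: bigcup_measurable => K _; exact: measurable_EK. Qed.

Lemma first_hit_law B : (forall i, measurable (B i)) ->
  P (EB B) = (hit p (pred1 n) 0 (law_functional n rate_gt0 B (fun=> 0%N)))%:E.
Proof.
move=> mB; rewrite EBE.
have EKE K : P (EK B K) = (hit_sum p (pred1 n) K 0 (law_functional n rate_gt0 B (fun=> 0%N)))%:E.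
  rewrite (hitev_law rate_gt0 law p_ge0 p_skipfree mB)//.
  rewrite /path_weight big_ord0 eqxx !mul1r; congr (hit_sum _ _ _ _ _)%:E.
  apply/funext => t; apply/funext => c; rewrite /law_functional.
  by apply: eq_bigr => i _; rewrite /visit_count big_ord0.
have /cvg_lim <- // : P (EK B K) @[K --> \oo] --> P (\bigcup_K EK B K).
  apply: nondecreasing_cvg_mu.
  - by move=> K; exact: measurable_EK.
  - by apply: bigcup_measurable => K _; exact: measurable_EK.
  - apply/nondecreasing_seqP => K; apply/subsetPset => w [Y0 [m [mK ? ?]]].
    by split => //; exists m; split => //; move: mK; rewrite !add0n/= => /ltnW.
apply/cvg_lim => //; under eq_cvg do rewrite EKE.
by apply/fine_cvgP; split; [exact: nearW|apply: (cvg_hit p_ge0 p_sum); exact: law_functional01].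
Qed.

(** Trivial constraints reduce the probability to [hit] of the constant 1, which [hit1]
    evaluates. *)
Lemma ae_first_hit : {ae P, forall w, exists m, first_hit n (Y ^~ w) m}.
Proof.
have PE : P (EB (fun=> setT)) = 1%E.
  rewrite first_hit_law// (_ : law_functional _ _ _ _ = fun _ _ => 1).
    by rewrite (@hit1 _ p (pred1 n) n)//= eqxx.
  apply/funext => t; apply/funext => c; rewrite /law_functional big1// => i _.
  by rewrite probability_setT.
exists (~` EB (fun=> setT)); split.
- by apply: measurableC; exact: measurable_EB.
- by rewrite probability_setC ?PE ?subee//; exact: measurable_EB.
- by move=> w /= nh [_ [m [? _]]]; apply: nh; exists m.
Qed.

Lemma exponential_prob_le0 (a : R) : 0 < a -> exponential_prob a `]-oo, 0] = 0%E.
Proof.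
move=> a0; rewrite /exponential_prob.
rewrite (_ : `]-oo, 0]%classic = `]-oo, 0[%classic `|` [set 0]); last first.
  by rewrite setUitv1.
rewrite integral_setU_EFin//=.
- rewrite integral_set1 adde0; apply: integral0_eq => x.
  by rewrite /= in_itv/= => x0; rewrite lt0_exponential_pdf.
- by apply: measurable_funTS; exact: measurable_exponential_pdf.
- by apply/disj_setPS => x /= []; rewrite in_itv/= => + x0; rewrite x0 ltxx.
Qed.

(** The law of [S k] is only given together with a prescribed path; the null events are summed over
    the countably many finite paths, enumerated by [unpickle]. *)
Lemma ae_holding_gt0 : {ae P, forall w, forall k, 0 < S k w}.
Proof.
have mS k : measurable (S k @^-1` `]-oo, 0]).
  by rewrite -[X in measurable X]setTI; exact: measurable_funPT.
pose N k (l : nat) := if (unpickle l : option (seq nat)) is Some y then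
   [set w | forall j, (j <= k.+1)%N -> Y j w = nth 0%N y j] `&` S k @^-1` `]-oo, 0]
   else set0.
have mN k l : measurable (N k l).
  by rewrite /N; case: unpickle => // y; apply: measurableI => //; exact: (measurable_path Y).
have N0 k l : P (N k l) = 0%E.
  rewrite /N; case: unpickle => [y|]; last by rewrite measure0.
  pose C j : set R := if j == k then `]-oo, 0]%classic else setT.
  have mC j : measurable (C j) by rewrite /C; case: ifP.
  have Ck : C k = `]-oo, 0]%classic by rewrite /C eqxx.
  have := law k.+1 (nth 0%N y) mC; rewrite [X in (_ * X)%E](bigD1 ord_max)//= Ck.
  rewrite exponential_prob_le0// mul0e mule0 => <-; congr (P _).
  apply/seteqP; split => w /= [Yw Sw]; split => //.
    by move=> j jk; rewrite /C; case: eqP => // ->.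
  by have := Sw k (ltnSn k); rewrite Ck.
have negl : P.-negligible (\bigcup_k \bigcup_l N k l).
  apply: negligible_bigcup => k; apply: negligible_bigcup => l.
  by apply/negligibleP; [exact: mN|exact: N0].
move: negl; apply: negligibleS => w /= /existsNP[k /negP]; rewrite -leNgt => Sk.
exists k => //; exists (pickle (mkseq (Y ^~ w) k.+2)) => //.
rewrite /N pickleK; split; last by rewrite /= in_itv.
by move=> j jk /=; rewrite nth_mkseq.
Qed.

End jump_chain.

Hypothesis X_markov : markov_jump_process P Q 0 X.

Definition real_occupation i w : R := fine (occupation_time X n i w).

Lemma measurable_real_occupation i : measurable_fun setT (real_occupation i).
Proof.
apply: (measurableT_comp (fine_measurable _)) => //.
by have [mX rX _] := X_markov; exact: measurable_occupation_time.
Qed.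

Lemma ae_real_occupation :
  {ae P, forall w, forall i, occupation_time X n i w = (real_occupation i w)%:E}.
Proof.
have [mX rX [Y [S [law aeX]]]] := X_markov.
have h1 := ae_first_hit law; have h2 := ae_holding_gt0 law.
apply: filterS3 h1 h2 aeX => w [m [ym yk]] s0 XE i.
by rewrite /real_occupation (occupation_time_path i s0 _ ym yk).
Qed.

Lemma occupation_law B : (forall i, measurable (B i)) ->
  P [set w | forall i, (i < n)%N -> B i (real_occupation i w)] =
  (hit p (pred1 n) 0 (law_functional n rate_gt0 B (fun=> 0%N)))%:E.
Proof.
move=> mB; have [mX rX [Y [S [law aeX]]]] := X_markov.
rewrite -(first_hit_law law mB); apply: eq_measure_ae.
- rewrite (_ : [set w | _] = \bigcap_(i in [set i | (i < n)%N]) (real_occupation i @^-1` B i)); last first.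
    by apply/seteqP; split.
  apply: bigcap_measurableType => i _; rewrite -[X in measurable X]setTI.
  exact: measurable_real_occupation.
- rewrite (_ : [set w | _] = [set w | forall k, (k <= 0)%N -> Y k w = 0%N] `&`
    \bigcup_m [set w | first_hit n (Y ^~ w) m /\
      forall i, (i < n)%N -> B i (visit_time S (Y ^~ w) m i w)]); last first.
    apply/seteqP; split => w /=.
      by move=> [Y0 [m ?]]; split => //; exists m.
    by move=> [Y0 [m _ ?]]; split => //; exists m.
  apply: measurableI; first exact: (measurable_path Y (fun=> 0%N)).
  by apply: bigcup_measurable => m _; exact: measurable_first_hit_time.
have Y0 : {ae P, forall w, Y 0%N w = 0%N}.
  have mY0 := measurable_Y_eq Y 0 0.
  exists (~` [set w | Y 0%N w = 0%N]); split => //; first exact: measurableC.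
  have PY0 : P [set w | Y 0%N w = 0%N] = 1%E.
    have := path_prob rate_gt0 law (fun=> 0%N) 0.
    rewrite /path_weight big_ord0 eqxx mulr1 => <-; congr (P _).
    by apply/seteqP; split => w /= Y0 => [k|]; [rewrite leqn0 => /eqP ->|exact: Y0].
  by rewrite probability_setC ?PY0 ?subee.
have h1 := ae_first_hit law; have h2 := ae_holding_gt0 law.
near=> w.
have [m [ym yk]] : exists m, first_hit n (Y ^~ w) m by near: w.
have s0 : forall k, 0 < S k w by near: w.
have XE : forall k t, jump_time S k w <= t < jump_time S k.+1 w -> X t w = Y k w by near: w.
have Y0w : Y 0%N w = 0%N by near: w.
have ellE i : real_occupation i w = visit_time S (Y ^~ w) m i w.
  by rewrite /real_occupation (occupation_time_path i s0 XE ym yk).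
split => [Bw|[_ [m' [fh' Bw]]] i iltn].
  split; first by move=> k; rewrite leqn0 => /eqP ->.
  by exists m; split => // i iltn; rewrite -ellE; exact: Bw.
have mm' : m = m'.
  case: fh' => ym' yk'; have [lt|lt|//] := ltngtP m m'.
    by case: (yk' m lt ym).
  by case: (yk m' lt ym').
by rewrite ellE mm'; exact: Bw.
Unshelve. all: by end_near.
Qed.

End occupation_law.

(** * Weighted exponential series *)

Section weighted_exp.
Context {R : realType}.
Implicit Types (w u v : nat -> R) (x : R).

(** Exponential generating function of the weights. With [w m] the weight of the paths with [m.+1]
    visits to [a] and [x = r s], the density of the time in [a] at [s] is [r e^{-x}] times this
    series. *)
Definition wexp w x : R := limn (series (fun m => w m * exp_coeff x m)).

Lemma exp_coeff_pow x m : exp_coeff x m = x ^+ m / m`!%:R.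
Proof. by []. Qed.

Definition weights w := forall m, 0 <= w m <= 1.

Lemma weight_exp_ge0 w x m : weights w -> 0 <= x -> 0 <= w m * exp_coeff x m.
Proof. by move=> w01 x0; have /andP[? _] := w01 m; rewrite mulr_ge0// exp_coeff_ge0. Qed.

Lemma weight_exp_le w x m : weights w -> 0 <= x -> w m * exp_coeff x m <= exp_coeff x m.
Proof.
move=> w01 x0; have /andP[_ w1] := w01 m.
by rewrite -[leRHS]mul1r ler_wpM2r// exp_coeff_ge0.
Qed.

Lemma is_cvg_wexp w x : weights w -> 0 <= x ->
  cvgn (series (fun m => w m * exp_coeff x m)).
Proof.
move=> w01 x0; apply: (@series_le_cvg _ _ (exp_coeff x)).
- by move=> m; exact: weight_exp_ge0.
- by move=> m; exact: exp_coeff_ge0.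
- by move=> m; exact: weight_exp_le.
- exact: is_cvg_series_exp_coeff.
Qed.

Lemma wexpE w x : weights w -> 0 <= x ->
  (\sum_(m <oo) (w m * exp_coeff x m)%:E)%E = (wexp w x)%:E.
Proof.
move=> w01 x0; rewrite /wexp -EFin_lim; last exact: is_cvg_wexp.
by congr (limn _); apply/funext => m /=; rewrite sumEFin.
Qed.

Lemma wexp_ge0 w x : weights w -> 0 <= x -> 0 <= wexp w x.
Proof.
move=> w01 x0; rewrite -lee_fin -wexpE//; apply: nneseries_ge0 => m _ _.
by rewrite lee_fin weight_exp_ge0.
Qed.

Lemma wexp_le_expR w x : weights w -> 0 <= x -> wexp w x <= expR x.
Proof.
move=> w01 x0; apply: lim_series_le => [| |m]; first exact: is_cvg_wexp.
  exact: is_cvg_series_exp_coeff.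
exact: weight_exp_le.
Qed.

Lemma wexp_le_lin w u v (e1 e2 : R) x : weights w -> weights u -> weights v ->
  (forall m, w m <= e1 * u m + e2 * v m) -> 0 <= x ->
  wexp w x <= e1 * wexp u x + e2 * wexp v x.
Proof.
move=> w01 u01 v01 wuv x0.
have cZ e z : weights z ->
    series (fun m => e * (z m * exp_coeff x m)) @ \oo --> e * wexp z x.
  move=> z01; have cz := is_cvg_wexp z01 x0.
  rewrite (_ : series _ = (fun k => e * series (fun m => z m * exp_coeff x m) k)).
    by apply: cvgM; [exact: cvg_cst|exact: cz].
  by apply/funext => k; rewrite /series/= mulr_sumr.
have cuev : series (fun m => e1 * (u m * exp_coeff x m) + e2 * (v m * exp_coeff x m)) @ \oo
    --> e1 * wexp u x + e2 * wexp v x.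
  rewrite (_ : series _ = (fun k => series (fun m => e1 * (u m * exp_coeff x m)) k +
     series (fun m => e2 * (v m * exp_coeff x m)) k)).
    by apply: cvgD; exact: cZ.
  by apply/funext => k; rewrite /series/= big_split.
rewrite -(cvg_lim (@Rhausdorff R) cuev); apply: lim_series_le.
- exact: is_cvg_wexp.
- exact: cvgP cuev.
- move=> m; have := ler_wpM2r (exp_coeff_ge0 m x0) (wuv m).
  by rewrite mulrDl -!mulrA.
Qed.

Lemma wexp_ge_lin w x : weights w -> 0 <= x -> w 0%N + w 1%N * x <= wexp w x.
Proof.
move=> w01 x0.
have := @nneseries_lim_ge R (fun m => (w m * exp_coeff x m)%:E) xpredT 0 2.
rewrite wexpE// sumEFin lee_fin big_mkord big_ord_recr big_ord1/=.
rewrite !exp_coeff_pow expr0 expr1 fact0 !divr1 mulr1; apply=> m _ _.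
by rewrite lee_fin weight_exp_ge0.
Qed.

(** After two terms the tail is at most [x^2 e^x], because [(m+2)!] dominates [m!]. *)
Lemma wexp_le_quad w x : weights w -> 0 <= x ->
  wexp w x <= w 0%N + w 1%N * x + x ^+ 2 * expR x.
Proof.
move=> w01 x0; rewrite -lee_fin -wexpE// (nneseries_split 0 2)//; last first.
  by move=> m _; rewrite lee_fin weight_exp_ge0.
rewrite sumEFin big_mkord big_ord_recr big_ord1/=.
rewrite !exp_coeff_pow expr0 expr1 fact0 !divr1 mulr1 [leRHS]EFinD.
apply: leeD => //; rewrite add0n.
have : (\sum_(2 <= m <oo) (w m * exp_coeff x m)%:E <=
   (x ^+ 2)%:E * \sum_(m <oo) (1 * exp_coeff x m)%:E)%E.
  rewrite -nneseriesZl; last by move=> m _; rewrite lee_fin mul1r exp_coeff_ge0.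
  rewrite -(@nneseries_addn _ (fun m => (w m * exp_coeff x m)%:E) 2); last first.
    by move=> m; rewrite lee_fin weight_exp_ge0.
  apply: lee_nneseries => m _; first by rewrite lee_fin weight_exp_ge0.
  rewrite -EFinM lee_fin mul1r.
  apply: (le_trans (weight_exp_le _ w01 x0)).
  rewrite addn2 !exp_coeff_pow !exprS expr0 mulr1 -!mulrA.
  do 2 apply: ler_wpM2l => //; apply: ler_wpM2l; first exact: exprn_ge0.
  rewrite lef_pV2 ?posrE ?ltr0n ?fact_gt0// ler_nat.
  by rewrite !factS; apply: (leq_trans (leq_pmull _ (ltn0Sn m))); exact: leq_pmull.
rewrite wexpE//; last by move=> m; rewrite ler01 lexx.
rewrite -EFinM => /le_trans; apply; rewrite lee_fin.
apply: ler_wpM2l; first exact: exprn_ge0.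
by apply: wexp_le_expR => // m; rewrite ler01 lexx.
Qed.

(** Interchange of summations over the triangle [D <= m]; nonnegativity replaces absolute
    convergence. *)
Lemma cauchy_nneseries (u v : nat -> R) (U V : R) :
  (forall m, 0 <= u m) -> (forall m, 0 <= v m) ->
  (\sum_(m <oo) (u m)%:E)%E = U%:E -> (\sum_(m <oo) (v m)%:E)%E = V%:E ->
  (\sum_(m <oo) (\sum_(D < m.+1) u (m - D)%N * v D)%:E)%E = (U * V)%:E.
Proof.
move=> u0 v0 uU vV.
have -> : (\sum_(m <oo) (\sum_(D < m.+1) u (m - D)%N * v D)%:E =
    \sum_(m <oo) \sum_(D <oo) (if (D <= m)%N then (u (m - D)%N * v D)%:E else 0))%E.
  apply: eq_eseriesr => m _.
  rewrite (nneseries_split 0 m.+1)//; last by move=> k _; case: ifP; rewrite ?lee_fin ?mulr_ge0.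
  rewrite eseries0 ?adde0; last by move=> k mk _; rewrite leqNgt mk.
  rewrite add0n big_mkord -sumEFin; apply: eq_bigr => D _.
  by rewrite -ltnS ltn_ord.
rewrite nneseries_interchange; last by move=> i j; case: ifP; rewrite ?lee_fin ?mulr_ge0.
rewrite EFinM -vV -nneseriesZl; last by move=> D _; rewrite lee_fin.
apply: eq_eseriesr => D _.
rewrite (nneseries_split 0 D)//; last by move=> k _; case: ifP; rewrite ?lee_fin ?mulr_ge0.
rewrite big_mkord big1 ?add0e ?add0n; last by move=> k _; rewrite leqNgt ltn_ord.
rewrite muleC -uU -nneseriesZl; last by move=> m _; rewrite lee_fin.
rewrite -nneseries_addn; last by move=> k; case: ifP; rewrite ?lee_fin ?mulr_ge0.
by apply: eq_eseriesr => k _; rewrite leq_addl addnK mulrC.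
Qed.

(** A binomial convolution of coefficients is a product of exponential generating functions. *)
Lemma wexpM w u v x : weights w -> weights u -> weights v ->
  (forall m, w m = \sum_(D < m.+1) 'C(m, D)%:R * (u (m - D)%N * v D)) ->
  0 <= x -> wexp w x = wexp u x * wexp v x.
Proof.
move=> w01 u01 v01 wE x0; apply/eqP; rewrite -eqe -wexpE//.
rewrite -(@cauchy_nneseries (fun m => u m * exp_coeff x m) (fun m => v m * exp_coeff x m))//.
- apply/eqP; apply: eq_eseriesr => m _; congr (_%:E).
  rewrite wE mulr_suml; apply: eq_bigr => D _.
  have Dm : (D <= m)%N by rewrite -ltnS ltn_ord.
  have := bin_fact Dm => /(congr1 (fun k => k%:R : R)); rewrite !natrM => fE.
  have fD : (D`!%:R : R) != 0 by rewrite pnatr_eq0 -lt0n fact_gt0.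
  have fmD : ((m - D)`!%:R : R) != 0 by rewrite pnatr_eq0 -lt0n fact_gt0.
  have xE : x ^+ m = x ^+ (m - D) * x ^+ D by rewrite -exprD subnK.
  rewrite !exp_coeff_pow -fE xE.
  have bD : ('C(m, D)%:R : R) != 0 by rewrite pnatr_eq0 -lt0n bin_gt0.
  by field; rewrite fD fmD bD.
- by move=> m; exact: weight_exp_ge0.
- by move=> m; exact: weight_exp_ge0.
- exact: wexpE.
- exact: wexpE.
Qed.

End weighted_exp.

(** * Joint density of the occupation times *)

Section hit_continuity.
Variables (R : realType) (p : nat -> nat -> R) (st : pred nat).
Hypothesis p_ge0 : forall i j, 0 <= p i j.
Hypothesis p_sum : forall i, \sum_(j < i.+2) p i j = 1.

Lemma cvg_hit_sum (G : nat -> nat -> (nat -> nat) -> R) F K i :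
  (forall t c, G N t c @[N --> \oo] --> F t c) ->
  hit_sum p st K i (G N) @[N --> \oo] --> hit_sum p st K i F.
Proof.
elim: K i G F => [|K IH] i G F GF /=; first exact: cvg_cst.
case: ifP => _; first exact: GF.
apply: cvg_sum_ord => j; apply: cvgM; first exact: cvg_cst.
by apply: (IH _ (fun N t c => G N t (incr i c))) => t c; exact: GF.
Qed.

(** Monotone convergence: two increasing limits, in [N] and in the truncation [K], are exchanged. *)
Lemma cvg_hit_nondecreasing (G : nat -> nat -> (nat -> nat) -> R) F i :
  (forall N, in01 (G N)) -> in01 F ->
  (forall t c, nondecreasing_seq (fun N => G N t c)) ->
  (forall t c, G N t c @[N --> \oo] --> F t c) ->
  hit p st i (G N) @[N --> \oo] --> hit p st i F.
Proof.
move=> G01 F01 ndG GF.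
have GleF N t c : G N t c <= F t c.
  by rewrite -(cvg_lim (@Rhausdorff R) (GF t c)); apply: nondecreasing_cvgn_le => //; exact: cvgP (GF t c).
have nd : nondecreasing_seq (fun N => hit p st i (G N)).
  by move=> N M NM; apply: (ler_hit _ p_ge0 p_sum) => // t c; exact: ndG.
have cv : cvgn (fun N => hit p st i (G N)).
  apply: nondecreasing_is_cvgn => //; exists 1 => _ [N _ <-].
  exact: (hit_le1 _ p_ge0 p_sum).
rewrite (_ : hit p st i F = limn (fun N => hit p st i (G N))); first exact: cv.
apply/eqP; rewrite eq_le; apply/andP; split.
  apply: (hit_le p_ge0 p_sum F01) => K.
  have cK := cvg_hit_sum (K := K) (i := i) GF.
  rewrite -(cvg_lim (@Rhausdorff R) cK); apply: ler_lim => //; first exact: cvgP cK.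
  by apply: nearW => N; exact: (hit_sum_le_hit _ p_ge0 p_sum).
apply: limr_le => //; apply: nearW => N; exact: (ler_hit _ p_ge0 p_sum).
Qed.

Lemma hit_sum_fun (G : nat -> nat -> (nat -> nat) -> R) i N :
  in01 (fun t c => \sum_(j < N) G j t c) -> (forall j t c, 0 <= G j t c) ->
  hit p st i (fun t c => \sum_(j < N) G j t c) = \sum_(j < N) hit p st i (G j).
Proof.
elim: N => [|N IH] G01 G0.
  rewrite big_ord0 -[RHS](hit0 p st i); congr (hit _ _ _ _).
  by apply/funext => t; apply/funext => c; rewrite big_ord0.
have SN01 : in01 (fun t c => \sum_(j < N) G j t c).
  move=> t c; rewrite sumr_ge0//=; have /andP[_] := G01 t c.
  by apply: le_trans; rewrite big_ord_recr/= lerDl.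
have GN01 : in01 (G N).
  move=> t c; rewrite G0/=; have /andP[_] := G01 t c.
  by apply: le_trans; rewrite big_ord_recr/= lerDr sumr_ge0.
rewrite big_ord_recr/= -IH// -(hitD _ p_ge0 p_sum)//; congr (hit _ _ _ _).
by apply/funext => t; apply/funext => c; rewrite big_ord_recr.
Qed.

Lemma cvg_hit_series (G : nat -> nat -> (nat -> nat) -> R) F i :
  (forall j t c, 0 <= G j t c) -> in01 F ->
  (forall t c, (\sum_(j < N) G j t c) @[N --> \oo] --> F t c) ->
  (\sum_(j < N) hit p st i (G j)) @[N --> \oo] --> hit p st i F.
Proof.
move=> G0 F01 GF.
have nd t c : nondecreasing_seq (fun N => \sum_(j < N) G j t c).
  by apply/nondecreasing_seqP => N; rewrite big_ord_recr/= lerDl.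
have S01 N : in01 (fun t c => \sum_(j < N) G j t c).
  move=> t c; rewrite sumr_ge0//=; have /andP[_] := F01 t c; apply: le_trans.
  rewrite -(cvg_lim (@Rhausdorff R) (GF t c)).
  by apply: nondecreasing_cvgn_le => //; exact: cvgP (GF t c).
under eq_cvg do rewrite -hit_sum_fun//.
apply: (@cvg_hit_nondecreasing (fun N t c => \sum_(j < N) G j t c) F i) => //.
Qed.

End hit_continuity.

Section occupation_density.
Context d (Omega : measurableType d) (R : realType) (P : probability Omega R).
Variables (Q : nat -> nat -> R) (n : nat) (X : R -> Omega -> nat).
Hypothesis rate_gt0 : forall i, 0 < - Q i i.
Local Notation p := (jump_prob Q).
Local Notation mu := (@lebesgue_measure R).
Hypothesis p_ge0 : forall i j, 0 <= p i j.
Hypothesis p_sum : forall i, \sum_(j < i.+2) p i j = 1.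
Hypothesis p_up : forall i, 0 < p i i.+1.
Hypothesis p_skipfree : forall i j, (i.+1 < j)%N -> p i j = 0.
Hypothesis X_markov : markov_jump_process P Q 0 X.
Local Notation ell := (real_occupation n X).
Variable a : nat.
Hypothesis b_lt : (a.+1 < n)%N.
Local Notation rate := (- Q a a).

Definition below_law (A : nat -> set R) (c : nat -> nat) : R :=
  \prod_(i < a) fine (glaw rate_gt0 i (c i) (A i)).

Definition next_law (C : set R) (c : nat -> nat) : R :=
  fine (glaw rate_gt0 a.+1 (c a.+1) C).

Lemma fine_glaw01 i c (C : set R) : measurable C -> 0 <= fine (glaw rate_gt0 i c C) <= 1.
Proof.
move=> mC; rewrite fine_ge0//= -[leRHS]/(fine (1%:E)); apply: fine_le => //.
  by apply: fin_num_measure; exact: mC.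
by apply: probability_le1; exact: mC.
Qed.

Lemma unitfun_below_law A : (forall i, measurable (A i)) -> unitfun (below_law A).
Proof.
move=> mA c; rewrite /below_law prodr_ge0/=; last first.
  by move=> i _; have /andP[] := fine_glaw01 i (c i) (mA i).
by apply: prodr_ile1 => i _; exact: fine_glaw01.
Qed.

Lemma unitfun_next_law C : measurable C -> unitfun (next_law C).
Proof. by move=> mC c; exact: fine_glaw01. Qed.

Lemma local_below_below_law A : local_below a (below_law A).
Proof. by move=> c c' cc; apply: eq_bigr => i _; rewrite cc. Qed.

Lemma local_above_next_law C : local_above n a (next_law C).
Proof. by move=> c c' cc; rewrite /next_law cc// ltnSn. Qed.

(** Index [m] stands for [m.+1] visits, in step with [gamma_pdf]; at least one visit is certain on
    the way to [n]. *)
Definition visit_weight g k (m : nat) : R := hit p (pred1 n) 0 (prod3 a g m.+1 k).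

Lemma weights_visit g k : unitfun g -> unitfun k -> weights (visit_weight g k).
Proof.
move=> g01 k01 m; have G01 := in01_prod3 a m.+1 g01 k01.
by rewrite /visit_weight (hit_ge0 _ p_ge0 p_sum)//= (hit_le1 _ p_ge0 p_sum).
Qed.

Definition visit_density (w : nat -> R) (s : R) : R :=
  if 0 <= s then rate * expR (- rate * s) * wexp w (rate * s) else 0.

Lemma visit_density_ge0 w s : weights w -> 0 <= visit_density w s.
Proof.
move=> w01; rewrite /visit_density; case: ifP => // s0.
by rewrite !mulr_ge0 ?expR_ge0 ?wexp_ge0 ?mulr_ge0// ltW.
Qed.

Lemma visit_densityE w s : weights w ->
  (\sum_(m <oo) (w m * gamma_pdf rate m s)%:E)%E = (visit_density w s)%:E.
Proof.
move=> w01; rewrite /visit_density /gamma_pdf; case: ifP => s0; last first.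
  by rewrite eseries0// => m _ _; rewrite mulr0.
have rs0 : 0 <= rate * s by rewrite mulr_ge0// ltW.
rewrite EFinM -wexpE// -nneseriesZl; last by move=> m _; rewrite lee_fin weight_exp_ge0.
apply: eq_eseriesr => m _; rewrite -EFinM; congr (_%:E).
by rewrite exp_coeff_pow exprMn exprS; ring.
Qed.

Lemma measurable_visit_density w : weights w -> measurable_fun [set: R] (visit_density w).
Proof.
move=> w01; apply/measurable_EFinP.
rewrite (_ : EFin \o _ = fun s => (\sum_(m <oo | m \in xpredT) (w m * gamma_pdf rate m s)%:E)%E).
  apply: ge0_emeasurable_sum => m.
    move=> s _ _; have /andP[? _] := w01 m.
    by rewrite lee_fin mulr_ge0// gamma_pdf_ge0.
  move=> _; apply/measurable_EFinP; apply: measurable_funM => //.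
  exact: measurable_gamma_pdf.
by apply/funext => s /=; rewrite -visit_densityE.
Qed.

(** Conditioning on the number [j] of visits to [a] isolates the factor [phi j], a gamma probability
    of [E]; the series of gamma densities is then the weighted exponential series. *)
Lemma occupation_density A E C : (forall i, measurable (A i)) -> measurable E ->
  measurable C ->
  P [set w | [/\ forall i, (i < a)%N -> A i (ell i w), E (ell a w) & C (ell a.+1 w)]] =
  (\int[mu]_(s in E) (visit_density (visit_weight (below_law A) (next_law C)) s)%:E)%E.
Proof.
move=> mA mE mC.
pose B i := if (i < a)%N then A i else if i == a then E else if i == a.+1 then C else setT.
have mB i : measurable (B i).
  by rewrite /B; case: ifP => // _; case: ifP => // _; case: ifP.
have g01 := unitfun_below_law mA; have k01 := unitfun_next_law mC.
set w := visit_weight _ _; have w01 : weights w by exact: weights_visit.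
transitivity (P [set w | forall i, (i < n)%N -> B i (ell i w)]).
  congr (P _); apply/seteqP; split => o /=.
    move=> [Ao Eo Co] i iltn; rewrite /B; case: ifP => ia; first exact: Ao.
    by case: eqP => [->//|_]; case: eqP => [->|].
  move=> Bo; split.
  - by move=> i ia; have := Bo i (ltn_trans ia (ltnW b_lt)); rewrite /B ia.
  - by have := Bo a (ltnW b_lt); rewrite /B ltnn eqxx.
  - by have := Bo a.+1 b_lt; rewrite /B ltnNge leqnSn/= gtn_eqF// eqxx.
rewrite (occupation_law _ rate_gt0 p_ge0 p_sum p_up p_skipfree X_markov mB).
pose phi m := fine (glaw rate_gt0 a m E).
have phi01 m : 0 <= phi m <= 1 by exact: fine_glaw01.
have FE : law_functional n rate_gt0 B (fun=> 0%N) =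
    fun _ c => below_law A c * phi (c a) * next_law C c.
  apply/funext => t; apply/funext => c; rewrite /law_functional.
  under eq_bigr do rewrite addn0.
  rewrite -(big_mkord xpredT (fun i => fine (glaw rate_gt0 i (c i) (B i)))).
  rewrite (big_cat_nat _ (n := a))//=; last exact: ltnW (ltnW b_lt).
  rewrite [X in _ * X]big_ltn; last exact: ltnW.
  rewrite [X in _ * (_ * X)]big_ltn// big_mkord -mulrA; congr (_ * (_ * _)).
  - by apply: eq_bigr => i _; rewrite /B ltn_ord.
  - by rewrite /B ltnn eqxx.
  - rewrite big_nat_cond big1 ?mulr1; last first.
      move=> i /andP[/andP[bi _] _]; rewrite /B ltnNge (ltnW (ltnW bi))/=.
      by rewrite !gtn_eqF ?probability_setT// ltnW.
    by rewrite /next_law /B ltnNge leqnSn/= gtn_eqF// eqxx.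
rewrite FE.
pose G j : nat -> (nat -> nat) -> R := fun t c => phi j * prod3 a (below_law A) j (next_law C) t c.
have P01 j : in01 (prod3 a (below_law A) j (next_law C)) by exact: in01_prod3.
have cvS : (\sum_(j < N) hit p (pred1 n) 0 (G j)) @[N --> \oo] -->
    hit p (pred1 n) 0 (fun _ c => below_law A c * phi (c a) * next_law C c).
  apply: (cvg_hit_series p_ge0 p_sum).
  - move=> j t c; have /andP[? _] := phi01 j; have /andP[? _] := P01 j t c.
    by rewrite mulr_ge0.
  - move=> t c; have /andP[? ?] := phi01 (c a); have /andP[? ?] := g01 c.
    have /andP[? ?] := k01 c; rewrite !mulr_ge0//=.
    by rewrite mulr_ile1 ?mulr_ge0// mulr_ile1.
  - move=> t c; apply: cvg_near_cst; exists (c a).+1 => // N /= caN.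
    rewrite (bigD1 (Ordinal caN))//= big1 ?addr0.
      by rewrite /G /prod3 eqxx mulr1; ring.
    move=> j; rewrite -val_eqE/= /G /prod3 eq_sym => /negbTE ->.
    by rewrite mulr0 mul0r mulr0.
have hG j : hit p (pred1 n) 0 (G j) = phi j * hit p (pred1 n) 0 (prod3 a (below_law A) j (next_law C)).
  by rewrite /G (hitZ _ p_ge0 p_sum).
have -> : (hit p (pred1 n) 0 (fun _ c => below_law A c * phi (c a) * next_law C c))%:E =
    (\sum_(j <oo) (phi j * hit p (pred1 n) 0 (prod3 a (below_law A) j (next_law C)))%:E)%E.
  apply/esym/cvg_lim => //.
  under eq_cvg => N do rewrite sumEFin big_mkord.
  apply/fine_cvgP; split; first exact: nearW.
  by under [X in X @ _ --> _]eq_fun => N /= do under eq_bigr do rewrite -hG.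
rewrite (nneseries_split 0 1)//; last first.
  move=> j _; have /andP[? _] := phi01 j.
  by rewrite lee_fin mulr_ge0// (hit_ge0 _ p_ge0 p_sum).
(* [j = 0] contributes nothing, and the remaining indices are shifted to match [gamma_pdf]. *)
rewrite big_nat1 add0n (hit_below_0 p_ge0 p_sum b_lt k01 g01)// mulr0 add0e.
rewrite -(@nneseries_addn _ (fun j => (phi j * hit p (pred1 n) 0
  (prod3 a (below_law A) j (next_law C)))%:E) 1); last first.
  move=> j; have /andP[? _] := phi01 j.
  by rewrite lee_fin mulr_ge0// (hit_ge0 _ p_ge0 p_sum).
have mpdf m : measurable_fun E (fun s => (gamma_pdf rate m s)%:E : \bar R).
  by apply/measurable_EFinP; apply: measurable_funTS; exact: measurable_gamma_pdf.
under [RHS]eq_integral do rewrite -visit_densityE//.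
rewrite integral_nneseries//; last 2 first.
- move=> m; apply/measurable_EFinP; apply: measurable_funM => //.
  by apply: measurable_funTS; exact: measurable_gamma_pdf.
- by move=> m s _; have /andP[? _] := w01 m; rewrite lee_fin mulr_ge0 ?gamma_pdf_ge0.
apply: eq_eseriesr => m _; rewrite addn1.
under eq_integral do rewrite EFinM.
have /andP[w0 _] := w01 m.
rewrite ge0_integralZl//; last by move=> s _; rewrite lee_fin gamma_pdf_ge0.
rewrite -(gamma_lawE (rate_gt0 a) m mE) mulrC EFinM fineK//.
  by apply: fin_num_measure; exact: mE.
exact: mpdf.
Qed.

End occupation_density.

(** * Occupation times confined to a short window *)

Section small_windows.
Context {R : realType}.
Variable Q : nat -> nat -> R.
Hypothesis rate_gt0 : forall i, 0 < - Q i i.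
Local Notation mu := (@lebesgue_measure R).

Definition window_prob (e : R) i c : R := fine (glaw rate_gt0 i c `[0, e]%classic).

Lemma window_prob_ge0 e i c : 0 <= window_prob e i c.
Proof. by rewrite /window_prob fine_ge0. Qed.

Lemma window_prob1_gt0 e i : 0 < e -> 0 < window_prob e i 1.
Proof.
move=> e0; rewrite /window_prob /glaw gamma_lawE; last exact: measurable_itv.
rewrite gamma_pdf0 -/(exponential_prob (- Q i i) `[0, e]%classic) exponential_prob_itv0c//.
by rewrite -EFinB/= subr_gt0 expR_lt1 mulNr oppr_lt0 mulr_gt0.
Qed.

(** Consecutive gamma densities at [x <= e] have ratio [r x / c.+1 <= r e], with [r] the rate of
    state [i]. *)
Lemma window_probS e i c : 0 <= e ->
  window_prob e i c.+2 <= - Q i i * e * window_prob e i c.+1.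
Proof.
move=> e0; rewrite -lee_fin EFinM /window_prob !fineK ?fin_num_measure//; try exact: measurable_itv.
rewrite /glaw !gamma_lawE; try exact: measurable_itv.
rewrite -ge0_integralZl//; last first.
- by rewrite lee_fin mulr_ge0// ltW.
- by move=> x _; rewrite lee_fin gamma_pdf_ge0.
- by apply/measurable_EFinP; apply: measurable_funTS; exact: measurable_gamma_pdf.
apply: ge0_le_integral => //.
- by move=> x _; rewrite lee_fin gamma_pdf_ge0.
- by apply/measurable_EFinP; apply: measurable_funTS; exact: measurable_gamma_pdf.
- apply: measurable_funeM; apply/measurable_EFinP.
  by apply: measurable_funTS; exact: measurable_gamma_pdf.
move=> x; rewrite /= in_itv/= => /andP[x0 xe]; rewrite -EFinM lee_fin.
have pdfS : gamma_pdf (- Q i i) c.+1 x = (- Q i i * x / c.+1%:R) * gamma_pdf (- Q i i) c x.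
  rewrite /gamma_pdf x0 factS natrM [_ ^+ c.+2]exprS [x ^+ _]exprS.
  have f0 : (c`!%:R : R) != 0 by rewrite pnatr_eq0 -lt0n fact_gt0.
  have c0 : (c.+1%:R : R) != 0 by rewrite pnatr_eq0.
  by field; rewrite f0 [_ + _]addrC natr1 c0.
rewrite pdfS ler_wpM2r ?gamma_pdf_ge0// -mulrA ler_wpM2l ?(ltW (rate_gt0 i))//.
by rewrite (le_trans _ xe)// ler_pdivrMr// ler_peMr// ler1n.
Qed.

Lemma window_prob_le1 e i c : 0 <= e -> - Q i i * e <= 1 ->
  window_prob e i c.+1 <= window_prob e i 1.
Proof.
move=> e0 re1; elim: c => // c IH; apply: le_trans (window_probS i c e0) _.
apply: le_trans IH; rewrite -[leRHS]mul1r ler_wpM2r//; exact: window_prob_ge0.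
Qed.

Lemma window_prob_le e i c : 0 <= e -> - Q i i * e <= 1 -> (0 < c)%N ->
  window_prob e i c <= window_prob e i 1 * ((c == 1%N)%:R + - Q i i * e).
Proof.
move=> e0 re1; have re0 : 0 <= - Q i i * e by rewrite mulr_ge0// ltW.
case: c => [|[|c]]// _; rewrite mulrDr.
  by rewrite mulr1 lerDl mulr_ge0// window_prob_ge0.
rewrite mulr0 add0r [leRHS]mulrC; apply: le_trans (window_probS i c e0) _.
by apply: ler_wpM2l => //; exact: window_prob_le1.
Qed.

(** Relative to states visited once, a state visited more often costs a factor [eta]: up to this
    error the window constraint is the indicator that every visit number is 1. *)
Lemma prod_window_prob_le e eta a (c : nat -> nat) : 0 <= e -> 0 <= eta <= 1 ->
  (forall i, (i < a)%N -> - Q i i * e <= eta) ->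
  (forall i, (i < a)%N -> (0 < c i)%N) ->
  \prod_(i < a) window_prob e i (c i) <=
  (\prod_(i < a) window_prob e i 1) * ([forall i : 'I_a, c i == 1%N]%:R + eta).
Proof.
move=> e0 /andP[eta0 eta1] reta c0.
have re1 i : (i < a)%N -> - Q i i * e <= 1 by move=> ia; exact: le_trans (reta i ia) eta1.
have P0 : 0 <= \prod_(i < a) window_prob e i 1.
  by apply: prodr_ge0 => i _; exact: window_prob_ge0.
have [/forallP c1|nc1] := boolP [forall i : 'I_a, c i == 1%N].
  rewrite mulrDr mulr1; have -> : \prod_(i < a) window_prob e i (c i) = \prod_(i < a) window_prob e i 1.
    by apply: eq_bigr => i _; rewrite (eqP (c1 i)).
  by rewrite lerDl mulr_ge0.
move: nc1; rewrite negb_forall => /existsP[i ci]; rewrite add0r.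
rewrite (bigD1 i)//= [X in X * eta](bigD1 i)//= mulrAC; apply: ler_pM.
- exact: window_prob_ge0.
- by apply: prodr_ge0 => j _; exact: window_prob_ge0.
- apply: (le_trans (window_prob_le e0 (re1 _ (ltn_ord i)) (c0 _ (ltn_ord i)))).
  by rewrite (negbTE ci) add0r ler_wpM2l ?window_prob_ge0// reta.
- apply: ler_prod => j _; rewrite window_prob_ge0/=.
  have := c0 _ (ltn_ord j); case: (c j) => // m _.
  by apply: window_prob_le1 => //; exact: re1.
Qed.

End small_windows.

(** * Density of the time in a state, given constraints on both sides *)

Section occupation_chain.
Context d (Omega : measurableType d) (R : realType) (P : probability Omega R).
Variables (Q : nat -> nat -> R) (n : nat) (X : R -> Omega -> nat).
Hypothesis rate_gt0 : forall i, 0 < - Q i i.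
Local Notation p := (jump_prob Q).
Local Notation mu := (@lebesgue_measure R).
Local Notation RR := (measurableTypeR R).
Hypothesis p_ge0 : forall i j, 0 <= p i j.
Hypothesis p_sum : forall i, \sum_(j < i.+2) p i j = 1.
Hypothesis p_up : forall i, 0 < p i i.+1.
Hypothesis p_skipfree : forall i j, (i.+1 < j)%N -> p i j = 0.
Hypothesis X_markov : markov_jump_process P Q 0 X.
Local Notation ell := (real_occupation n X).
Variable a : nat.
Hypothesis b_lt : (a.+1 < n)%N.
Local Notation rate := (- Q a a).

(** An explicit version of f(A, C), defined at every point; its expansion near 0 is what the
    converse uses. *)
Definition chain_density A C : R -> R :=
  visit_density Q a (visit_weight Q n a (below_law rate_gt0 a A) (next_law rate_gt0 a C)).

Definition past_event (A : nat -> set R) (E : set R) : set Omega :=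
  [set w | (forall i, (i < a)%N -> A i (ell i w)) /\ E (ell a w)].

Let measurable_ell i (B : set R) : measurable B -> measurable (ell i @^-1` B).
Proof.
move=> mB; rewrite -[X in measurable X]setTI.
apply: (measurable_real_occupation n X_markov i) => //.
Qed.

Lemma measurable_past_event A E : (forall i, measurable (A i)) -> measurable E ->
  measurable (past_event A E).
Proof.
move=> mA mE; rewrite (_ : past_event A E =
  (\bigcap_(i in [set i | (i < a)%N]) (ell i @^-1` A i)) `&` (ell a @^-1` E)); last first.
  by apply/seteqP; split.
by apply: measurableI; [apply: bigcap_measurableType => i _|]; exact: measurable_ell.
Qed.

Lemma weights_chain A C : (forall i, measurable (A i)) -> measurable C ->
  weights (visit_weight Q n a (below_law rate_gt0 a A) (next_law rate_gt0 a C)).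
Proof.
move=> mA mC; apply: (weights_visit n p_ge0 p_sum).
  exact: unitfun_below_law.
exact: unitfun_next_law.
Qed.

Lemma chain_density_ge0 A C s : (forall i, measurable (A i)) -> measurable C ->
  0 <= chain_density A C s.
Proof. by move=> mA mC; apply: (visit_density_ge0 rate_gt0); exact: weights_chain. Qed.

Lemma measurable_chain_density A C : (forall i, measurable (A i)) -> measurable C ->
  measurable_fun [set: R] (chain_density A C).
Proof. by move=> mA mC; apply: (measurable_visit_density rate_gt0); exact: weights_chain. Qed.

Lemma chain_densityP A E C : (forall i, measurable (A i)) -> measurable E ->
  measurable C ->
  P (past_event A E `&` ell a.+1 @^-1` C) =
  (\int[mu]_(s in E) (chain_density A C s)%:E)%E.
Proof.
move=> mA mE mC.
rewrite -(occupation_density rate_gt0 p_ge0 p_sum p_up p_skipfree X_markov b_lt mA mE mC).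
by congr (P _); apply/seteqP; split => w /=; [move=> [[? ?] ?]|move=> [? ? ?]]; split.
Qed.

(** The probability restricted to the constraints below [a], pushed forward by the time in [a], has
    density f(A, T). *)
Lemma ge0_integral_past_event A E (phi : R -> \bar R) : (forall i, measurable (A i)) ->
  measurable E -> (forall s, (0 <= phi s)%E) -> measurable_fun [set: R] phi ->
  (\int[P]_(w in past_event A E) phi (ell a w) =
   \int[mu]_(s in E) (phi s * (chain_density A setT s)%:E))%E.
Proof.
move=> mA mE phi0 mphi.
pose W := past_event A setT.
have mW : measurable W by exact: measurable_past_event.
have mell : measurable_fun setT (ell a : Omega -> RR).
  exact: (measurable_real_occupation n X_markov a).
have mphiell : measurable_fun setT (fun w => phi (ell a w)).
  exact: (measurableT_comp mphi (measurable_real_occupation n X_markov a)).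
have -> : past_event A E = (ell a @^-1` E) `&` W.
  by apply/seteqP; split => w; [move=> [? ?]|move=> [? [? _]]]; split.
rewrite integral_mkcondr.
transitivity (\int[mrestr P mW]_(w in ell a @^-1` E) phi (ell a w))%E.
  rewrite (@ge0_integral_density _ Omega R P (mrestr P mW) (fun w => (\1_W w)%:E))//.
  - by apply: eq_integral => w _; rewrite epatch_indic.
  - by apply/measurable_EFinP; exact: measurable_indic.
  - by move=> B mB; rewrite integral_indic// /mrestr setIC.
  - exact: measurable_ell.
  - exact: measurable_funTS.
rewrite -(@ge0_integral_pushforward _ _ Omega RR R (ell a) mell (mrestr P mW) E phi)//; last first.
  exact: measurable_funTS.
apply: (@ge0_integral_density _ RR R (lebesgue_measure : {measure set RR -> \bar R}) _
  (fun s => (chain_density A setT s)%:E)) => //.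
- by move=> s; rewrite lee_fin chain_density_ge0.
- by apply/measurable_EFinP; exact: measurable_chain_density.
- move=> B mB; rewrite -chain_densityP//; congr (P _).
  apply/seteqP; split => w /=; first by move=> [? [? _]]; split => //; split.
  by move=> [[? ?] _]; split => //; split.
- exact: measurable_funTS.
Qed.

End occupation_chain.

(** * Markov occupation times force a tridiagonal generator *)

Definition tuple_box d (T : measurableType d) k (D : nat -> set T) : set (k.-tuple T) :=
  [set t | forall i : 'I_k, D i (tnth t i)].

Lemma measurable_tuple_box d (T : measurableType d) k (D : nat -> set T) :
  (forall i, measurable (D i)) -> measurable (tuple_box (k := k) D).
Proof.
move=> mD; rewrite (_ : tuple_box D = \bigcap_(i in [set: 'I_k]) ((@tnth k T ^~ i) @^-1` D i)).
  apply: fin_bigcap_measurable => // i _; rewrite -[X in measurable X]setTI.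
  exact: measurable_tnth.
by apply/seteqP; split => t /= tD i => [_|]; exact: tD.
Qed.

Lemma measurable_past d d' (T : measurableType d) (E : measurableType d')
    (l : nat -> T -> E) k : (forall i, measurable_fun setT (l i)) ->
  measurable_fun setT (past l k).
Proof.
move=> ml; apply/measurable_fun_tnthP => i.
by rewrite (_ : _ \o _ = l (k.-1 - i)%N)//; apply/funext => w /=; rewrite tnth_mktuple.
Qed.

Lemma ae_exists_small (R : realType) (T : R -> Prop) (delta : R) : 0 < delta ->
  (\forall s \ae (lebesgue_measure : {measure set (measurableTypeR R) -> \bar R}), T s) ->
  exists2 s, 0 < s < delta & T s.
Proof.
move=> delta0 [M [mM M0 sub]]; apply: contrapT => noT.
have : (lebesgue_measure `]0%R, delta[%classic <= (0 : \bar R))%E.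
  have sM : `]0, delta[%classic `<=` M.
    by move=> s /=; rewrite in_itv/= => s0; apply: sub => /= Ts; apply: noT; exists s.
  rewrite -M0; apply: le_measure; rewrite ?inE//.
by rewrite lebesgue_measure_itv/= lte_fin delta0 sube0 lee_fin leNgt delta0.
Qed.

Lemma le0_archi (R : realType) (x M : R) : (forall N, x <= N.+1%:R^-1 * M) -> x <= 0.
Proof.
move=> xM; rewrite leNgt; apply/negP => x0.
have := xM (Num.truncn (M / x)); rewrite ler_pdivlMl ?ltr0n// leNgt.
by rewrite -ltr_pdivrMr// truncnS_gt.
Qed.

Section markov_implies_tridiagonal.
Context d (Omega : measurableType d) (R : realType) (P : probability Omega R).
Variables (Q : nat -> nat -> R) (n : nat) (X : R -> Omega -> nat).
Hypothesis rate_gt0 : forall i, 0 < - Q i i.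
Local Notation p := (jump_prob Q).
Local Notation mu := (@lebesgue_measure R).
Local Notation RR := (measurableTypeR R).
Hypothesis p_ge0 : forall i j, 0 <= p i j.
Hypothesis p_sum : forall i, \sum_(j < i.+2) p i j = 1.
Hypothesis p_up : forall i, 0 < p i i.+1.
Hypothesis p_skipfree : forall i j, (i.+1 < j)%N -> p i j = 0.
Hypothesis X_markov : markov_jump_process P Q 0 X.
Local Notation ell := (real_occupation n X).
Variable a : nat.
Hypothesis b_lt : (a.+1 < n)%N.
Local Notation rate := (- Q a a).
Hypothesis markov : finite_markov_chain P n (fun i => occupation_time X n i).
Local Notation f A C := (chain_density n rate_gt0 a A C).
Local Notation leb := (lebesgue_measure : {measure set RR -> \bar R}).

(** [h] is the kernel given the last time, evaluated at [C]; it does not depend on [A], because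
    almost surely it agrees with the kernel given the whole past. The null set may depend on [A]. *)
Lemma chain_density_factor C : measurable C -> exists h : R -> \bar R,
  forall A, (forall i, measurable (A i)) ->
    \forall s \ae leb, (f A C s)%:E = (h s * (f A setT s)%:E)%E.
Proof.
move=> mC.
have mC' : measurable (fine @^-1` C : set (\bar R)).
  by rewrite -[X in measurable X]setTI; exact: fine_measurable.
have k1 : (1 <= a.+1 <= n.-1)%N by rewrite /= -ltnS prednK// (leq_trans _ b_lt).
have [kp [kl [cp _ kpl]]] := markov k1.
exists (fun s => kl s%:E (fine @^-1` C)) => A mA.
have mh : measurable_fun [set: R] (fun s : R => kl s%:E (fine @^-1` C)).
  by apply: (measurableT_comp (measurable_kernel kl _ mC')).
suff : ae_eq leb setT (fun s => (f A C s)%:E)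
    (fun s => kl s%:E (fine @^-1` C) * (f A setT s)%:E)%E.
  by apply: filterS => s /(_ I).
apply: integral_ae_eq => //.
- apply/integrableP; split; first by apply/measurable_EFinP; exact: measurable_chain_density.
  under eq_integral do rewrite gee0_abs ?lee_fin ?chain_density_ge0//.
  rewrite -(chain_densityP rate_gt0 p_ge0 p_sum p_up p_skipfree X_markov b_lt)//.
  rewrite (le_lt_trans (probability_le1 _ _)) ?ltry//.
  apply: measurableI; first exact: (measurable_past_event n X_markov a).
  rewrite -[X in measurable X]setTI.
  by apply: (measurable_real_occupation n X_markov a.+1) => //.
- apply: emeasurable_funM => //.
  by apply/measurable_EFinP; exact: measurable_chain_density.
move=> E _ mE.
rewrite -(chain_densityP rate_gt0 p_ge0 p_sum p_up p_skipfree X_markov b_lt)//.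
rewrite -(ge0_integral_past_event rate_gt0 p_ge0 p_sum p_up p_skipfree X_markov b_lt)//.
(* [past] lists the times backwards: coordinate 0 is the time in [a], coordinate [i] the time in
   [a - i]. *)
pose D i := fine @^-1` (if i == 0%N then E else A (a - i)%N) : set (\bar R).
have mD i : measurable (D i).
  rewrite -[X in measurable X]setTI; apply: fine_measurable => //.
  by case: ifP.
have := cp (tuple_box D) (fine @^-1` C) (measurable_tuple_box mD) mC'.
have -> : past (fun i => occupation_time X n i) a.+1 @^-1` tuple_box D = past_event n X a A E.
  apply/seteqP; split => w /=.
    move=> wD; split.
      move=> i ia; have ai : (a - i < a.+1)%N by rewrite ltnS leq_subr.
      have := wD (Ordinal ai); rewrite tnth_mktuple /D/= subn_eq0 leqNgt ia/=.
      by rewrite subKn// ltnW.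
    by have := wD ord0; rewrite tnth_mktuple /D/= subn0.
  move=> [Aw Ew] i; rewrite tnth_mktuple /D/=; case: eqP => [->|/eqP i0].
    by rewrite subn0.
  by apply: Aw; move: (ltn_ord i) i0; lia.
move=> ->; apply: ge0_ae_eq_integral => //.
- exact: (measurable_past_event n X_markov a).
- apply: measurable_funTS; apply: (measurableT_comp (measurable_kernel kp _ mC')).
  by apply: measurable_past => i; have [mX rX _] := X_markov; exact: measurable_occupation_time.
- apply: measurable_funTS; apply: (measurableT_comp mh).
  exact: (measurable_real_occupation n X_markov a).
have aeell := ae_real_occupation n rate_gt0 p_ge0 p_sum p_up p_skipfree X_markov.
apply: filterS2 aeell kpl => w lE kE _.
by rewrite kE// lE.
Qed.

Local Notation allT := (fun=> setT : set R).

Let mT : forall i : nat, measurable (allT i). Proof. by []. Qed.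

(** Both sides equal [h s] times f(A, T) f(T, T), for the common factor [h] of
    [chain_density_factor]. *)
Lemma chain_density_product A C : (forall i, measurable (A i)) -> measurable C ->
  \forall s \ae leb, f A C s * f allT setT s = f A setT s * f allT C s.
Proof.
move=> mA mC; have [h hE] := chain_density_factor mC.
have h1 := hE A mA; have h2 := hE allT mT. apply: (@filterS2 _ _ (ae_filter_ringOfSetsType leb) _ _ _ _ h1 h2) => s sA sT.
apply/eqP; rewrite -eqe !EFinM sA sT; apply/eqP.
by rewrite [(h s * (f A _ s)%:E)%E]muleC -muleA.
Qed.

Local Notation W g k := (visit_weight Q n a g k).
Local Notation cst1 := (fun _ : nat -> nat => 1 : R).
Local Notation straight := (straight_below R a 0).
Local Notation once := (once_b R a).

Let u1 : unitfun cst1. Proof. exact: unitfun1. Qed.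
Let us : unitfun straight. Proof. exact: unitfun_straight. Qed.
Let uo : unitfun once. Proof. exact: unitfun_once_b. Qed.

Let weightsW g k : unitfun g -> unitfun k -> weights (W g k).
Proof. exact: (weights_visit n p_ge0 p_sum). Qed.

Lemma below_lawT : below_law rate_gt0 a allT = cst1.
Proof.
apply/funext => c; rewrite /below_law big1// => i _.
by rewrite probability_setT.
Qed.

Lemma next_lawT : next_law rate_gt0 a setT = cst1.
Proof. by apply/funext => c; rewrite /next_law probability_setT. Qed.

(** The combination may reach 2, so everything is halved to stay within [in01]. *)
Lemma hit_le_comb F F1 F2 (x y : R) : in01 F -> in01 F1 -> in01 F2 ->
  0 <= x <= 1 -> 0 <= y <= 1 ->
  (forall t c, (forall l, (l < n)%N -> (0 < c l)%N) -> F t c <= x * F1 t c + y * F2 t c) ->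
  hit p (pred1 n) 0 F <= x * hit p (pred1 n) 0 F1 + y * hit p (pred1 n) 0 F2.
Proof.
move=> F01 F101 F201 /andP[x0 x1] /andP[y0 y1] FF.
have half (z : R) (H : nat -> (nat -> nat) -> R) : 0 <= z -> z <= 1 -> in01 H -> forall t c, 0 <= z / 2 * H t c <= 2^-1.
  move=> z0 z1 H01 t c; have /andP[? ?] := H01 t c; rewrite mulr_ge0 ?divr_ge0//=.
  rewrite mulrAC -[leRHS]mul1r ler_wpM2r ?invr_ge0//; exact: mulr_ile1.
have half01 (z : R) (H : nat -> (nat -> nat) -> R) : 0 <= z -> z <= 1 -> in01 H -> in01 (fun t c => z / 2 * H t c).
  move=> z0 z1 H01 t c; have /andP[-> /= h] := half z H z0 z1 H01 t c.
  by apply: le_trans h _; rewrite invf_le1// ler1n.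
have H1 := half01 x F1 x0 x1 F101; have H2 := half01 y F2 y0 y1 F201.
have H0 := half01 1 F ler01 (lexx 1) F01.
have := @ler_hit_all_visited R p n a p_ge0 p_sum b_lt (fun t c => 1 / 2 * F t c)
  (fun t c => x / 2 * F1 t c + y / 2 * F2 t c) H0.
rewrite (hitD _ p_ge0 p_sum)// !(hitZ _ p_ge0 p_sum)// => H.
suff : 1 / 2 * hit p (pred1 n) 0 F <=
  x / 2 * hit p (pred1 n) 0 F1 + y / 2 * hit p (pred1 n) 0 F2 by lra.
apply: H => t c.
  have /andP[? ?] := half x F1 x0 x1 F101 t c; have /andP[? ?] := half y F2 y0 y1 F201 t c.
  by apply/andP; split; lra.
by move=> /FF ?; rewrite !(mulrAC _ 2^-1) mul1r -mulrDl ler_pM2r ?invr_gt0.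
Qed.

Section window.
Variables (e eta : R).
Hypothesis e_gt0 : 0 < e.
Hypothesis eta01 : 0 <= eta <= 1.
Hypothesis rate_eta : forall i, (i <= a.+1)%N -> - Q i i * e <= eta.
Local Notation win := `[0, e]%classic.
Local Notation gA := (below_law rate_gt0 a (fun=> win)).
Local Notation kC := (next_law rate_gt0 a win).
Let G : R := \prod_(i < a) window_prob rate_gt0 e i 1.
Let K : R := window_prob rate_gt0 e a.+1 1.

Let mwin : measurable (win : set R). Proof. exact: measurable_itv. Qed.

Let ugA : unitfun gA. Proof. by apply: unitfun_below_law. Qed.
Let ukC : unitfun kC. Proof. exact: unitfun_next_law. Qed.

Let G_gt0 : 0 < G.
Proof. by apply: prodr_gt0 => i _; exact: window_prob1_gt0. Qed.

Let K_gt0 : 0 < K. Proof. exact: window_prob1_gt0. Qed.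

Let G_le1 : G <= 1.
Proof. by apply: prodr_ile1 => i _; exact: fine_glaw01. Qed.

Let K_le1 : K <= 1.
Proof. by have /andP[] := fine_glaw01 rate_gt0 a.+1 1 mwin. Qed.

Let eta0 : 0 <= eta. Proof. by have /andP[] := eta01. Qed.
Let eta1 : eta <= 1. Proof. by have /andP[] := eta01. Qed.

(** Paths that are straight below and visit [a.+1] once satisfy both window constraints with
    probability exactly [G * K]. *)
Lemma window_weight_ge m : W straight once m <= (G * K)^-1 * W gA kC m.
Proof.
rewrite mulrC ler_pdivlMr ?mulr_gt0// mulrC.
have PS : in01 (prod3 a straight m.+1 once) by exact: in01_prod3.
rewrite /visit_weight -(hitZ _ p_ge0 p_sum)//.
apply: (ler_hit_all_visited p_ge0 p_sum b_lt).
- move=> t c; have /andP[? ?] := PS t c.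
  have ? : 0 <= G * K by rewrite mulr_ge0 ?ltW.
  by rewrite mulr_ge0//= mulr_ile1// mulr_ile1// ltW.
- exact: in01_prod3.
move=> t c _; rewrite /prod3 /once_b.
case: eqP => [_|_]; last first.
  by rewrite !mulr0 !mul0r mulr0.
have /andP[g0 _] := ugA c; have /andP[k0 _] := ukC c.
rewrite /straight_below; case: forallP => [c0|_]; last by rewrite !mul0r mulr0 !mulr_ge0.
case: eqP => [c1|_]; last by rewrite !mulr0 !mulr_ge0.
rewrite !mulr1 /next_law /below_law c1 -/(window_prob rate_gt0 e a.+1 1) -/K.
under eq_bigr => i _ do rewrite (eqP (c0 i)) -/(window_prob rate_gt0 e i 1).
exact: lexx.
Qed.

Lemma window_weight_below_le m :
  W gA cst1 m <= G * W straight cst1 m + (G * eta) * W cst1 cst1 m.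
Proof.
apply: hit_le_comb.
- exact: in01_prod3.
- exact: in01_prod3.
- exact: in01_prod3.
- by rewrite (ltW G_gt0)/=.
- by rewrite mulr_ge0 ?(ltW G_gt0)//= mulr_ile1// ltW.
move=> t c c0; rewrite /prod3 !mulr1 mul1r; case: eqP => _; last by rewrite !mulr0 addr0.
rewrite !mulr1 -mulrDr; apply: prod_window_prob_le => //; first exact: ltW.
  by move=> i ia; apply: rate_eta; rewrite ltnW// ltnS ltnW.
by move=> i ia; apply: c0; rewrite (ltn_trans ia)// ltnW.
Qed.

Lemma window_weight_next_le m :
  W cst1 kC m <= K * W cst1 once m + (K * eta) * W cst1 cst1 m.
Proof.
apply: hit_le_comb.
- exact: in01_prod3.
- exact: in01_prod3.
- exact: in01_prod3.
- by rewrite (ltW K_gt0)/=.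
- by rewrite mulr_ge0 ?(ltW K_gt0)//= mulr_ile1// ltW.
move=> t c c0; rewrite /prod3 !mul1r; case: eqP => _; last by rewrite !mul0r !mulr0 addr0.
rewrite !mul1r mulr1 -mulrDr.
have re1 : - Q a.+1 a.+1 * e <= 1 by apply: le_trans eta1; exact: rate_eta.
apply: (le_trans (window_prob_le rate_gt0 (ltW e_gt0) re1 (c0 _ b_lt))).
by rewrite ler_wpM2l ?window_prob_ge0// lerD2l rate_eta.
Qed.

(** f(A, C) is bounded from below, f(A, T) and f(T, C) from above. Both sides then carry [G * K],
    which cancels and leaves [eta] as the only trace of the window. *)
Lemma window_density_le s : 0 <= s ->
  f (fun=> win) win s * f allT setT s = f (fun=> win) setT s * f allT win s ->
  let x := rate * s in
  wexp (W straight once) x * wexp (W cst1 cst1) x <=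
  (wexp (W straight cst1) x + eta * wexp (W cst1 cst1) x) *
  (wexp (W cst1 once) x + eta * wexp (W cst1 cst1) x).
Proof.
move=> s0; rewrite /chain_density /visit_density s0 below_lawT next_lawT.
set x := rate * s; have x0 : 0 <= x by rewrite mulr_ge0// ltW.
set D := rate * expR _; have D0 : 0 < D by rewrite mulr_gt0// expR_gt0.
move=> fE /=.
have {}fE : wexp (W gA kC) x * wexp (W cst1 cst1) x = wexp (W gA cst1) x * wexp (W cst1 kC) x.
  apply: (mulfI (lt0r_neq0 D0)); apply: (mulfI (lt0r_neq0 D0)).
  by move: fE; lra.
have ge0 m : W straight once m <= (G * K)^-1 * W gA kC m + 0 * W gA kC m.
  by rewrite mul0r addr0; exact: window_weight_ge.
have := wexp_le_lin (weightsW us uo) (weightsW ugA ukC) (weightsW ugA ukC) ge0 x0.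
have := wexp_le_lin (weightsW ugA u1) (weightsW us u1) (weightsW u1 u1) window_weight_below_le x0.
have := wexp_le_lin (weightsW u1 ukC) (weightsW u1 uo) (weightsW u1 u1) window_weight_next_le x0.
have := wexp_ge0 (weightsW u1 u1) x0; have := wexp_ge0 (weightsW ugA u1) x0.
have := wexp_ge0 (weightsW u1 ukC) x0.
move: fE; set AC := wexp (W gA kC) x; set TT := wexp (W cst1 cst1) x.
set AT := wexp (W gA cst1) x; set TC := wexp (W cst1 kC) x.
set Y1 := wexp (W straight once) x; set Y2 := wexp (W straight cst1) x.
set Y3 := wexp (W cst1 once) x => fE TC0 AT0 TT0 TCle ATle Yle.
rewrite mul0r addr0 in Yle.
have GK0 : 0 < G * K by rewrite mulr_gt0.
rewrite -(ler_pM2l GK0); apply: (@le_trans _ _ (AC * TT)).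
  rewrite mulrA ler_wpM2r// -ler_pdivlMl//.
rewrite fE; apply: (le_trans (ler_pM AT0 TC0 ATle TCle)).
by rewrite le_eqVlt; apply/orP; left; apply/eqP; ring.
Qed.

End window.

(** The countable sequence of windows gives a single null set; off it, [N] tends to infinity at
    fixed [s]. *)
Lemma density_le_ae : \forall s \ae leb, 0 <= s ->
  let x := rate * s in
  wexp (W straight once) x * wexp (W cst1 cst1) x <=
  wexp (W straight cst1) x * wexp (W cst1 once) x.
Proof.
(* [S] exceeds every rate up to [a.+1], so [e N] makes each product of rate and window at most
   [1 / N.+1]. *)
pose S := 1 + \sum_(i < a.+2) - Q i i.
have S0 : 0 < S by rewrite ltr_pwDl// sumr_ge0// => i _; exact: ltW.
pose e N := (N.+1%:R * S)^-1.
have e0 N : 0 < e N by rewrite invr_gt0 mulr_gt0.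
have eta01 N : 0 <= (N.+1%:R^-1 : R) <= 1 by rewrite invr_ge0 ler0n/= invf_le1// ler1n.
have re N i : (i <= a.+1)%N -> - Q i i * e N <= N.+1%:R^-1.
  move=> ia; rewrite /e invfM mulrCA ler_piMr ?invr_ge0// ler_pdivrMr// mul1r.
  have ia' : (i < a.+2)%N by [].
  rewrite /S (bigD1 (Ordinal ia'))//= addrCA lerDl addr_ge0// sumr_ge0// => j _.
  exact: ltW.
have mwin N : measurable (`[0, e N]%classic : set R) by exact: measurable_itv.
have H : \forall s \ae leb, forall N,
    f (fun=> `[0, e N]%classic) `[0, e N]%classic s * f allT setT s =
    f (fun=> `[0, e N]%classic) setT s * f allT `[0, e N]%classic s.
  by apply/ae_foralln => N; apply: chain_density_product.
apply: (@filterS _ _ (ae_filter_ringOfSetsType leb) _ _ _ H) => s fE s0.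
set x := rate * s => /=; have x0 : 0 <= x by rewrite mulr_ge0// ltW.
rewrite -subr_le0; set T := wexp (W cst1 cst1) x.
set Y2 := wexp (W straight cst1) x; set Y3 := wexp (W cst1 once) x.
have T0 : 0 <= T by exact: wexp_ge0 (weightsW u1 u1) x0.
(* Expanding the product gives [eta * T * (Y2 + Y3)] and [eta^2 * T^2]; the latter is at most
   [eta * T^2]. *)
apply: (@le0_archi _ _ (T * Y2 + T * Y3 + T * T)) => N.
have := window_density_le (e0 N) (eta01 N) (@re N) s0 (fE N).
rewrite /= -/x -/T -/Y2 -/Y3; have /andP[] := eta01 N.
set eta := (N.+1%:R^-1 : R); move: (wexp _ _) => Y1 h0 h1 h.
rewrite lerBlDl; apply: le_trans h _.
have : eta * eta * (T * T) <= eta * (T * T).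
  by rewrite ler_wpM2r ?mulr_ge0// ler_piMl.
lra.
Qed.

Lemma jump_prob_eq0 j : (j < a)%N -> p a.+1 j = 0.
Proof.
move=> ja; apply/eqP; rewrite eq_sym; apply: contrapT => /negP pj.
have {}pj : 0 < p a.+1 j by rewrite lt_neqAle pj p_ge0.
have pd i : p i i = 0 by rewrite /jump_prob eqxx.
have eqn : W straight once 0 * W cst1 cst1 0 = W straight cst1 0 * W cst1 once 0.
  exact: (excursion_identity p_ge0 p_sum p_up pd b_lt).
have lt : W straight cst1 0 * W cst1 once 1 + W straight cst1 1 * W cst1 once 0 <
    W straight once 0 * W cst1 cst1 1.
  exact: (excursion_inequality p_ge0 p_sum p_up pd b_lt ja pj).
(* Gap between the coefficients of order 1, against which the remainders of order 2 are weighed. *)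
pose D := W straight once 0 * W cst1 cst1 1 -
  (W straight cst1 0 * W cst1 once 1 + W straight cst1 1 * W cst1 once 0).
have D0 : 0 < D by rewrite subr_gt0.
pose E : R := expR 1.
have E0 : 0 < E by exact: expR_gt0.
(* Bounds the coefficient of [x^2] for [x <= 1]: 1 for [b1 * c1], [2 * E] for each cross term with a
   tail, [E ^+ 2] for the product of the tails. *)
pose M := 1 + 4 * E + E ^+ 2.
have M0 : 0 < M by rewrite /M; nra.
(* Expressed in [s], hence the division by [rate]; it ensures [x < 1] and [x * M < D]. *)
pose delta := Num.min 1 (D / M) / rate.
have delta0 : 0 < delta by rewrite divr_gt0// lt_min ltr01 divr_gt0.
have [s /andP[s0 sdelta] /(_ (ltW s0))] := ae_exists_small delta0 density_le_ae.
move: sdelta; rewrite ltr_pdivlMr// mulrC lt_min => /andP[x1 xD] /=.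
move: x1 xD; set x := rate * s => x1 xD.
have x0 : 0 < x by rewrite mulr_gt0.
have := wexp_ge_lin (weightsW us uo) (ltW x0); have := wexp_ge_lin (weightsW u1 u1) (ltW x0).
have := wexp_le_quad (weightsW us u1) (ltW x0); have := wexp_le_quad (weightsW u1 uo) (ltW x0).
have := wexp_ge0 (weightsW us u1) (ltW x0); have := wexp_ge0 (weightsW u1 uo) (ltW x0).
have EE : expR x <= E by rewrite ler_expR ltW.
move: xD; rewrite ltr_pdivlMr// => xD.
have := weightsW us uo 0; have := weightsW us uo 1.
have := weightsW u1 u1 0; have := weightsW u1 u1 1.
have := weightsW us u1 0; have := weightsW us u1 1.
have := weightsW u1 uo 0; have := weightsW u1 uo 1.
move: eqn xD; rewrite /D.
set a0 := W straight once 0; set a1 := W straight once 1.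
set t0 := W cst1 cst1 0; set t1 := W cst1 cst1 1.
set b0 := W straight cst1 0; set b1 := W straight cst1 1.
set c0 := W cst1 once 0; set c1 := W cst1 once 1.
set Y1 := wexp (W straight once) x; set T := wexp (W cst1 cst1) x.
set Y2 := wexp (W straight cst1) x; set Y3 := wexp (W cst1 once) x.
move=> eqn xD /andP[c1p c1l] /andP[c0p c0l] /andP[b1p b1l] /andP[b0p b0l].
move=> /andP[t1p t1l] /andP[t0p t0l] /andP[a1p a1l] /andP[a0p a0l] Y30 Y20 Y3l Y2l Tl Y1l.
move=> YY.
have EE0 := expR_gt0 x.
have low : (a0 + a1 * x) * (t0 + t1 * x) <= Y1 * T.
  by apply: ler_pM => //; rewrite addr_ge0// mulr_ge0// ltW.
have up : Y2 * Y3 <= (b0 + b1 * x + x ^+ 2 * E) * (c0 + c1 * x + x ^+ 2 * E).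
  apply: ler_pM => //.
    by apply: le_trans Y2l _; rewrite lerD2l ler_wpM2l// exprn_ge0// ltW.
  by apply: le_trans Y3l _; rewrite lerD2l ler_wpM2l// exprn_ge0// ltW.
have b01 : b0 + b1 * x <= 2 by nra.
have c01 : c0 + c1 * x <= 2 by nra.
have quad : (b0 + b1 * x + x ^+ 2 * E) * (c0 + c1 * x + x ^+ 2 * E) <=
    b0 * c0 + (b0 * c1 + b1 * c0) * x + x ^+ 2 * M.
  rewrite -subr_ge0 /M (_ : _ - _ = x ^+ 2 * ((1 - b1 * c1) + E * (2 - (b0 + b1 * x)) +
    E * (2 - (c0 + c1 * x)) + E ^+ 2 * (1 - x ^+ 2))); last by ring.
  have h1 : 0 <= 1 - b1 * c1 by rewrite subr_ge0 mulr_ile1.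
  have h2 : 0 <= E * (2 - (b0 + b1 * x)) by rewrite mulr_ge0 ?subr_ge0// ltW.
  have h3 : 0 <= E * (2 - (c0 + c1 * x)) by rewrite mulr_ge0 ?subr_ge0// ltW.
  have h4 : 0 <= E ^+ 2 * (1 - x ^+ 2).
    by rewrite mulr_ge0 ?exprn_ge0 ?subr_ge0 ?exprn_ile1// ltW.
  rewrite mulr_ge0 ?exprn_ge0 ?(ltW x0)//; do 3 apply: addr_ge0 => //.
have := le_trans (le_trans (le_trans low YY) up) quad.
have : 0 <= (a1 * t0) * x + a1 * t1 * x ^+ 2.
  by rewrite addr_ge0 ?mulr_ge0 ?exprn_ge0// ltW.
have : x * (x * M) < x * (a0 * t1 - (b0 * c1 + b1 * c0)) by rewrite ltr_pM2l.
move: eqn; rewrite !expr2; lra.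
Qed.

End markov_implies_tridiagonal.

(** * Transition kernels in the tridiagonal case *)

Section tuple_measure.
Context d (T : measurableType d) (R : realType) (k : nat).

Lemma measurable_tupleE :
  (measurable : set (set (k.-tuple T))) =
  <<s [set B | exists2 D : nat -> set T, (forall i, measurable (D i)) & B = tuple_box D] >>.
Proof.
apply/seteqP; split.
  apply: smallest_sub; first exact: smallest_sigma_algebra.
  move=> B; rewrite -bigcup_seq => -[i _ [C mC <-]]; apply: sub_sigma_algebra.
  exists (fun j => if j == i :> nat then C else setT).
    by move=> j; case: ifP.
  rewrite setTI; apply/seteqP; split => t /=.
    by move=> tC j; case: eqP => // /val_inj ->.
  by move=> /(_ i); rewrite eqxx.
apply: smallest_sub; first exact: sigma_algebra_measurable.
by move=> B [D mD ->]; exact: measurable_tuple_box.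
Qed.

(** Boxes are stable under intersection and generate, so conditional laws given the past need
    checking on boxes only. *)
Lemma tuple_measure_unique (m1 m2 : {measure set (k.-tuple T) -> \bar R}) :
  (m1 setT < +oo)%E ->
  (forall D : nat -> set T, (forall i, measurable (D i)) ->
    m1 (tuple_box D) = m2 (tuple_box D)) ->
  forall B, measurable B -> m1 B = m2 B.
Proof.
move=> m1T m12 B mB.
have boxT : tuple_box (fun=> setT : set T) = [set: k.-tuple T] by apply/seteqP; split.
apply: (measure_unique _ (fun=> setT) measurable_tupleE) => //.
- move=> _ _ [D mD ->] [D' mD' ->]; exists (fun i => D i `&` D' i).
    by move=> i; exact: measurableI.
  apply/seteqP; split => t /=; first by move=> [tD tD'] i; split; [exact: tD|exact: tD'].
  by move=> tDD; split => i; have [] := tDD i.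
- by move=> _; exists (fun=> setT) => //; rewrite boxT.
- by apply/seteqP; split => // t _; exists 0%N.
- by move=> _ [D mD ->]; exact: m12.
Qed.

End tuple_measure.

Section integral_measure.
Context d (T : measurableType d) (R : realType) (mu : {measure set T -> \bar R}).
Variable f : T -> \bar R.
Hypotheses (mf : measurable_fun setT f) (f0 : forall x, (0 <= f x)%E).

(* The proofs are arguments of the definition so that unification finds the
   measure structure declared below. *)
Definition integral_measure_def of measurable_fun setT f & (forall x, (0 <= f x)%E) :=
  fun A : set T => (\int[mu]_(x in A) f x)%E.
Local Notation im := (integral_measure_def mf f0).

Let im0 : im set0 = 0%E. Proof. by rewrite /im integral_set0. Qed.
Let im_ge0 A : (0 <= im A)%E. Proof. exact: integral_ge0. Qed.
Let im_sigma_additive : semi_sigma_additive im.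
Proof. exact: semi_sigma_additive_nng_induced. Qed.

HB.instance Definition _ := isMeasure.Build _ _ _ im im0 im_ge0 im_sigma_additive.

Definition integral_measure : {measure set T -> \bar R} := im.

End integral_measure.

Section scaled_kernel.
Context d d' (X : measurableType d) (Y : measurableType d') (R : realType).

Variables (r : X -> {nonneg R}) (nu : {measure set Y -> \bar R}).
Hypothesis mr : measurable_fun setT (fun x => (r x)%:num).

Definition scaled_measure of measurable_fun setT (fun x => (r x)%:num) :
  X -> {measure set Y -> \bar R} := fun x => mscale (r x) nu.

Let measurable_scaled_measure U : measurable U ->
  measurable_fun setT (scaled_measure mr ^~ U).
Proof.
move=> mU; rewrite /scaled_measure/= /mscale/=.
by apply: emeasurable_funM; [exact/measurable_EFinP|exact: measurable_cst].
Qed.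

HB.instance Definition _ := isKernel.Build _ _ X Y R (scaled_measure mr)
  measurable_scaled_measure.

Definition scaled_kernel : R.-ker X ~> Y := scaled_measure mr.

End scaled_kernel.

Section above_sigma_additive.
Context (R : realType).
Variables (Q : nat -> nat -> R) (n a : nat).
Hypothesis rate_gt0 : forall i, 0 < - Q i i.
Local Notation p := (jump_prob Q).
Hypothesis p_ge0 : forall i j, 0 <= p i j.
Hypothesis p_sum : forall i, \sum_(j < i.+2) p i j = 1.

(** Countable additivity of [above] in its functional, one excursion at a time; it makes [above_law]
    a measure in the constraint on [a.+1]. *)
Lemma cvg_above_series D (k : nat -> (nat -> nat) -> R) F :
  (forall j, unitfun (k j)) -> unitfun F ->
  (forall c, (\sum_(j < N) k j c) @[N --> \oo] --> F c) ->
  (\sum_(j < N) above p n a D (k j)) @[N --> \oo] --> above p n a D F.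
Proof.
elim: D k F => [|D IH] k F k01 F01 kF.
- under eq_cvg do rewrite -mulr_sumr; apply: cvgM; first exact: cvg_cst.
  apply: (@cvg_hit_series R p (pred2 a n) p_ge0 p_sum
    (fun j t c => (t == n)%:R * k j c) (fun t c => (t == n)%:R * F c) a.+1) => [j t c||t c].
  + by rewrite mulr_ge0//; have /andP[] := k01 j c.
  + exact: (in01_above n a p_ge0 p_sum 0%N F01).
  + under eq_cvg do rewrite -mulr_sumr; apply: cvgM; first exact: cvg_cst.
    exact: kF.
- under eq_cvg do rewrite -mulr_sumr; apply: cvgM; first exact: cvg_cst.
  pose A (F : (nat -> nat) -> R) c := above p n a D (fun c' => F (fun l => (c l + c' l)%N)).
  apply: (@cvg_hit_series R p (pred2 a n) p_ge0 p_sum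
    (fun j t c => (t == a)%:R * A (k j) c) (fun t c => (t == a)%:R * A F c) a.+1) => [j t c||t c].
  + by rewrite mulr_ge0//; have /andP[] := above01 n a p_ge0 p_sum D (unitfun_add c (k01 j)).
  + exact: (in01_above n a p_ge0 p_sum D.+1 F01).
  + under eq_cvg do rewrite -mulr_sumr; apply: cvgM; first exact: cvg_cst.
    apply: (IH (fun j c' => k j (fun l => (c l + c' l)%N)) (fun c' => F (fun l => (c l + c' l)%N))).
    * by move=> j; exact: unitfun_add.
    * exact: unitfun_add.
    * by move=> c'; exact: kF.
Qed.

(* The absolute value only matters for non-measurable sets [B], on which
   measures have to be nonnegative too. *)
Definition above_law D (B : set (\bar R)) : \bar R :=
  `|above p n a D (next_law rate_gt0 a (EFin @^-1` B))|%:E.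

(** The hypotheses are arguments so that unification finds the measure structure, as for
    [integral_measure_def]. *)
Definition above_measure_def of (forall i j, 0 <= p i j) &
  (forall i, \sum_(j < i.+2) p i j = 1) := above_law.
Local Notation am := (above_measure_def p_ge0 p_sum).

Lemma measurable_EFin_preimage (B : set (\bar R)) : measurable B ->
  measurable (EFin @^-1` B : set R).
Proof. by move=> mB; rewrite -[X in measurable X]setTI; exact: EFin_measurable. Qed.

Let unit_next B : measurable B -> unitfun (next_law rate_gt0 a (EFin @^-1` B)).
Proof. by move=> /measurable_EFin_preimage; exact: unitfun_next_law. Qed.

Lemma above_zero D : above p n a D (fun=> 0) = 0.
Proof.
have H (G : nat -> (nat -> nat) -> R) : (forall t c, G t c = 0) -> hit p (pred2 a n) a.+1 G = 0.
  move=> G0; rewrite -[RHS](hit0 p (pred2 a n) a.+1); congr (hit _ _ _ _).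
  by apply/funext => t; apply/funext => c; rewrite G0.
by elim: D => [|D IH] /=; rewrite H ?mulr0// => t c; rewrite ?IH mulr0.
Qed.

Lemma above_lawE D B : measurable B ->
  above_law D B = (above p n a D (next_law rate_gt0 a (EFin @^-1` B)))%:E.
Proof.
move=> /unit_next/(above01 n a p_ge0 p_sum D)/andP[h _].
by rewrite /above_law ger0_norm.
Qed.

Let above_law0 D : am D set0 = 0%E.
Proof.
rewrite /above_measure_def /above_law preimage_set0 (_ : next_law _ _ _ = fun=> 0) ?above_zero ?normr0//.
by apply/funext => c; rewrite /next_law measure0.
Qed.

Let above_law_ge0 D B : (0 <= am D B)%E.
Proof. by rewrite /above_measure_def /above_law lee_fin normr_ge0. Qed.

Let above_law_sigma_additive D : semi_sigma_additive (am D).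
Proof.
move=> F mF tF mUF; rewrite /above_measure_def above_lawE//.
under eq_cvg => N.
  under eq_bigr => j _ do rewrite above_lawE//.
  rewrite sumEFin big_mkord; over.
apply/fine_cvgP; split; first exact: nearW.
apply: (@cvg_above_series D (fun j => next_law rate_gt0 a (EFin @^-1` F j))) => [j||c].
- exact: unit_next.
- exact: unit_next.
have mG j : measurable (EFin @^-1` F j : set R) by exact: measurable_EFin_preimage.
rewrite /next_law preimage_bigcup.
have fin B : measurable B -> glaw rate_gt0 a.+1 (c a.+1) B \is a fin_num.
  by move=> mB; apply: fin_num_measure.
have tG : trivIset setT (fun j => EFin @^-1` F j : set R).
  apply/trivIsetP => i j _ _ ij; move/trivIsetP : tF => /(_ i j I I ij) tF.
  by rewrite -preimage_setI tF preimage_set0.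
have mU : measurable (\bigcup_j (EFin @^-1` F j) : set R) by exact: bigcup_measurable.
have := @measure_semi_sigma_additive _ _ _ (glaw rate_gt0 a.+1 (c a.+1)) _ mG tG mU.
rewrite -[X in _ --> X](fineK (fin _ mU)) => /fine_cvg.
apply: cvg_trans; apply: near_eq_cvg; apply: nearW => N /=.
by rewrite big_mkord sum_fine// => j _; exact: (fin _ (mG j)).
Qed.

HB.instance Definition _ D := isMeasure.Build _ _ _ (am D) (above_law0 D)
  (above_law_ge0 D) (@above_law_sigma_additive D).

Definition above_measure D : {measure set (\bar R) -> \bar R} := am D.

(** The absolute value extends the coefficient to negative [y], where a kernel must exist too
    although the density vanishes. *)
Definition poisson_coeff D (y : R) : {nonneg R} := NngNum (exp_coeff_ge0 D (normr_ge0 (- Q a a * y))).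

Lemma measurable_poisson_coeff d (T : measurableType d) (f : T -> \bar R) D :
  measurable_fun setT f -> measurable_fun setT (fun x => (poisson_coeff D (fine (f x)))%:num).
Proof.
move=> mf /=.
rewrite (_ : (fun _ => _) = fun x => `|- Q a a * fine (f x)| ^+ D / D`!%:R); last first.
  by apply/funext => x; rewrite exp_coeff_pow.
apply: measurable_funM => //; apply: measurable_funX; apply: measurableT_comp => //.
apply: measurable_funM => //; apply: measurableT_comp => //.
Qed.

(* Unnormalised law of the time in [a.+1] given that the time in [a] is [f x]:
   the number [D] of excursions above [a] has the weight of a Poisson law. *)
Definition excursion_kernel d (T : measurableType d) (f : T -> \bar R)
    (mf : measurable_fun setT f) : R.-ker T ~> \bar R :=
  kseries (fun D => scaled_kernel (above_measure D) (measurable_poisson_coeff D mf)).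

(** The Dirac law is the fallback when the total mass cannot be normalised. A general [f] yields
    both kernels at once: [f] is the head for the past, the identity for the last time. *)
Definition excursion_pkernel d (T : measurableType d) (f : T -> \bar R)
    (mf : measurable_fun setT f) : R.-pker T ~> \bar R :=
  knormalize (excursion_kernel mf) (dirac 0%E).

End above_sigma_additive.

Section excursion_kernel.
Context (R : realType).
Variables (Q : nat -> nat -> R) (n a : nat).
Hypothesis rate_gt0 : forall i, 0 < - Q i i.
Local Notation p := (jump_prob Q).
Hypothesis p_ge0 : forall i j, 0 <= p i j.
Hypothesis p_sum : forall i, \sum_(j < i.+2) p i j = 1.
Context d (T : measurableType d) (f : T -> \bar R) (mf : measurable_fun setT f).
Local Notation ker := (excursion_kernel n a rate_gt0 p_ge0 p_sum mf).
Local Notation pker := (excursion_pkernel n a rate_gt0 p_ge0 p_sum mf).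

Definition above_weight (C : set R) D := above p n a D (next_law rate_gt0 a C).

Lemma weights_above C : measurable C -> weights (above_weight C).
Proof.
by move=> mC D; apply: above01 => //; exact: unitfun_next_law.
Qed.

Lemma excursion_kernelE x B : measurable B ->
  ker x B = (wexp (above_weight (EFin @^-1` B)) `|- Q a a * fine (f x)|)%:E.
Proof.
move=> mB; rewrite -wexpE//; last by apply: weights_above; exact: measurable_EFin_preimage.
apply: eq_eseriesr => D _; rewrite mulrC EFinM -above_lawE//.
Qed.

Lemma mnormalize_excursion_kernel x B :
  pker x B = mnormalize (ker x) (dirac (0%E : \bar R)) B.
Proof. by []. Qed.

(** Stated without division so as to cover total mass zero, where the right-hand side vanishes as
    well. *)
Lemma excursion_pkernelE x B : measurable B ->
  (pker x B * (wexp (above_weight setT) `|- Q a a * fine (f x)|)%:E)%E =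
  (wexp (above_weight (EFin @^-1` B)) `|- Q a a * fine (f x)|)%:E.
Proof.
move=> mB; rewrite -(preimage_setT EFin) -!excursion_kernelE//.
have fT : ker x setT \is a fin_num by rewrite excursion_kernelE.
have BT : (ker x B <= ker x setT)%E by apply: le_measure; rewrite ?inE.
rewrite mnormalize_excursion_kernel /mnormalize.
have [T0|T0] := eqVneq (ker x setT) 0%E.
  rewrite T0 mule0; apply/esym/eqP; rewrite eq_le measure_ge0 andbT.
  by apply: le_trans BT _; rewrite T0.
have [Too|_] /= := eqVneq (ker x setT) +oo%E; first by rewrite Too in fT.
rewrite -muleA -[X in (_ * (_ * X))%E]fineK// -EFinM mulVf ?mule1//.
by rewrite fine_eq0.
Qed.

End excursion_kernel.

Lemma eq_excursion_pkernel (R : realType) (Q : nat -> nat -> R) n a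
    (rate_gt0 : forall i, 0 < - Q i i) (p_ge0 : forall i j, 0 <= jump_prob Q i j)
    (p_sum : forall i, \sum_(j < i.+2) jump_prob Q i j = 1)
    d (T : measurableType d) (f : T -> \bar R) (mf : measurable_fun setT f)
    d' (T' : measurableType d') (g : T' -> \bar R) (mg : measurable_fun setT g) x y B :
  f x = g y -> measurable B ->
  excursion_pkernel n a rate_gt0 p_ge0 p_sum mf x B =
  excursion_pkernel n a rate_gt0 p_ge0 p_sum mg y B.
Proof.
move=> fg mB.
have E C : measurable C -> excursion_kernel n a rate_gt0 p_ge0 p_sum mf x C =
    excursion_kernel n a rate_gt0 p_ge0 p_sum mg y C.
  by move=> mC; rewrite !excursion_kernelE// fg.
rewrite !mnormalize_excursion_kernel /mnormalize (E _ measurableT).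
by case: ifP => // _; rewrite (E _ mB).
Qed.

Section tridiagonal_implies_markov.
Context d (Omega : measurableType d) (R : realType) (P : probability Omega R).
Variables (Q : nat -> nat -> R) (n : nat) (X : R -> Omega -> nat).
Hypothesis rate_gt0 : forall i, 0 < - Q i i.
Local Notation p := (jump_prob Q).
Local Notation mu := (@lebesgue_measure R).
Hypothesis p_ge0 : forall i j, 0 <= p i j.
Hypothesis p_sum : forall i, \sum_(j < i.+2) p i j = 1.
Hypothesis p_up : forall i, 0 < p i i.+1.
Hypothesis p_skipfree : forall i j, (i.+1 < j)%N -> p i j = 0.
Hypothesis X_markov : markov_jump_process P Q 0 X.
Local Notation ell := (real_occupation n X).
Local Notation occ := (occupation_time X n).
Variable a : nat.
Hypothesis b_lt : (a.+1 < n)%N.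
Hypothesis no_jump_over :
  forall i j, (a < i)%N -> (i < n)%N -> (j < a)%N -> p i j = 0.
Local Notation rate := (- Q a a).
Local Notation f A C := (chain_density n rate_gt0 a A C).

(** The binomial coefficients of [hit_prod3] are those of a product of exponential generating
    functions, by [wexpM]. *)
Lemma chain_density_split A C s : (forall i, measurable (A i)) -> measurable C -> 0 <= s ->
  f A C s = rate * expR (- rate * s) *
    (wexp (fun E => to_below p a 0 E (below_law rate_gt0 a A)) (rate * s) *
     wexp (above_weight n a rate_gt0 C) (rate * s)).
Proof.
move=> mA mC s0; rewrite /chain_density /visit_density s0; congr (_ * _).
have g01 := unitfun_below_law rate_gt0 a mA; have k01 := unitfun_next_law rate_gt0 a mC.
apply: wexpM.
- exact: weights_chain.
- by move=> E; exact: to_below01.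
- exact: weights_above.
- move=> m; rewrite /visit_weight hit_prod3//.
  + by move=> i; rewrite /jump_prob eqxx.
  + exact: ltnW.
  + exact: local_below_below_law.
  + exact: local_above_next_law.
- by rewrite mulr_ge0// ltW.
Qed.

Section kernel_density.
Context d' (T : measurableType d') (g : T -> \bar R) (mg : measurable_fun setT g).
Local Notation pker := (excursion_pkernel n a rate_gt0 p_ge0 p_sum mg).

(** For [s >= 0] the factor carrying [A] is common to both sides and the normalisation of the kernel
    absorbs the other; for [s < 0] both densities vanish. *)
Lemma chain_density_kernel A B x s : (forall i, measurable (A i)) -> measurable B ->
  g x = s%:E -> (pker x B * (f A setT s)%:E)%E = (f A (EFin @^-1` B) s)%:E.
Proof.
move=> mA mB gx; have mB' := measurable_EFin_preimage mB.
have [s0|s0] := leP 0 s; last first.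
  by rewrite /chain_density /visit_density leNgt s0 /= mule0.
rewrite !chain_density_split//.
have := excursion_pkernelE n a rate_gt0 p_ge0 p_sum mg x mB.
rewrite gx [fine _]/= ger0_norm ?mulr_ge0 ?(ltW (rate_gt0 a))// => H.
by rewrite ![rate * _ * (_ * _)]mulrA EFinM muleCA H -EFinM.
Qed.

End kernel_density.

Lemma measurable_occ i : measurable_fun setT (occ i).
Proof. by have [mX rX _] := X_markov; exact: measurable_occupation_time. Qed.

Let head : a.+1.-tuple (\bar R) -> \bar R := @tnth a.+1 (\bar R) ^~ ord0.

Let measurable_head : measurable_fun setT head. Proof. exact: measurable_tnth. Qed.

Let head_past w : head (past occ a.+1 w) = occ a w.
Proof. by rewrite /head tnth_mktuple subn0. Qed.

Let kpast := excursion_pkernel n a rate_gt0 p_ge0 p_sum measurable_head.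
Let klast := excursion_pkernel n a rate_gt0 p_ge0 p_sum (@measurable_id _ (\bar R) setT).

Lemma past_cond_distribution : cond_distribution P (occ a.+1) (past occ a.+1) kpast.
Proof.
move=> B C mB mC; have mC' := measurable_EFin_preimage mC.
have mpast : measurable_fun setT (past occ a.+1) by apply: measurable_past; exact: measurable_occ.
have mO : measurable (occ a.+1 @^-1` C).
  by rewrite -[X in measurable X]setTI; exact: measurable_occ.
have mk : measurable_fun setT (fun w => kpast (past occ a.+1 w) C).
  by apply: (measurableT_comp (measurable_kernel kpast _ mC)).
have k0 w : (0 <= kpast (past occ a.+1 w) C)%E by exact: measure_ge0.
(* The two sides of the claim, as functions of [B], are measures on tuples, compared on boxes. *)
unshelve epose (m1 := pushforward (mrestr P mO) (past occ a.+1) : {measure set (a.+1.-tuple (\bar R)) -> \bar R}).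
  exact: mpast.
unshelve epose (m2 := pushforward (integral_measure P mk k0) (past occ a.+1) : {measure set (a.+1.-tuple (\bar R)) -> \bar R}).
  exact: mpast.
apply: (@tuple_measure_unique _ (\bar R) R a.+1 m1 m2 _ _ B mB).
  rewrite /m1 /= /pushforward /mrestr (le_lt_trans (probability_le1 _ _)) ?ltry//.
by rewrite preimage_setT setTI.
move=> D mD.
(* The box is read backwards, the past being listed from [a] down to 0. *)
pose A i : set R := EFin @^-1` D (a - i)%N; pose E : set R := EFin @^-1` D 0%N.
have mA i : measurable (A i) by exact: measurable_EFin_preimage.
have mE : measurable E by exact: measurable_EFin_preimage.
have mbox : measurable (past occ a.+1 @^-1` tuple_box D).
  by rewrite -[X in measurable X]setTI; have := mpast; apply => //; exact: measurable_tuple_box.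
have boxE w : (forall i, occ i w = (ell i w)%:E) ->
    (past occ a.+1 @^-1` tuple_box D) w <-> past_event n X a A E w.
  move=> oE; split=> /=.
    move=> wD; split.
      move=> i ia; have ai : (a - i < a.+1)%N by rewrite ltnS leq_subr.
      by have := wD (Ordinal ai); rewrite tnth_mktuple /A/= subKn ?oE// ltnW.
    by have := wD ord0; rewrite tnth_mktuple /= subn0 oE.
  move=> [Aw Ew] i; rewrite tnth_mktuple /= oE.
  have [i0|i0] := posnP i; first by rewrite i0 subn0.
  have ia : (a - i < a)%N by move: (ltn_ord i) i0; lia.
  by have := Aw _ ia; rewrite /A/= subKn// -ltnS.
have aeE := ae_real_occupation n rate_gt0 p_ge0 p_sum p_up p_skipfree X_markov.
have mpe : measurable (past_event n X a A E) by exact: (measurable_past_event n X_markov a).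
have mell i (G : set R) : measurable G -> measurable (ell i @^-1` G).
  by move=> mG; rewrite -[X in measurable X]setTI; apply: (measurable_real_occupation n X_markov i).
transitivity (P (past_event n X a A E `&` ell a.+1 @^-1` (EFin @^-1` C))).
  rewrite -[LHS]/(P (past occ a.+1 @^-1` tuple_box D `&` occ a.+1 @^-1` C)).
  apply: eq_measure_ae; [exact: measurableI|apply: measurableI => //; exact: mell|].
  apply: filterS aeE => w oE; split => -[/(boxE w oE) h1 h2]; split => //.
    by move: h2 => /=; rewrite oE.
  by rewrite /= oE.
rewrite (chain_densityP rate_gt0 p_ge0 p_sum p_up p_skipfree X_markov b_lt)//.
transitivity (\int[P]_(w in past_event n X a A E) klast (ell a w)%:E C)%E.
  have mphi : measurable_fun [set: R] (fun s : R => klast s%:E C).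
    by apply: (measurableT_comp (measurable_kernel klast _ mC)).
  rewrite (ge0_integral_past_event rate_gt0 p_ge0 p_sum p_up p_skipfree X_markov b_lt
    mA mE (phi := fun s => klast s%:E C))//.
  by apply: eq_integral => s _; rewrite chain_density_kernel.
rewrite -[RHS]/(\int[P]_(w in past occ a.+1 @^-1` tuple_box D) kpast (past occ a.+1 w) C)%E.
rewrite integral_mkcond [RHS]integral_mkcond.
apply: ge0_ae_eq_integral => //.
- apply/(measurable_restrictT _ mpe); apply: measurable_funTS.
  have mphi : measurable_fun [set: R] (fun s : R => klast s%:E C).
    by apply: (measurableT_comp (measurable_kernel klast _ mC)).
  exact: (measurableT_comp mphi (measurable_real_occupation n X_markov a)).
- by apply/(measurable_restrictT _ mbox); exact: measurable_funTS.
- by move=> w _; rewrite patchE; case: ifP.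
- by move=> w _; rewrite patchE; case: ifP.
apply: filterS aeE => w oE _; rewrite !patchE.
have -> : (w \in past occ a.+1 @^-1` tuple_box D) = (w \in past_event n X a A E).
  by apply/idP/idP => /set_mem /(boxE w oE) /mem_set.
case: ifP => // _; apply: eq_excursion_pkernel => //.
by rewrite head_past oE.
Qed.

Lemma kpast_klast w C : measurable C -> kpast (past occ a.+1 w) C = klast (occ a w) C.
Proof. by apply: eq_excursion_pkernel; rewrite head_past. Qed.

(** The kernel of the past sees only its head, so conditioning on the last time is the special case
    of events on the head. *)
Lemma last_cond_distribution : cond_distribution P (occ a.+1) (occ a) klast.
Proof.
move=> B C mB mC.
have -> : occ a @^-1` B = past occ a.+1 @^-1` (head @^-1` B).
  by apply/seteqP; split => w /=; rewrite head_past.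
have mhB : measurable (head @^-1` B).
  by rewrite -[X in measurable X]setTI; exact: measurable_head.
apply: etrans (past_cond_distribution mhB mC) _.
by apply: eq_integral => w _; exact: kpast_klast.
Qed.

Lemma occupation_markov_step :
  exists (kp : R.-pker (a.+1.-tuple (\bar R)) ~> (\bar R)) (kl : R.-pker (\bar R) ~> (\bar R)),
    [/\ cond_distribution P (occ a.+1) (past occ a.+1) kp,
        cond_distribution P (occ a.+1) (occ a) kl
      & {ae P, forall w, forall C, measurable C -> kp (past occ a.+1 w) C = kl (occ a w) C}].
Proof.
exists kpast, klast; split.
- exact: past_cond_distribution.
- exact: last_cond_distribution.
- by apply: nearW => w C; exact: kpast_klast.
Qed.

End tridiagonal_implies_markov.

(** * The equivalence *)

Theorem mainTheorem2 (R : realType) (d : measure_display)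
    (Omega : measurableType d) (P : probability Omega R)
    (Q : nat -> nat -> R) (X : R -> Omega -> nat) (n : nat)
    (Q_offdiag_ge0 : forall i j : nat, i <> j -> 0 <= Q i j)
    (Q_up : forall i : nat, 0 < Q i i.+1)
    (Q_skipfree : forall i j : nat, (i.+1 < j)%N -> Q i j = 0)
    (Q_rowsum : forall i : nat, \sum_(0 <= j < i.+2) Q i j = 0)
    (X_markov : markov_jump_process P Q 0 X)
    (n_ge3 : (3 <= n)%N) :
  finite_markov_chain P n (fun i => occupation_time X n i) <->
  is_tridiag_mx (upper_submatrix Q n).
Proof.
(* A zero row sum makes the rate the total jump intensity, which is positive thanks to the upward
   jump. *)
have rateE i : - Q i i = Q i i.+1 + \sum_(j < i) Q i j.
  have := Q_rowsum i; rewrite big_mkord big_ord_recr big_ord_recr/= => H; lra.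
have rate_gt0 i : 0 < - Q i i.
  rewrite rateE ltr_wpDr// sumr_ge0// => j _; apply: Q_offdiag_ge0.
  by apply/eqP; rewrite gtn_eqF.
have p_ge0 i j : 0 <= jump_prob Q i j.
  rewrite /jump_prob; case: eqP => // ji; rewrite divr_ge0 ?(ltW (rate_gt0 i))//.
  by apply: Q_offdiag_ge0 => ij; apply: ji.
have p_sum i : \sum_(j < i.+2) jump_prob Q i j = 1.
  rewrite big_ord_recr big_ord_recr/= {2}/jump_prob eqxx addr0 {2}/jump_prob gtn_eqF//.
  under eq_bigr => j _ do rewrite /jump_prob ltn_eqF//.
  by rewrite -mulr_suml -mulrDl addrC -rateE divff// lt0r_neq0.
have p_up i : 0 < jump_prob Q i i.+1 by rewrite /jump_prob gtn_eqF// divr_gt0.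
have p_skipfree i j : (i.+1 < j)%N -> jump_prob Q i j = 0.
  by move=> ij; rewrite /jump_prob Q_skipfree// mul0r; case: ifP.
split=> [markov i j ij|tridiag k /andP[k0 kn]].
- rewrite mxE; have [ltij|] := ltnP i.+1 j; first exact: Q_skipfree.
  move=> ji; have {ij}ji' : (j.+1 < i)%N by move: ij ji; lia.
  (* Below the subdiagonal the row is [a.+1] and the column [j < a]: the Markov property at
     [k = a.+1] excludes this entry. *)
  move: ji'; case: i {ji} => -[//|a] b_lt /= ja.
  have := jump_prob_eq0 rate_gt0 p_ge0 p_sum p_up p_skipfree X_markov b_lt markov (j := j).
  rewrite /jump_prob ltn_eqF ?(leq_trans ja)//; last exact: ltnW.
  move=> /(_ ja)/eqP; rewrite mulf_eq0 invr_eq0 [- Q _ _ == 0]gt_eqF// orbF.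
  by move=> /eqP.
- case: k k0 kn => // a _ an.
  have b_lt : (a.+1 < n)%N by move: an; lia.
  apply: (occupation_markov_step rate_gt0 p_ge0 p_sum p_up p_skipfree X_markov b_lt).
  move=> i j ai iltn ja; rewrite /jump_prob ltn_eqF; last exact: ltn_trans ai.
  have jn : (j < n)%N by move: ja b_lt; lia.
  have := tridiag (Ordinal iltn) (Ordinal jn); rewrite mxE /= => ->; first by rewrite mul0r.
  by move: ai ja; lia.
Qed.
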